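(* Let $\Lambda$ be a lattice in $\mathbb{R}^d\times\widehat{\mathbb{R}}^d\cong\mathbb{R}^{2d}$ with adjoint lattice $\Lambda^0$, and let $f_1,f_2,g_1,g_2\in M^1(\mathbb{R}^d)$. Then $$\sum_{\lambda\in\Lambda}V_{g_1}f_1(\lambda)\cdot\overline{V_{g_2}f_2(\lambda)}=|\Lambda|^{-1}\sum_{\lambda^0\in\Lambda^0}V_{g_1}g_2(\lambda^0)\cdot\overline{V_{f_1}f_2(\lambda^0)}.$$
   Context: Time-frequency shifts: for $(x,\omega)\in\mathbb{R}^{2d}$, $\pi(x,\omega)f(t)=e^{2\pi i\omega\cdot t}f(t-x)$. Short-time Fourier transform: $V_gf(x,\omega)=\langle f,\pi(x,\omega)g\rangle=\int_{\mathbb{R}^d}f(t)\overline{g(t-x)}e^{-2\pi i\omega\cdot t}\,dt$. Feichtinger's algebra: $M^1(\mathbb{R}^d)$ (also written $S_0(\mathbb{R}^d)$) is the space of $f$ (functions or tempered distributions) such that $\|f\|_{M^1}=\iint_{\mathbb{R}^{2d}}|V_gf(x,\omega)|\,dx\,d\omega<\infty$ for a fixed non-zero Schwartz function $g\in\mathcal{S}(\mathbb{R}^d)$; the space is independent of the choice of $g$. Lattices: a lattice $\Lambda\subset\mathbb{R}^{2d}$ is a discrete cocompact subgroup; $|\Lambda|$ is the Lebesgue measure of a fundamental domain of $\Lambda$. With $\Omega((x,\omega),(y,\eta))=x\cdot\eta-\omega\cdot y$, the adjoint lattice is $\Lambda^0=\{z\in\mathbb{R}^{2d}: e^{2\pi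 i\Omega(\lambda,z)}=1\ \text{for all }\lambda\in\Lambda\}$; equivalently, the set of $z$ for which $\pi(z)$ commutes with $\pi(\lambda)$ for all $\lambda\in\Lambda$. *)

(* Defs.v *)
From HB Require Import structures.
From mathcomp Require Import all_boot all_order all_algebra.
From mathcomp Require Import all_classical all_reals all_analysis.
From mathcomp Require Import complex ring_quotient.

Set Implicit Arguments.
Unset Strict Implicit.
Unset Printing Implicit Defensive.
Import Order.TTheory GRing.Theory Num.Theory.
Import numFieldNormedType.Exports.

Local Open Scope classical_set_scope.
Local Open Scope ring_scope.

Local Notation normc := ComplexField.Normc.normc.
Local Notation Re := complex.Re.
Local Notation Im := complex.Im.
Local Open Scope complex_scope.

Definition measure_rV_display : measure_display -> measure_display.
Proof. exact. Qed.

Section measurable_rV.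
Context {d : measure_display} {T : sigmaRingType d}.
Variable n : nat.

Let coord (i : 'I_n) (v : 'rV[T]_n) : T := v ord0 i.

Let rV_set0 : g_sigma_preimage coord set0.
Proof. exact: sigma_algebra0. Qed.

Let rV_setC A : g_sigma_preimage coord A -> g_sigma_preimage coord (~` A).
Proof. exact: sigma_algebraC. Qed.

Let rV_bigcup (F : (set 'rV[T]_n)^nat) :
  (forall i, g_sigma_preimage coord (F i)) ->
  g_sigma_preimage coord (\bigcup_i (F i)).
Proof. exact: sigma_algebra_bigcup. Qed.

HB.instance Definition _ := @isMeasurable.Build (measure_rV_display d)
  'rV[T]_n (g_sigma_preimage coord) rV_set0 rV_setC rV_bigcup.

End measurable_rV.

Lemma measurable_coord_rV d (T : sigmaRingType d) n (i : 'I_n) :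
  measurable_fun [set: 'rV[T]_n] (fun v => v ord0 i).
Proof.
move=> _ Y mY; rewrite setTI; apply: sub_sigma_algebra => /=.
rewrite -bigcup_seq/=; exists i => /=; first by rewrite mem_index_enum.
by exists Y => //; rewrite setTI.
Qed.

Lemma measurable_fun_rVP d1 d2 (T1 : measurableType d1)
    (T2 : measurableType d2) n (f : T1 -> 'rV[T2]_n) :
  measurable_fun [set: T1] f <->
  forall i, measurable_fun [set: T1] (fun x => f x ord0 i).
Proof.
split=> [mf i|mf].
  exact: (measurableT_comp (measurable_coord_rV _) mf).
move=> _ Y; rewrite setTI.
set G := [set Z : set 'rV[T2]_n | measurable (f @^-1` Z)].
suff : @measurable _ 'rV[T2]_n `<=` G by move=> /[apply].
apply: smallest_sub.
  split => /=.
  - by rewrite /G/= preimage_set0; exact: measurable0.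
  - by move=> A GA; rewrite /G/= setTD preimage_setC; exact: measurableC.
  - by move=> F GF; rewrite /G/= preimage_bigcup; exact: bigcupT_measurable.
rewrite -bigcup_seq => Z [i _ [A mA <-]]; rewrite setTI /G/=.
by have := mf i measurableT A mA; rewrite setTI.
Qed.

(* The library proves this inside a section, but the instance it registers for
   [m1 \x m2] is not inferred. *)
Lemma product_sigma_finite d1 d2 (T1 : measurableType d1)
    (T2 : measurableType d2) (R : realType)
    (m1 : {sigma_finite_measure set T1 -> \bar R})
    (m2 : {sigma_finite_measure set T2 -> \bar R}) :
  sigma_finite setT (m1 \x m2)%E.
Proof.
have /sigma_finiteP[F [TF ndF Foo]] := sigma_finiteT m1.
have /sigma_finiteP[G [TG ndG Goo]] := sigma_finiteT m2.
exists (fun n => F n `*` G n).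
  rewrite -setXTT TF TG predeqE => -[x y]; split.
    move=> [/= [n _ Fnx] [k _ Gky]]; exists (maxn n k) => //; split.
    - by move: x Fnx; exact/subsetPset/ndF/leq_maxl.
    - by move: y Gky; exact/subsetPset/ndG/leq_maxr.
  by move=> [n _ []/= ? ?]; split; exists n.
move=> k; have [? ?] := Foo k; have [? ?] := Goo k.
split; first exact: measurableX.
by rewrite product_measure1E// lte_mul_pinfty// ge0_fin_numE.
Qed.

Section volume.
Context {R : realType}.

Definition rV_cons n (p : measurableTypeR R * 'rV[R]_n) : 'rV[R]_n.+1 :=
  row_mx (p.1 : R)%:M p.2 : 'rV[R]_(1 + n).

Definition rV_uncons n (v : 'rV[R]_n.+1) : measurableTypeR R * 'rV[R]_n :=
  (v ord0 ord0, \row_j v ord0 (lift ord0 j)).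

Lemma rV_cons0 n (p : measurableTypeR R * 'rV[R]_n) :
  rV_cons p 0 ord0 = p.1.
Proof.
have := @row_mxEl R 1 1 n (p.1 : R)%:M p.2 ord0 ord0.
rewrite [RHS]mxE eqxx mulr1n => pE; rewrite -[RHS]pE.
by congr (row_mx _ _ _ _); exact/val_inj.
Qed.

Lemma rV_consS n (p : measurableTypeR R * 'rV[R]_n) j :
  rV_cons p 0 (lift ord0 j) = p.2 0 j.
Proof. by rewrite -rshift1 [LHS]row_mxEr. Qed.

Lemma rV_consK n : cancel (@rV_cons n) (@rV_uncons n).
Proof.
move=> [x v]; congr pair; first exact: rV_cons0.
by apply/rowP => j; rewrite mxE rV_consS.
Qed.

Lemma measurable_rV_cons n : measurable_fun [set: _] (@rV_cons n).
Proof.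
apply/measurable_fun_rVP => i; have [j ->|->] := unliftP ord0 i.
  rewrite (_ : (fun _ => _) = (fun v : 'rV[R]_n => v ord0 j) \o snd).
    apply: measurableT_comp; first exact: measurable_coord_rV.
    exact: measurable_snd.
  by apply/funext => p; exact: rV_consS.
rewrite (_ : (fun _ => _) = fst); first exact: measurable_fst.
by apply/funext => p; exact: rV_cons0.
Qed.

Lemma measurable_rV_uncons n : measurable_fun [set: _] (@rV_uncons n).
Proof.
apply/measurable_fun_pair => /=; first exact: measurable_coord_rV.
apply/measurable_fun_rVP => j.
rewrite [X in measurable_fun _ X](_ : _ =
    fun v : 'rV[R]_n.+1 => v ord0 (lift ord0 j)).
  exact: measurable_coord_rV.
by apply/funext => v; rewrite mxE.
Qed.

Section step.
Variables (n : nat) (m : {sigma_finite_measure set 'rV[R]_n -> \bar R}).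

Definition volume_step : set 'rV[R]_n.+1 -> \bar R :=
  pushforward (lebesgue_measure \x m)%E (@rV_cons n).

Let volume_step_measure : {measure set 'rV[R]_n.+1 -> \bar R} :=
  measure_function_pushforward__canonical__measure_function_Measure
    (lebesgue_measure \x m)%E (@measurable_rV_cons n).

Let volume_step0 : volume_step set0 = 0%E.
Proof. exact: (measure0 volume_step_measure). Qed.

Let volume_step_ge0 A : (0 <= volume_step A)%E.
Proof. exact: (measure_ge0 volume_step_measure). Qed.

Let volume_step_sigma_additive : semi_sigma_additive volume_step.
Proof. exact: (@measure_semi_sigma_additive _ _ _ volume_step_measure). Qed.

HB.instance Definition _ := isMeasure.Build _ _ _ volume_step
  volume_step0 volume_step_ge0 volume_step_sigma_additive.

Let volume_step_sigma_finite : sigma_finite setT volume_step.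
Proof.
have [F FT Foo] := product_sigma_finite
  (@lebesgue_measure R) m.
exists (fun k => @rV_uncons n @^-1` F k).
  by rewrite -preimage_bigcup -FT preimage_setT.
move=> k; have [mF Fk] := Foo k; split.
  by rewrite -[X in measurable X]setTI; exact: measurable_rV_uncons.
rewrite /volume_step /pushforward -comp_preimage.
by rewrite (_ : _ \o _ = id)// funeqE; exact: rV_consK.
Qed.

HB.instance Definition _ :=
  Measure_isSigmaFinite.Build _ _ _ volume_step volume_step_sigma_finite.

End step.

(* Lebesgue measure on R^n, as the n-fold product of Lebesgue measure on R;
   R^0 is a single point, of mass 1. *)
Fixpoint volume (n : nat) : {sigma_finite_measure set 'rV[R]_n -> \bar R} :=
  if n is k.+1 then volume_step (volume k)
  else \d_(0 : 'rV[R]_0).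

Lemma volume_box n (a b : 'rV[R]_n) : (forall i, a 0 i <= b 0 i) ->
  volume n [set v | forall i, a 0 i <= v 0 i <= b 0 i] =
  (\prod_i (b 0 i - a 0 i))%:E.
Proof.
elim: n a b => [|n IHn] a b ab.
  by rewrite big_ord0 /= diracE mem_set// => -[].
rewrite big_ord_recl /= /volume_step /pushforward.
pose a' : 'rV[R]_n := \row_j a 0 (lift ord0 j).
pose b' : 'rV[R]_n := \row_j b 0 (lift ord0 j).
have mbox : measurable
    [set v : 'rV[R]_n | forall i, a' 0 i <= v 0 i <= b' 0 i].
  rewrite [X in measurable X](_ : _ = \big[setI/setT]_(i < n)
      ((fun v : 'rV[R]_n => v ord0 i) @^-1` `[a' 0 i, b' 0 i]%classic)).
    apply: bigsetI_measurable => i _; rewrite -[X in measurable X]setTI.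
    exact: measurable_coord_rV.
  rewrite -bigcap_seq; apply/seteqP; split=> v /= H i.
    by move=> _; rewrite /= in_itv; exact: H.
  by have := H i (mem_index_enum i); rewrite /= in_itv.
rewrite (_ : _ @^-1` _ = `[a 0 0, b 0 0]%classic `*`
    [set v : 'rV[R]_n | forall i, a' 0 i <= v 0 i <= b' 0 i]).
  rewrite product_measure1E//= IHn; last by move=> i; rewrite !mxE.
  rewrite lebesgue_measure_itv/= lte_fin.
  rewrite (eq_bigr (fun i => b 0 (lift ord0 i) - a 0 (lift ord0 i))).
    case: ltP => // ba; rewrite mul0e.
    by rewrite (_ : a 0 0 = b 0 0) ?subrr ?mul0r//; apply/le_anti; rewrite ab.
  by move=> i _; rewrite !mxE.
apply/seteqP; split=> -[x v] /=.
  move=> H; split=> [|i]; first by have := H 0; rewrite rV_cons0 in_itv.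
  by rewrite !mxE; have := H (lift ord0 i); rewrite rV_consS.
rewrite in_itv => -[xab H] i; have [j ->|->] := unliftP ord0 i.
  by rewrite rV_consS; have := H j; rewrite !mxE.
by rewrite rV_cons0.
Qed.

End volume.

Section complex_integral_and_sum.
Context {R : realType}.

Section integral.
Context {disp : measure_display} {T : measurableType disp}.

Definition cmeasurable (f : T -> R[i]) : Prop :=
  measurable_fun setT (fun x => Re (f x)) /\
  measurable_fun setT (fun x => Im (f x)).

Definition cintegrable (mu : {measure set T -> \bar R}) (f : T -> R[i]) : Prop :=
  mu.-integrable setT (fun x => (Re (f x))%:E) /\
  mu.-integrable setT (fun x => (Im (f x))%:E).

Definition cintegral (mu : {measure set T -> \bar R}) (f : T -> R[i]) : R[i] :=
  (\int[mu]_x Re (f x)) +i* (\int[mu]_x Im (f x)).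

End integral.

Section sum.
Context {T : choiceType}.

(* Absolute (equivalently, unconditional) convergence over the index set S. *)
Definition csummable (S : set T) (F : T -> R[i]) : Prop :=
  summable S (fun l => (normc (F l))%:E).

(* Unordered sums; [fine] makes the value meaningless without summability. *)
Definition rsum (S : set T) (u : T -> R) : R :=
  fine (\esum_(l in S) (u^\+ l)%:E) - fine (\esum_(l in S) (u^\- l)%:E).

Definition csum (S : set T) (F : T -> R[i]) : R[i] :=
  rsum S (fun l => Re (F l)) +i* rsum S (fun l => Im (F l)).

End sum.
End complex_integral_and_sum.

Section time_frequency.
Context {R : realType} {d : nat}.

Local Notation time := 'rV[R]_d.
Local Notation phase := ('rV[R]_d * 'rV[R]_d)%type.

Definition dot (x y : time) : R := \sum_(i < d) x 0 i * y 0 i.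

(* s |-> e^{2 pi i s} *)
Definition cis2pi (s : R) : R[i] := cos (2 * pi * s) +i* sin (2 * pi * s).

Definition tfshift (z : phase) (f : time -> R[i]) : time -> R[i] :=
  fun t => cis2pi (dot z.2 t) * f (t - z.1).

Definition inner (f g : time -> R[i]) : R[i] :=
  cintegral (volume d) (fun t => f t * (g t)^*).

Definition stft (g f : time -> R[i]) (z : phase) : R[i] :=
  inner f (tfshift z g).

Lemma stftE g f x w : stft g f (x, w) =
  cintegral (volume d) (fun t => f t * (g (t - x))^* * cis2pi (- dot w t)).
Proof.
congr cintegral; apply/funext => t; rewrite /tfshift /=.
rewrite rmorphM -mulrA; congr (_ * _); rewrite [RHS]mulrC; congr (_ * _).
by rewrite /cis2pi mulrN cosN sinN.
Qed.

Fixpoint iter_partial (s : seq 'I_d) (u : time -> R) : time -> R :=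
  if s is i :: s' then fun x => 'D_(delta_mx 0 i) (iter_partial s' u) x else u.

(* Smoothness is the existence everywhere of all iterated partial derivatives:
   these are also required to be bounded, hence they are all Lipschitz. *)
Definition rschwartz (u : time -> R) : Prop := forall s : seq 'I_d,
  (forall i x, derivable (iter_partial s u) x (delta_mx 0 i)) /\
  (forall k : nat, exists M : R,
     forall x, `|x| ^+ k * `|iter_partial s u x| <= M).

Definition schwartz (f : time -> R[i]) : Prop :=
  rschwartz (fun x => Re (f x)) /\ rschwartz (fun x => Im (f x)).

(* The functions f for which psi |-> \int f psi is a tempered distribution. *)
Definition tempered_function (f : time -> R[i]) : Prop :=
  cmeasurable f /\
  forall psi, schwartz psi -> cintegrable (volume d) (fun t => f t * psi t).

(* Lebesgue measure on R^d x R^d. *)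
Definition phase_volume : set phase -> \bar R :=
  (volume d \x volume d)%E.

HB.instance Definition _ := Measure.on phase_volume.

(* Feichtinger's algebra, with window phi. All elements of M^1 are (classes
   a.e. of) functions. *)
Definition M1 (phi : time -> R[i]) : set (time -> R[i]) :=
  [set f | tempered_function f /\
    (\int[phase_volume]_z (normc (stft phi f z))%:E < +oo)%E].

Definition discrete_subgroup (L : zmodClosed phase) : Prop :=
  forall z, z \in L -> \forall w \near z, w \in L -> w = z.

Definition cocompact (L : zmodClosed phase) : Prop :=
  compact [set: quotient_topology (Quotient.quot L)].

Definition lattice (L : zmodClosed phase) : Prop :=
  discrete_subgroup L /\ cocompact L.

Definition fundamental_domain (L : zmodClosed phase) (D : set phase) : Prop :=
  measurable D /\ forall z, exists! w, D w /\ z - w \in L.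

(* Any two measurable fundamental domains of a lattice have the same measure. *)
Definition covolume (L : zmodClosed phase) : R :=
  fine (phase_volume (xget set0 [set D | fundamental_domain L D])).

Definition Omega (z w : phase) : R := dot z.1 w.2 - dot z.2 w.1.

Definition adjoint_lattice (L : zmodClosed phase) : set phase :=
  [set z | forall l, l \in L -> cis2pi (Omega l z) = 1].

End time_frequency.

(* Main.v *)
Require Import Defs.
From HB Require Import structures.
From mathcomp Require Import all_boot all_order all_algebra.
From mathcomp Require Import all_classical all_reals all_analysis.
From mathcomp Require Import complex ring_quotient measurable_realfun ring lra.

(** The identity is Poisson summation for the function F on phase space.

    Its Fourier transform with respect to the symplectic form Omega is computed
    by Moyal's identity ([moyal]): Parseval's identity in the frequency variable
    and a linear change of variables turn the integral of F against the
    character cis2pi (Omega z w) into G w. The characters trivial on the lattice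
    L are those with w in the adjoint lattice, so the periodization of F over L
    has the Fourier coefficients G w, up to the covolume, and its value at 0 is
    the sum of its Fourier series.

    Pointwise summation requires F to be continuous, and F and G to be summable
    over lattices. This is where M^1 enters. By Fourier inversion, each f in M^1
    agrees almost everywhere with an absolutely convergent superposition of
    time-frequency shifts of a modulated Gaussian, with coefficients proportional
    to its short-time Fourier transform ([M1_synth]). The short-time Fourier
    transform of two superpositions is dominated by a convolution of integrable
    functions with that of the Gaussian, so its local suprema are integrable
    ([amalgam_stft_synth2]), and therefore it is summable over any set of points
    whose mutual distances are bounded below ([amalgam_sum]).

    A discrete cocompact subgroup has a basis ([lattice_basis]): it spans because
    a functional vanishing on it would be bounded on the compact quotient, and
    a system of independent elements of least determinant generates it. The
    basis provides a fundamental cell, the dual basis of the adjoint lattice,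
    and trigonometric polynomials whose powers concentrate at the origin. The
    periodization of F minus its Fourier series is orthogonal to all of these
    and continuous at 0, so it vanishes there ([orth_eq0], [poisson]). *)

Set Implicit Arguments.
Unset Strict Implicit.
Unset Printing Implicit Defensive.
Import Order.TTheory GRing.Theory Num.Theory.
Import numFieldNormedType.Exports.

Local Open Scope classical_set_scope.
Local Open Scope complex_scope.
Local Open Scope ring_scope.
Local Notation normc := (@ComplexField.Normc.normc _).
Local Notation Re := complex.Re.
Local Notation Im := complex.Im.

(** * Complex numbers and complex-valued integrals *)

Section complex_numbers.
Context {R : realType}.
Implicit Types x y : R[i].

Lemma ReD x y : Re (x + y) = Re x + Re y. Proof. by case: x; case: y. Qed.
Lemma ImD x y : Im (x + y) = Im x + Im y. Proof. by case: x; case: y. Qed.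
Lemma ReN x : Re (- x) = - Re x. Proof. by case: x. Qed.
Lemma ImN x : Im (- x) = - Im x. Proof. by case: x. Qed.
Lemma ReM x y : Re (x * y) = Re x * Re y - Im x * Im y.
Proof. by case: x; case: y. Qed.
Lemma ImM x y : Im (x * y) = Re x * Im y + Im x * Re y.
Proof. by case: x; case: y. Qed.
Lemma ReJ x : Re (x^*) = Re x. Proof. by case: x. Qed.
Lemma ImJ x : Im (x^*) = - Im x. Proof. by case: x. Qed.
Definition ReImE := (ReD, ImD, ReN, ImN, ReM, ImM, ReJ, ImJ).

Lemma complexP x y : Re x = Re y -> Im x = Im y -> x = y.
Proof. by case: x => a b; case: y => c e /= -> ->. Qed.

Lemma normcE2 x : normc x = Num.sqrt (Re x ^+ 2 + Im x ^+ 2).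
Proof. by case: x. Qed.

Lemma normc_ge0 x : 0 <= normc x.
Proof. by rewrite normcE2 sqrtr_ge0. Qed.

Lemma normc_conj x : normc x^* = normc x.
Proof. by rewrite !normcE2 ReJ ImJ sqrrN. Qed.

Lemma normcM x y : normc (x * y) = normc x * normc y.
Proof. exact: ComplexField.Normc.normcM. Qed.

Lemma ler_normcD x y : normc (x + y) <= normc x + normc y.
Proof. exact: (@le_normcD R x y). Qed.

Lemma normcC (a : R) : normc a%:C = `|a|.
Proof. by rewrite normcE2 /= expr0n addr0 sqrtr_sqr. Qed.

Lemma normcN x : normc (- x) = normc x.
Proof. by rewrite !normcE2 ReN ImN !sqrrN. Qed.

Lemma normc_eq0 x : normc x = 0 -> x = 0.
Proof. exact: ComplexField.Normc.eq0_normc. Qed.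

Lemma normc0 : normc (0 : R[i]) = 0.
Proof. exact: ComplexField.Normc.normc0. Qed.

Lemma normc1 : normc (1 : R[i]) = 1.
Proof. exact: ComplexField.Normc.normc1. Qed.

Lemma ler_Re_normc x : `|Re x| <= normc x.
Proof.
by rewrite normcE2 -sqrtr_sqr ler_sqrt ?addr_ge0 ?sqr_ge0// lerDl sqr_ge0.
Qed.

Lemma ler_Im_normc x : `|Im x| <= normc x.
Proof.
by rewrite normcE2 -sqrtr_sqr ler_sqrt ?addr_ge0 ?sqr_ge0// lerDr sqr_ge0.
Qed.

Lemma ler_normc_ReIm x : normc x <= `|Re x| + `|Im x|.
Proof.
rewrite normcE2 -(@ger0_norm _ (_ + `|Im x|)) ?addr_ge0// -sqrtr_sqr.
rewrite ler_sqrt ?sqr_ge0// sqrrD !real_normK ?num_real//.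
by rewrite lerD2r lerDl mulrn_wge0// mulr_ge0.
Qed.

Lemma normc_prod (I : Type) (s : seq I) (F : I -> R[i]) :
  normc (\prod_(i <- s) F i) = \prod_(i <- s) normc (F i).
Proof.
elim/big_ind2 : _ => //; first by rewrite normc1.
by move=> a b c e ab ce; rewrite normcM ab ce.
Qed.

Lemma mulcJ x : x * x^* = (normc x ^+ 2)%:C.
Proof.
apply: complexP; rewrite !ReImE normcE2 sqr_sqrtr ?addr_ge0 ?sqr_ge0//=; ring.
Qed.

Lemma conjcM x y : (x * y)^* = x^* * y^*.
Proof. by apply: complexP; rewrite !ReImE; ring. Qed.

Lemma conjcC (a : R) : (a%:C)^* = a%:C.
Proof. by apply: complexP => //=; rewrite oppr0. Qed.

Definition cvgc (u : nat -> R[i]) (l : R[i]) : Prop :=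
  ((fun n => Re (u n)) @ \oo --> Re l) /\ ((fun n => Im (u n)) @ \oo --> Im l).

Lemma cvgc_cst l : cvgc (fun=> l) l.
Proof. by split; exact: cvg_cst. Qed.

Lemma cvgcM u v k l : cvgc u k -> cvgc v l -> cvgc (fun n => u n * v n) (k * l).
Proof.
move=> [u1 u2] [v1 v2]; split; rewrite !ReImE.
- by under eq_fun do rewrite ReM; apply: cvgB; exact: cvgM.
- by under eq_fun do rewrite ImM; apply: cvgD; exact: cvgM.
Qed.

Lemma cvgcJ u l : cvgc u l -> cvgc (fun n => (u n)^*) l^*.
Proof.
move=> [u1 u2]; split; rewrite !ReImE.
- by under eq_fun do rewrite ReJ.
- by under eq_fun do rewrite ImJ; exact: cvgN.
Qed.

Lemma cvgcB u v k l : cvgc u k -> cvgc v l -> cvgc (fun n => u n - v n) (k - l).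
Proof.
move=> [u1 u2] [v1 v2]; split; rewrite !ReImE.
- by under eq_fun do rewrite !ReImE; exact: cvgB.
- by under eq_fun do rewrite !ReImE; exact: cvgB.
Qed.

Lemma cvgc_unique u k l : cvgc u k -> cvgc u l -> k = l.
Proof.
by move=> [u1 u2] [v1 v2]; apply: complexP;
  [exact: (cvg_unique _ u1 v1)|exact: (cvg_unique _ u2 v2)].
Qed.

Lemma cvgc_real (u : nat -> R) (l : R) : u @ \oo --> l -> cvgc (fun n => (u n)%:C) l%:C.
Proof. by move=> ul; split => //=; exact: cvg_cst. Qed.

Lemma cvgc_normcB u l : cvgc u l -> normc (u n - l) @[n --> \oo] --> (0 : R).
Proof.
move=> [u1 u2].
have d (v : nat -> R) k : v n @[n --> \oo] --> k ->
    `|v n - k| @[n --> \oo] --> (0 : R).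
  by move=> vk; apply/norm_cvg0P; rewrite -(subrr k); apply: cvgB => //; exact: cvg_cst.
apply: (@squeeze_cvgr _ _ _ _ (fun=> 0)
    (fun n => `|Re (u n) - Re l| + `|Im (u n) - Im l|)).
- near=> n; rewrite normc_ge0/= (le_trans (ler_normc_ReIm _))//.
  by rewrite !ReImE.
- exact: cvg_cst.
- by rewrite -[X in _ --> X]addr0; apply: cvgD; exact: d.
Unshelve. all: by end_near. Qed.

Lemma cis2pi0 : cis2pi 0 = 1 :> R[i].
Proof. by rewrite /cis2pi mulr0 cos0 sin0. Qed.

Lemma cis2piD (s t : R) : cis2pi (s + t) = cis2pi s * cis2pi t.
Proof.
apply: complexP; rewrite !ReImE /cis2pi/= mulrDr ?cosD ?sinD//.
by rewrite addrC; congr (_ + _); rewrite mulrC.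
Qed.

Lemma cis2piN (s : R) : cis2pi (- s) = (cis2pi s)^*.
Proof. by apply: complexP; rewrite !ReImE /cis2pi/= mulrN ?cosN ?sinN. Qed.

Lemma normc_cis2pi (s : R) : normc (cis2pi s) = 1.
Proof. by rewrite normcE2/= cos2Dsin2 sqrtr1. Qed.

Lemma cis2piVr (s : R) : cis2pi s * cis2pi (- s) = 1.
Proof. by rewrite -cis2piD subrr cis2pi0. Qed.

End complex_numbers.

Section cintegral_theory.
Context {R : realType} {disp : measure_display} {T : measurableType disp}.
Implicit Types (f g : T -> R[i]) (mu : {measure set T -> \bar R}).

Lemma cmeasurable_cst (c : R[i]) : cmeasurable (fun _ : T => c).
Proof. by split; exact: measurable_cst. Qed.

Lemma cmeasurableD f g : cmeasurable f -> cmeasurable g ->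
  cmeasurable (fun x => f x + g x).
Proof.
move=> [f1 f2] [g1 g2]; split.
- by under eq_fun do rewrite ReD; exact: measurable_funD.
- by under eq_fun do rewrite ImD; exact: measurable_funD.
Qed.

Lemma cmeasurableN f : cmeasurable f -> cmeasurable (fun x => - f x).
Proof.
move=> [f1 f2]; split.
- by under eq_fun do rewrite ReN; exact: measurableT_comp.
- by under eq_fun do rewrite ImN; exact: measurableT_comp.
Qed.

Lemma cmeasurableB f g : cmeasurable f -> cmeasurable g ->
  cmeasurable (fun x => f x - g x).
Proof. by move=> mf mg; apply: cmeasurableD => //; exact: cmeasurableN. Qed.

Lemma cmeasurableM f g : cmeasurable f -> cmeasurable g ->
  cmeasurable (fun x => f x * g x).
Proof.
move=> [f1 f2] [g1 g2]; split.
- by under eq_fun do rewrite ReM; apply: measurable_funB; exact: measurable_funM.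
- by under eq_fun do rewrite ImM; apply: measurable_funD; exact: measurable_funM.
Qed.

Lemma cmeasurableJ f : cmeasurable f -> cmeasurable (fun x => (f x)^*).
Proof.
move=> [f1 f2]; split.
- by under eq_fun do rewrite ReJ.
- by under eq_fun do rewrite ImJ; exact: measurableT_comp.
Qed.

Lemma cmeasurableC (u : T -> R) : measurable_fun setT u ->
  cmeasurable (fun x => (u x)%:C).
Proof. by move=> mu; split => //=; exact: measurable_cst. Qed.

Lemma cmeasurable_cis2pi (u : T -> R) : measurable_fun setT u ->
  cmeasurable (fun x => cis2pi (u x)).
Proof.
move=> mu; split => /=.
- apply: measurableT_comp; last exact: measurable_funM.
  by apply: continuous_measurable_fun; exact: continuous_cos.
- apply: measurableT_comp; last exact: measurable_funM.
  by apply: continuous_measurable_fun; exact: continuous_sin.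
Qed.

Lemma cmeasurable_normc f : cmeasurable f -> measurable_fun setT (normc \o f).
Proof.
move=> [f1 f2]; rewrite (_ : _ \o _ =
  (@Num.sqrt R) \o (fun x => Re (f x) ^+ 2 + Im (f x) ^+ 2)); last first.
  by apply/funext => x /=; rewrite normcE2.
apply: measurableT_comp.
  by apply: continuous_measurable_fun; exact: sqrt_continuous.
by apply: measurable_funD; exact: measurable_funX.
Qed.

Lemma cmeasurable_prod (I : Type) (s : seq I) (F : I -> T -> R[i]) :
  (forall i, cmeasurable (F i)) -> cmeasurable (fun x => \prod_(i <- s) F i x).
Proof.
move=> mF; elim: s => [|i s IH].
  by under eq_fun do rewrite big_nil; exact: cmeasurable_cst.
by under eq_fun do rewrite big_cons; exact: cmeasurableM.
Qed.

Lemma cmeasurable_cvg (F : nat -> T -> R[i]) f :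
  (forall n, cmeasurable (F n)) -> (forall x, cvgc (F^~ x) (f x)) ->
  cmeasurable f.
Proof.
move=> mF Ff; split.
- apply: (@measurable_fun_cvg _ _ _ _ (fun n x => Re (F n x))) => //.
    by move=> n; have [] := mF n.
  by move=> x _; have [] := Ff x.
- apply: (@measurable_fun_cvg _ _ _ _ (fun n x => Im (F n x))) => //.
    by move=> n; have [] := mF n.
  by move=> x _; have [] := Ff x.
Qed.

Lemma cintegrable_cmeasurable mu f : cintegrable mu f -> cmeasurable f.
Proof.
by move=> [/measurable_int/measurable_EFinP ? /measurable_int/measurable_EFinP].
Qed.

Lemma le_cintegrable mu f (g : T -> R) : cmeasurable f ->
  (forall x, normc (f x) <= g x) -> mu.-integrable setT (EFin \o g) ->
  cintegrable mu f.
Proof.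
move=> [f1 f2] fg ig; split; apply: (le_integrable _ _ _ ig) => //.
- exact/measurable_EFinP.
- move=> x _ /=; rewrite lee_fin (le_trans (ler_Re_normc _))//.
  by rewrite (le_trans (fg x))// ler_norm.
- exact/measurable_EFinP.
- move=> x _ /=; rewrite lee_fin (le_trans (ler_Im_normc _))//.
  by rewrite (le_trans (fg x))// ler_norm.
Qed.

Lemma cintegrable_normc mu f : cintegrable mu f ->
  mu.-integrable setT (fun x => (normc (f x))%:E).
Proof.
move=> imf; have [f1 f2] := imf.
have mf := cintegrable_cmeasurable imf.
apply: (le_integrable _ _ _ (integrableD measurableT (integrable_abse f1) (integrable_abse f2))) => //.
  by apply/measurable_EFinP; exact: cmeasurable_normc.
move=> x _ /=; rewrite -?EFinD lee_fin ger0_norm ?normc_ge0//.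
by rewrite ger0_norm ?addr_ge0// ler_normc_ReIm.
Qed.

Lemma cintegrableP mu f : cmeasurable f ->
  cintegrable mu f <-> (\int[mu]_x (normc (f x))%:E < +oo)%E.
Proof.
move=> mf; split=> [/cintegrable_normc/integrableP[_]|foo].
  by under eq_integral do rewrite abse_EFin ger0_norm ?normc_ge0//.
apply: (@le_cintegrable _ _ (normc \o f)) => //.
apply/integrableP; split.
  by apply/measurable_EFinP; exact: cmeasurable_normc.
by under eq_integral do rewrite abse_EFin ger0_norm ?normc_ge0//.
Qed.

Lemma cintegrable_dom mu f g : cmeasurable f ->
  (forall x, normc (f x) <= normc (g x)) -> cintegrable mu g ->
  cintegrable mu f.
Proof. by move=> mf fg /cintegrable_normc; exact: le_cintegrable. Qed.

Lemma cintegrableD mu f g : cintegrable mu f -> cintegrable mu g ->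
  cintegrable mu (fun x => f x + g x).
Proof.
move=> [f1 f2] [g1 g2]; split.
- by under eq_fun do rewrite ReD EFinD; exact: integrableD.
- by under eq_fun do rewrite ImD EFinD; exact: integrableD.
Qed.

Lemma cintegrableN mu f : cintegrable mu f -> cintegrable mu (fun x => - f x).
Proof.
move=> [f1 f2]; split.
- by under eq_fun do rewrite ReN EFinN; exact: integrableN.
- by under eq_fun do rewrite ImN EFinN; exact: integrableN.
Qed.

Lemma cintegrableJ mu f : cintegrable mu f ->
  cintegrable mu (fun x => (f x)^*).
Proof.
move=> [f1 f2]; split.
- by under eq_fun do rewrite ReJ.
- by under eq_fun do rewrite ImJ EFinN; exact: integrableN.
Qed.

Lemma cintegrableZl mu (c : R[i]) f : cintegrable mu f ->
  cintegrable mu (fun x => c * f x).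
Proof.
move=> imf; apply: (@le_cintegrable _ _ (fun x => normc c * normc (f x))).
- apply: cmeasurableM; first exact: cmeasurable_cst.
  exact: cintegrable_cmeasurable imf.
- by move=> x; rewrite normcM.
- rewrite (_ : _ \o _ = fun x => ((normc c)%:E * (normc (f x))%:E)%E)//.
  by apply: integrableZl => //; exact: cintegrable_normc.
Qed.

Lemma cintegrable0 mu : cintegrable mu (fun=> 0).
Proof. by split; exact: integrable0. Qed.

Lemma cintegrableMb mu f g (M : R) : cintegrable mu f -> cmeasurable g ->
  (forall x, normc (g x) <= M) -> cintegrable mu (fun x => f x * g x).
Proof.
move=> imf mg gM.
apply: (@cintegrable_dom _ _ (fun x => M%:C * f x)).
- by apply: cmeasurableM => //; exact: cintegrable_cmeasurable imf.
- move=> x; rewrite !normcM mulrC ler_wpM2r ?normc_ge0// normcC.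
  by rewrite (le_trans (gM x))// ler_norm.
- exact: cintegrableZl.
Qed.

Lemma cintegralD mu f g : cintegrable mu f -> cintegrable mu g ->
  cintegral mu (fun x => f x + g x) = cintegral mu f + cintegral mu g.
Proof.
move=> [f1 f2] [g1 g2]; apply: complexP; rewrite !ReImE /=.
- by under eq_Rintegral do rewrite ReD; rewrite RintegralD.
- by under eq_Rintegral do rewrite ImD; rewrite RintegralD.
Qed.

Lemma cintegralJ mu f : cintegrable mu f ->
  cintegral mu (fun x => (f x)^*) = (cintegral mu f)^*.
Proof.
move=> [f1 f2]; apply: complexP; rewrite !ReImE /=.
- by under eq_Rintegral do rewrite ReJ.
- under eq_Rintegral do rewrite ImJ -mulN1r.
  by rewrite RintegralZl// mulN1r.
Qed.

Lemma cintegralZl mu (c : R[i]) f : cintegrable mu f ->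
  cintegral mu (fun x => c * f x) = c * cintegral mu f.
Proof.
move=> [f1 f2].
have iZ (a : R) (h : T -> R) : mu.-integrable setT (EFin \o h) ->
    mu.-integrable setT (EFin \o (fun x => a * h x)).
  by move=> ih; rewrite (_ : _ \o _ = fun x => (a%:E * (h x)%:E)%E)//;
    exact: integrableZl.
apply: complexP; rewrite !ReImE /=.
- under eq_Rintegral do rewrite ReM.
  by rewrite RintegralB// ?RintegralZl//; exact: iZ.
- under eq_Rintegral do rewrite ImM.
  by rewrite RintegralD// ?RintegralZl//; exact: iZ.
Qed.

Lemma cintegralZr mu (c : R[i]) f : cintegrable mu f ->
  cintegral mu (fun x => f x * c) = cintegral mu f * c.
Proof.
by move=> imf; rewrite mulrC -cintegralZl//; congr cintegral; apply/funext => x;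
  rewrite mulrC.
Qed.

Lemma cintegral0 mu : cintegral mu (fun=> 0) = 0 :> R[i].
Proof. by apply: complexP; rewrite /cintegral/= /Rintegral integral0. Qed.

Lemma cintegralN mu f : cintegrable mu f ->
  cintegral mu (fun x => - f x) = - cintegral mu f.
Proof.
by move=> imf; under eq_fun do rewrite -mulN1r; rewrite cintegralZl// mulN1r.
Qed.

Lemma cintegralB mu f g : cintegrable mu f -> cintegrable mu g ->
  cintegral mu (fun x => f x - g x) = cintegral mu f - cintegral mu g.
Proof.
by move=> imf img; rewrite cintegralD ?cintegralN//; exact: cintegrableN.
Qed.

(** Rotating the integral onto the positive real axis turns its modulus into
    the integral of a real part. *)
Lemma normc_cintegral mu f : cintegrable mu f ->
  normc (cintegral mu f) <= \int[mu]_x normc (f x).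
Proof.
move=> imf; set z := cintegral mu f.
have [z0|z0] := eqVneq (normc z) 0.
  by rewrite z0; apply: Rintegral_ge0 => x _; exact: normc_ge0.
pose u := ((normc z)^-1)%:C * z^*.
have nu : normc u = 1.
  by rewrite normcM normcC normc_conj normfV ger0_norm ?normc_ge0// mulVf.
have -> : normc z = Re (u * z).
  rewrite /u -mulrA (mulrC z^*) mulcJ -rmorphM/= expr2 mulrA mulVf// mul1r//.
rewrite /z -cintegralZl//= le_Rintegral//.
- by have [] := cintegrableZl u imf.
- exact: cintegrable_normc.
- move=> x _; rewrite (le_trans (ler_norm _))//.
  by rewrite (le_trans (ler_Re_normc _))// normcM nu mul1r.
Qed.

Lemma EFin_Rintegral mu (u : T -> R) : mu.-integrable setT (EFin \o u) ->
  ((\int[mu]_x u x)%:E = \int[mu]_x (u x)%:E)%E.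
Proof. by move=> iu; rewrite /Rintegral fineK//; exact: integrable_fin_num. Qed.

Lemma ae_eq_cintegral mu f g : cmeasurable f -> cmeasurable g ->
  {ae mu, forall x, f x = g x} -> cintegral mu f = cintegral mu g.
Proof.
move=> [f1 f2] [g1 g2] fg; apply: complexP; rewrite /= /Rintegral;
  congr fine; apply: ae_eq_integral => //; try exact/measurable_EFinP.
- by apply: filterS fg => x -> _.
- by apply: filterS fg => x -> _.
Qed.

Lemma cdominated_convergence mu (F : nat -> T -> R[i]) f (g : T -> R) :
  (forall n, cmeasurable (F n)) -> cmeasurable f ->
  {ae mu, forall x, cvgc (F^~ x) (f x)} ->
  mu.-integrable setT (EFin \o g) ->
  (forall n x, normc (F n x) <= g x) ->
  cvgc (fun n => cintegral mu (F n)) (cintegral mu f).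
Proof.
move=> mF mf Ff ig Fg.
have key (P : R[i] -> R) : (forall n, measurable_fun setT (fun x => P (F n x))) ->
    measurable_fun setT (fun x => P (f x)) ->
    {ae mu, forall x, P (F n x) @[n --> \oo] --> P (f x)} ->
    (forall z, `|P z| <= normc z) ->
    (\int[mu]_x P (F n x)) @[n --> \oo] --> \int[mu]_x P (f x).
  move=> mP mPf PF Pn.
  have PF' : {ae mu, forall x, setT x ->
      (P (F n x))%:E @[n --> \oo] --> (P (f x))%:E}.
    apply: filterS PF => x h _; apply: cvg_EFin; last exact: h.
    exact: nearW.
  have [ifi _ c] := @dominated_convergence _ _ _ mu setT measurableT
    (fun n x => (P (F n x))%:E) (fun x => (P (f x))%:E) (EFin \o g)
    (fun n => iffRL (measurable_EFinP _ _) (mP n))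
    (iffRL (measurable_EFinP _ _) mPf) PF' ig
    (@nearW _ _ _ _ (fun x n _ => le_trans (Pn _) (Fg n x))).
  by apply: fine_cvg; rewrite EFin_Rintegral.
split; apply: key => //.
- by move=> n; have [] := mF n.
- by have [] := mf.
- by apply: filterS Ff => x [].
- exact: ler_Re_normc.
- by move=> n; have [] := mF n.
- by have [] := mf.
- by apply: filterS Ff => x [].
- exact: ler_Im_normc.
Qed.

End cintegral_theory.

(** * Fubini's theorem for complex integrands *)

Lemma ae_eq_integrable {R : realType} d (T : measurableType d)
    (mu : {measure set T -> \bar R}) (f g : T -> \bar R) :
  measurable_fun setT g -> ae_eq mu setT f g -> mu.-integrable setT f ->
  mu.-integrable setT g.
Proof.
move=> mg fg /integrableP[mf foo]; apply/integrableP; split => //.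
suff <- : (\int[mu]_x `|f x| = \int[mu]_x `|g x|)%E by [].
apply: ge0_ae_eq_integral => //; try exact: measurableT_comp.
by apply: filterS fg => x /= h /h ->.
Qed.

Lemma integralE_comp {R : realType} d1 (T1 : measurableType d1) (T2 : Type)
    (mu : {measure set T1 -> \bar R}) (f : T2 -> \bar R) (S : T1 -> T2) :
  (\int[mu]_x f (S x) = \int[mu]_x f^\+ (S x) - \int[mu]_x f^\- (S x))%E.
Proof.
rewrite integralE; congr (_ - _)%E; apply: eq_integral => x _.
  by rewrite !funeposE.
by rewrite !funenegE.
Qed.

Section cfubini.
Context {R : realType} {d1 d2 : measure_display}.
Context {T1 : measurableType d1} {T2 : measurableType d2}.
Variables (m1 : {sigma_finite_measure set T1 -> \bar R}).
Variables (m2 : {sigma_finite_measure set T2 -> \bar R}).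
Implicit Types (f : T1 * T2 -> R[i]) (u : T1 * T2 -> R).

Lemma measurable_Rintegral1 u : measurable_fun setT u ->
  measurable_fun setT (fun x => \int[m2]_y u (x, y)).
Proof.
move=> mu; rewrite /Rintegral.
have mue : measurable_fun setT (EFin \o u) by exact/measurable_EFinP.
apply: (@measurableT_comp _ _ _ _ _ _ (@fine R)) => //.
under eq_fun => x do rewrite (integralE_comp _ (EFin \o u) (pair x)).
apply: emeasurable_funB.
  exact: (@measurable_fun_fubini_tonelli_F _ _ _ _ _ m2 _ (measurable_funepos mue)
    (fun z => funepos_ge0 _ z)).
exact: (@measurable_fun_fubini_tonelli_F _ _ _ _ _ m2 _ (measurable_funeneg mue)
    (fun z => funeneg_ge0 _ z)).
Qed.

Lemma measurable_Rintegral2 u : measurable_fun setT u ->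
  measurable_fun setT (fun y => \int[m1]_x u (x, y)).
Proof.
move=> mu; rewrite /Rintegral.
have mue : measurable_fun setT (EFin \o u) by exact/measurable_EFinP.
apply: (@measurableT_comp _ _ _ _ _ _ (@fine R)) => //.
under eq_fun => y do rewrite (integralE_comp _ (EFin \o u) (pair^~ y)).
apply: emeasurable_funB.
  exact: (@measurable_fun_fubini_tonelli_G _ _ _ _ _ m1 _ (measurable_funepos mue)
    (fun z => funepos_ge0 _ z)).
exact: (@measurable_fun_fubini_tonelli_G _ _ _ _ _ m1 _ (measurable_funeneg mue)
    (fun z => funeneg_ge0 _ z)).
Qed.

Lemma ae_Rintegral1 u : (m1 \x m2)%E.-integrable setT (EFin \o u) ->
  {ae m1, forall x, (\int[m2]_y u (x, y))%:E = (\int[m2]_y (u (x, y))%:E)%E}.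
Proof.
by move=> /ae_integrable1; apply: filterS => x iu; rewrite EFin_Rintegral.
Qed.

Lemma ae_Rintegral2 u : (m1 \x m2)%E.-integrable setT (EFin \o u) ->
  {ae m2, forall y, (\int[m1]_x u (x, y))%:E = (\int[m1]_x (u (x, y))%:E)%E}.
Proof.
by move=> /ae_integrable2; apply: filterS => x iu; rewrite EFin_Rintegral.
Qed.

Lemma integrable_fubini_G' (f : T1 * T2 -> \bar R) :
  (m1 \x m2)%E.-integrable setT f -> m2.-integrable setT (fubini_G m1 f).
Proof.
move=> imf; have mf : measurable_fun setT f by exact: measurable_int imf.
pose sw (p : T2 * T1) := (p.2, p.1).
have ms : measurable_fun setT sw by exact/measurable_fun_pair.
have mfs : measurable_fun setT (f \o sw) by exact: measurableT_comp.
apply: (@integrable_fubini_F _ _ _ _ _ m2 m1 (f \o sw)).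
apply/(integrable12ltyP m2 m1 mfs).
exact/(integrable21ltyP m1 m2 mf).
Qed.

Lemma RFubini1 u : (m1 \x m2)%E.-integrable setT (EFin \o u) ->
  m1.-integrable setT (fun x => (\int[m2]_y u (x, y))%:E) /\
  \int[m1]_x \int[m2]_y u (x, y) = \int[(m1 \x m2)%E]_z u z.
Proof.
move=> iu; have mu : measurable_fun setT u.
  exact/measurable_EFinP/measurable_int/iu.
have mF := measurable_Rintegral1 mu.
have iF := integrable_fubini_F iu; split.
  apply: (ae_eq_integrable _ _ iF).
    exact/measurable_EFinP.
  by apply: filterS (ae_Rintegral1 iu) => x e _; rewrite e.
rewrite [LHS]/Rintegral [RHS]/Rintegral -integral12_prod_meas1//; congr fine.
apply: ae_eq_integral => //; first exact/measurable_EFinP.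
  exact: measurable_int iF.
by apply: filterS (ae_Rintegral1 iu) => x.
Qed.

Lemma RFubini2 u : (m1 \x m2)%E.-integrable setT (EFin \o u) ->
  m2.-integrable setT (fun y => (\int[m1]_x u (x, y))%:E) /\
  \int[m2]_y \int[m1]_x u (x, y) = \int[(m1 \x m2)%E]_z u z.
Proof.
move=> iu; have mu : measurable_fun setT u.
  exact/measurable_EFinP/measurable_int/iu.
have mF := measurable_Rintegral2 mu.
have iF := integrable_fubini_G' iu; split.
  apply: (ae_eq_integrable _ _ iF).
    exact/measurable_EFinP.
  by apply: filterS (ae_Rintegral2 iu) => x e _; rewrite e.
rewrite [LHS]/Rintegral [RHS]/Rintegral -integral21_prod_meas1//; congr fine.
apply: ae_eq_integral => //; first exact/measurable_EFinP.
  exact: measurable_int iF.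
by apply: filterS (ae_Rintegral2 iu) => x.
Qed.

Lemma cmeasurable_cintegral1 f : cmeasurable f ->
  cmeasurable (fun x => cintegral m2 (fun y => f (x, y))).
Proof.
by move=> [f1 f2]; split => /=; [exact: (measurable_Rintegral1 f1)|
  exact: (measurable_Rintegral1 f2)].
Qed.

Lemma cmeasurable_cintegral2 f : cmeasurable f ->
  cmeasurable (fun y => cintegral m1 (fun x => f (x, y))).
Proof.
by move=> [f1 f2]; split => /=; [exact: (measurable_Rintegral2 f1)|
  exact: (measurable_Rintegral2 f2)].
Qed.

Lemma cintegrable_cintegral1 f : cintegrable (m1 \x m2)%E f ->
  cintegrable m1 (fun x => cintegral m2 (fun y => f (x, y))).
Proof. by move=> [/RFubini1[? _] /RFubini1[? _]]; split. Qed.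

Lemma cintegrable_cintegral2 f : cintegrable (m1 \x m2)%E f ->
  cintegrable m2 (fun y => cintegral m1 (fun x => f (x, y))).
Proof. by move=> [/RFubini2[? _] /RFubini2[? _]]; split. Qed.

Lemma cFubini1 f : cintegrable (m1 \x m2)%E f ->
  cintegral m1 (fun x => cintegral m2 (fun y => f (x, y))) =
  cintegral (m1 \x m2)%E f.
Proof. by move=> [/RFubini1[_ e1] /RFubini1[_ e2]]; apply: complexP. Qed.

Lemma cFubini2 f : cintegrable (m1 \x m2)%E f ->
  cintegral m2 (fun y => cintegral m1 (fun x => f (x, y))) =
  cintegral (m1 \x m2)%E f.
Proof. by move=> [/RFubini2[_ e1] /RFubini2[_ e2]]; apply: complexP. Qed.

Lemma cFubini f : cintegrable (m1 \x m2)%E f ->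
  cintegral m1 (fun x => cintegral m2 (fun y => f (x, y))) =
  cintegral m2 (fun y => cintegral m1 (fun x => f (x, y))).
Proof. by move=> imf; rewrite cFubini1// cFubini2. Qed.

Lemma ae_cintegrable1 f : cintegrable (m1 \x m2)%E f ->
  {ae m1, forall x, cintegrable m2 (fun y => f (x, y))}.
Proof.
by move=> [/ae_integrable1 h1 /ae_integrable1 h2]; apply: filterS2 h1 h2 => x.
Qed.

Lemma cmeasurable_pair1 f x : cmeasurable f -> cmeasurable (fun y => f (x, y)).
Proof.
by move=> [f1 f2]; split; [apply: (measurableT_comp f1)|apply: (measurableT_comp f2)];
  exact: measurable_pair1.
Qed.

Lemma cmeasurable_pair2 f y : cmeasurable f -> cmeasurable (fun x => f (x, y)).
Proof.
by move=> [f1 f2]; split; [apply: (measurableT_comp f1)|apply: (measurableT_comp f2)];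
  exact: measurable_pair2.
Qed.

Lemma cintegrable12 f : cmeasurable f ->
  (\int[m1]_x \int[m2]_y (normc (f (x, y)))%:E < +oo)%E ->
  cintegrable (m1 \x m2)%E f.
Proof.
move=> mf foo; apply/cintegrableP => //; rewrite fubini_tonelli1//.
  by apply/measurable_EFinP; exact: cmeasurable_normc.
by move=> z; rewrite lee_fin normc_ge0.
Qed.

Lemma cintegrable21 f : cmeasurable f ->
  (\int[m2]_y \int[m1]_x (normc (f (x, y)))%:E < +oo)%E ->
  cintegrable (m1 \x m2)%E f.
Proof.
move=> mf foo; apply/cintegrableP => //; rewrite fubini_tonelli2//.
  by apply/measurable_EFinP; exact: cmeasurable_normc.
by move=> z; rewrite lee_fin normc_ge0.
Qed.

Lemma cintegrable_prod (f : T1 -> R[i]) (g : T2 -> R[i]) :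
  cintegrable m1 f -> cintegrable m2 g ->
  cintegrable (m1 \x m2)%E (fun z => f z.1 * g z.2).
Proof.
move=> imf img.
have mf := cintegrable_cmeasurable imf; have mg := cintegrable_cmeasurable img.
apply: cintegrable12.
  apply: cmeasurableM.
    by case: mf => f1 f2; split; [exact: (measurableT_comp f1)|exact: (measurableT_comp f2)].
  by case: mg => f1 f2; split; [exact: (measurableT_comp f1)|exact: (measurableT_comp f2)].
under eq_integral => x _.
  under eq_integral do rewrite /= normcM EFinM.
  rewrite ge0_integralZl//; last 3 first.
  - by apply/measurable_EFinP; exact: cmeasurable_normc.
  - by move=> y _; rewrite lee_fin normc_ge0.
  - by rewrite lee_fin normc_ge0.
  over.
rewrite ge0_integralZr//; last 3 first.
- by apply/measurable_EFinP; exact: cmeasurable_normc.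
- by move=> y _; rewrite lee_fin normc_ge0.
- by apply: integral_ge0 => y _; rewrite lee_fin normc_ge0.
have foo := (cintegrableP m1 mf).1 imf; have goo := (cintegrableP m2 mg).1 img.
have f0 : (0 <= \int[m1]_x (normc (f x))%:E)%E.
  by apply: integral_ge0 => y _; rewrite lee_fin normc_ge0.
by apply: lte_mul_pinfty => //; rewrite ge0_fin_numE.
Qed.

Lemma cintegral_prod (f : T1 -> R[i]) (g : T2 -> R[i]) :
  cintegrable m1 f -> cintegrable m2 g ->
  cintegral (m1 \x m2)%E (fun z => f z.1 * g z.2) =
  cintegral m1 f * cintegral m2 g.
Proof.
move=> imf img; rewrite -cFubini1; last exact: cintegrable_prod.
under eq_fun do rewrite /= cintegralZl//.
by rewrite cintegralZr.
Qed.

End cfubini.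

Lemma cintegrable_swap {R : realType} d1 d2 (T1 : measurableType d1)
    (T2 : measurableType d2) (m1 : {sigma_finite_measure set T1 -> \bar R})
    (m2 : {sigma_finite_measure set T2 -> \bar R}) (f : T1 * T2 -> R[i]) :
  cintegrable (m1 \x m2)%E f -> cintegrable (m2 \x m1)%E (fun p => f (p.2, p.1)).
Proof.
move=> imf; have mf := cintegrable_cmeasurable imf.
have msw : measurable_fun setT (fun p : T2 * T1 => (p.2, p.1)).
  exact/measurable_fun_pair.
apply: cintegrable12.
  by have [f1 f2] := mf; split; [exact: (measurableT_comp f1 msw)|
    exact: (measurableT_comp f2 msw)].
have := (cintegrableP _ mf).1 imf; rewrite fubini_tonelli2//.
  by apply/measurable_EFinP; exact: cmeasurable_normc.
by move=> z; rewrite lee_fin normc_ge0.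
Qed.

Lemma cmeasurable_comp {R : realType} d1 d2 (T1 : measurableType d1)
    (T2 : measurableType d2) (f : T2 -> R[i]) (g : T1 -> T2) :
  cmeasurable f -> measurable_fun setT g -> cmeasurable (fun x => f (g x)).
Proof.
by move=> [f1 f2] mg; split; [exact: (measurableT_comp f1)|
  exact: (measurableT_comp f2)].
Qed.

(** * Transformations scaling a measure *)

Section scaling.
Context {R : realType} {disp : measure_display} {T : measurableType disp}.
Implicit Type mu : {measure set T -> \bar R}.

(** Asked of nonnegative functions, the change of variables formula passes to
    products by Tonelli's theorem; the formulas for integrable functions and
    for the measures of sets follow from it. *)
Definition scaling mu (c : R) (S : T -> T) : Prop :=
  [/\ 0 < c, measurable_fun setT S & forall f : T -> \bar R,
    measurable_fun setT f -> (forall x, 0 <= f x)%E ->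
    (\int[mu]_x f (S x) = c%:E * \int[mu]_x f x)%E].

Lemma scaling_Rintegral mu c S (u : T -> R) : scaling mu c S ->
  measurable_fun setT u -> \int[mu]_x u (S x) = c * \int[mu]_x u x.
Proof.
move=> [c0 mS SE] mu'; rewrite /Rintegral (integralE_comp _ (EFin \o u) S).
have mue : measurable_fun setT (EFin \o u) by exact/measurable_EFinP.
transitivity (fine (c%:E * \int[mu]_x (EFin \o u)^\+ x -
    c%:E * \int[mu]_x (EFin \o u)^\- x)%E).
  congr fine; congr (_ - _)%E.
    exact: (SE _ (measurable_funepos mue) (fun z => funepos_ge0 _ z)).
  exact: (SE _ (measurable_funeneg mue) (fun z => funeneg_ge0 _ z)).
rewrite [in RHS]integralE.
have : (0 <= \int[mu]_x (EFin \o u)^\+ x)%E by exact: integral_ge0.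
have : (0 <= \int[mu]_x (EFin \o u)^\- x)%E by exact: integral_ge0.
move: (\int[mu]_x _)%E (\int[mu]_x _)%E => a b.
case: a => [a||]//; case: b => [b||]// _ _.
- by rewrite -!EFinM -EFinB /= mulrBr.
- by rewrite gt0_muley ?lte_fin//= mulr0.
- by rewrite gt0_muley ?lte_fin//= mulr0.
- by rewrite gt0_muley ?lte_fin//= mulr0.
Qed.

Lemma cintegral_scaling mu c S (f : T -> R[i]) : scaling mu c S ->
  cmeasurable f -> cintegral mu (fun x => f (S x)) = c%:C * cintegral mu f.
Proof.
move=> sS [f1 f2]; apply: complexP; rewrite !ReImE /= !mul0r ?subr0 ?addr0.
  exact: (scaling_Rintegral sS f1).
exact: (scaling_Rintegral sS f2).
Qed.

Lemma cintegrable_scaling mu c S (f : T -> R[i]) : scaling mu c S ->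
  cintegrable mu f -> cintegrable mu (fun x => f (S x)).
Proof.
move=> [c0 mS SE] imf; have mf := cintegrable_cmeasurable imf.
apply/cintegrableP; first exact: cmeasurable_comp.
rewrite (SE (fun x => (normc (f x))%:E)); last 2 first.
- by apply/measurable_EFinP; exact: cmeasurable_normc.
- by move=> x; rewrite lee_fin normc_ge0.
apply: lte_mul_pinfty; rewrite ?lee_fin ?ltW//; exact/cintegrableP.
Qed.

Lemma scaling_comp mu a b S U : scaling mu a S -> scaling mu b U ->
  scaling mu (a * b) (S \o U).
Proof.
move=> [a0 mS SE] [b0 mU UE]; split; [exact: mulr_gt0|exact: measurableT_comp|].
move=> f mf f0; rewrite (UE (f \o S) (measurableT_comp mf mS)) => [|x]; last exact: f0.
by rewrite SE// EFinM muleCA muleA.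
Qed.

Lemma scaling_measure mu c S A : scaling mu c S -> measurable A ->
  mu (S @^-1` A) = (c%:E * mu A)%E.
Proof.
move=> [c0 mS SE] mA.
have mSA : measurable (S @^-1` A) by rewrite -[X in measurable X]setTI; exact: mS.
rewrite -[X in (_ * mu X)%E]setIT -integral_indic// -SE//.
- by rewrite -[X in mu X](setIT (S @^-1` A)) -integral_indic.
- exact/measurable_EFinP.
Qed.

Lemma scaling_ae mu c S (P : T -> Prop) : scaling mu c S ->
  {ae mu, forall x, P x} -> {ae mu, forall x, P (S x)}.
Proof.
move=> sS [A [mA A0 PA]]; have [c0 mS SE] := sS.
exists (S @^-1` A); split.
- by rewrite -[X in measurable X]setTI; exact: mS.
- by rewrite (scaling_measure sS mA) A0 mule0.
- by move=> x /= nP; apply: PA => /=.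
Qed.

End scaling.

Section scaling_product.
Context {R : realType} {d1 d2 : measure_display}.
Context {T1 : measurableType d1} {T2 : measurableType d2}.
Variables (m1 : {sigma_finite_measure set T1 -> \bar R}).
Variables (m2 : {sigma_finite_measure set T2 -> \bar R}).

Lemma scaling_prod a b S1 S2 : scaling m1 a S1 -> scaling m2 b S2 ->
  scaling (m1 \x m2)%E (a * b) (fun z => (S1 z.1, S2 z.2)).
Proof.
move=> [a0 mS1 S1E] [b0 mS2 S2E].
have mS : measurable_fun setT (fun z : T1 * T2 => (S1 z.1, S2 z.2)).
  by apply/measurable_fun_pair; exact: measurableT_comp.
split=> //; first exact: mulr_gt0.
move=> f mf f0; rewrite fubini_tonelli1//; last exact: measurableT_comp.
have mF := @measurable_fun_fubini_tonelli_F _ _ _ _ _ m2 _ mf f0.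
rewrite [in RHS]fubini_tonelli1//; rewrite /fubini_F/=.
under eq_integral => x _.
  rewrite (S2E (fun y => f (S1 x, y)))//; last first.
    exact: (measurableT_comp mf (measurable_pair1 _)).
  over.
rewrite (S1E (fun x => b%:E * \int[m2]_y f (x, y))%E)//; last 2 first.
- by apply: emeasurable_funM => //; exact: measurable_cst.
- by move=> x; apply: mule_ge0; [rewrite lee_fin ltW|apply: integral_ge0].
rewrite ge0_integralZl ?lee_fin ?ltW//; last by move=> x _; apply: integral_ge0 => y _.
by rewrite muleA EFinM.
Qed.

End scaling_product.

Section volume_scaling.
Context {R : realType}.

Lemma volume_tonelli n (f : 'rV[R]_n.+1 -> \bar R) : measurable_fun setT f ->
  (forall x, 0 <= f x)%E ->
  (\int[volume n.+1]_v f v =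
   \int[(lebesgue_measure \x volume n)%E]_z f (rV_cons z))%E.
Proof.
move=> mf f0.
rewrite [LHS](ge0_integral_pushforward (@measurable_rV_cons R n)
  (lebesgue_measure \x volume n)%E measurableT mf) ?preimage_setT//.
Qed.

Lemma cintegral_volume n (f : 'rV[R]_n.+1 -> R[i]) : cmeasurable f ->
  cintegral (volume n.+1) f =
  cintegral (lebesgue_measure \x volume n)%E (fun z => f (rV_cons z)).
Proof.
have key (u : 'rV[R]_n.+1 -> R) : measurable_fun setT u ->
    \int[volume n.+1]_v u v =
    \int[(lebesgue_measure \x volume n)%E]_z u (rV_cons z).
  move=> mu; rewrite /Rintegral (integralE_comp _ (EFin \o u) id).
  rewrite (integralE_comp _ (EFin \o u) (@rV_cons R n)).
  have mue : measurable_fun setT (EFin \o u) by exact/measurable_EFinP.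
  congr fine; congr (_ - _)%E.
    exact: (volume_tonelli (measurable_funepos mue) (fun z => funepos_ge0 _ z)).
  exact: (volume_tonelli (measurable_funeneg mue) (fun z => funeneg_ge0 _ z)).
by move=> [f1 f2]; apply: complexP; [exact: key f1|exact: key f2].
Qed.

Lemma cintegrable_volume n (f : 'rV[R]_n.+1 -> R[i]) : cmeasurable f ->
  cintegrable (volume n.+1) f <->
  cintegrable (lebesgue_measure \x volume n)%E (fun z => f (rV_cons z)).
Proof.
move=> mf; rewrite cintegrableP// cintegrableP//; last first.
  exact: (cmeasurable_comp mf (@measurable_rV_cons R n)).
rewrite volume_tonelli//.
  by apply/measurable_EFinP; exact: cmeasurable_normc.
by move=> x; rewrite lee_fin normc_ge0.
Qed.

(** The pushforward of Lebesgue measure agrees, up to the factor, with Lebesgue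
    measure on half-open intervals, hence everywhere. *)
Lemma lebesgue_scaling (a b : R) : a != 0 ->
  scaling (lebesgue_measure : {measure set (measurableTypeR R) -> \bar R})
   `|a|^-1 (fun x : measurableTypeR R => a * x + b).
Proof.
move=> a0; have n0 : 0 < `|a| by rewrite normr_gt0.
have mS : measurable_fun setT (fun x : measurableTypeR R => a * x + b : measurableTypeR R).
  by apply: measurable_funD => //; exact: measurable_funM.
pose mu0 : {measure set (measurableTypeR R) -> \bar R} := lebesgue_measure.
pose mu1 : {measure set (measurableTypeR R) -> \bar R} :=
  mscale (NngNum (normr_ge0 a)) (measure_function_pushforward__canonical__measure_function_Measure mu0 mS).
have mu1E A : measurable A -> mu0 A = mu1 A.
  move=> mA; apply: lebesgue_measure_unique => //= X [[u v] _ <-].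
  rewrite /mu1/= /mscale/= /pushforward/= /mu0.
  have [an|ap|//] := ltgtP a 0; last by move=> /eqP; rewrite (negbTE a0).
  - rewrite (_ : _ @^-1` _ = `[(v - b) / a, (u - b) / a[%classic); last first.
      apply/seteqP; split=> x /=; rewrite !in_itv/=.
        by rewrite ler_ndivrMr// ltr_ndivlMr// lerBrDr ltrBlDr mulrC andbC.
      by rewrite ler_ndivrMr// ltr_ndivlMr// lerBrDr ltrBlDr mulrC andbC.
    rewrite !lebesgue_measure_itv/= !lte_fin ltr_nM2r ?invr_lt0// ltrD2r.
    case: ifPn => _; last by rewrite mule0.
    rewrite -EFinB -EFinM ltr0_norm// ; congr (_%:E); field; rewrite lt_eqF//.
  - rewrite (_ : _ @^-1` _ = `](u - b) / a, (v - b) / a]%classic); last first.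
      apply/seteqP; split=> x /=; rewrite !in_itv/=.
        by rewrite ltr_pdivrMr// ler_pdivlMr// lerBrDr ltrBlDr mulrC.
      by rewrite ltr_pdivrMr// ler_pdivlMr// lerBrDr ltrBlDr mulrC.
    rewrite !lebesgue_measure_itv/= !lte_fin ltr_pM2r ?invr_gt0// ltrD2r.
    case: ifPn => _; last by rewrite mule0.
    rewrite -EFinB -EFinM gtr0_norm// ; congr (_%:E); field; rewrite gt_eqF//.
split; [by rewrite invr_gt0|exact: mS|].
move=> f mf f0.
have -> : (\int[lebesgue_measure]_x f x = \int[mu1]_x f x)%E.
  by apply: eq_measure_integral => A mA _; exact: mu1E.
rewrite ge0_integral_mscale// muleA -EFinM mulVf ?gt_eqF// mul1e.
by rewrite (ge0_integral_pushforward mS)// preimage_setT.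
Qed.

Lemma volume_scaling n (c : R) (S : 'I_n -> R -> R) :
  (forall i, scaling (lebesgue_measure : {measure set (measurableTypeR R) -> \bar R})
     c (S i)) ->
  scaling (volume n) (c ^+ n) (fun v => \row_i S i (v 0 i)).
Proof.
elim: n S => [|n IH] S sS.
  rewrite expr0; split=> //; first by apply/measurable_fun_rVP => -[].
  move=> f mf f0; rewrite mul1e; apply: eq_integral => x _; congr f.
  by apply/rowP => -[].
have mS : measurable_fun setT (fun v : 'rV[R]_n.+1 => \row_i S i (v 0 i) : 'rV[R]_n.+1).
  apply/measurable_fun_rVP => i; under eq_fun do rewrite mxE.
  have [_ mSi _] := sS i; apply: (measurableT_comp mSi).
  exact: measurable_coord_rV.
have sS' := scaling_prod (sS ord0) (IH _ (fun i => sS (lift ord0 i))).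
have [c0 mS' SE] := sS'; rewrite exprS; split => // f mf f0.
rewrite volume_tonelli//; last exact: measurableT_comp.
rewrite volume_tonelli//.
rewrite -(SE (fun z => f (rV_cons z)))//; last first.
  exact: (measurableT_comp mf (@measurable_rV_cons R n)).
apply: eq_integral => -[x v] _; congr f; apply/rowP => i; rewrite mxE.
have [j ->|->] := unliftP ord0 i; first by rewrite !rV_consS/= mxE.
by rewrite !rV_cons0.
Qed.

Lemma volume_shift n (a : 'rV[R]_n) : scaling (volume n) 1 (fun v => v + a).
Proof.
have := @volume_scaling n 1 (fun i x => x + a 0 i).
rewrite expr1n (_ : (fun v => _) = (fun v => v + a)); last first.
  by apply/funext => v; apply/rowP => i; rewrite !mxE.
apply=> i; have := @lebesgue_scaling 1 (a 0 i) (oner_neq0 _).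
by rewrite normr1 invr1; under eq_fun do rewrite mul1r.
Qed.

Lemma volume_opp n (a : 'rV[R]_n) : scaling (volume n) 1 (fun v => a - v).
Proof.
have := @volume_scaling n 1 (fun i x => - x + a 0 i).
rewrite expr1n (_ : (fun v => _) = (fun v => a - v)); last first.
  by apply/funext => v; apply/rowP => i; rewrite !mxE addrC.
apply=> i; have := @lebesgue_scaling (-1) (a 0 i) _.
by rewrite normrN normr1 invr1; under eq_fun do rewrite mulN1r;
  apply; rewrite oppr_eq0 oner_eq0.
Qed.

Lemma volume_dilation n (s : R) : 0 < s ->
  scaling (volume n) (s^-1 ^+ n) (fun v => s *: v).
Proof.
move=> s0; have := @volume_scaling n s^-1 (fun i x => s * x).
rewrite (_ : (fun v : 'rV[R]_n => \row_i (s * v 0 i)) = (fun v : 'rV[R]_n => s *: v)); last first.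
  by apply/funext => v; apply/rowP => i; rewrite !mxE.
apply=> i; have := @lebesgue_scaling s 0 (lt0r_neq0 s0).
by rewrite gtr0_norm//; under eq_fun do rewrite addr0.
Qed.

End volume_scaling.

Section phase_measure.
Context {R : realType} {d : nat}.
Local Notation phase := ('rV[R]_d * 'rV[R]_d)%type.
Local Notation pvol := (@phase_volume R d).

HB.instance Definition _ := Measure_isSigmaFinite.Build _ _ _ pvol
  (product_sigma_finite (volume d) (volume d)).

Lemma phase_shift (a : phase) : scaling pvol 1 (fun z => z + a).
Proof.
have := scaling_prod (volume_shift a.1) (volume_shift a.2).
by rewrite mulr1.
Qed.

Lemma phase_opp (a : phase) : scaling pvol 1 (fun z => a - z).
Proof.
have := scaling_prod (volume_opp a.1) (volume_opp a.2).
by rewrite mulr1.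
Qed.

End phase_measure.

(** * Gaussians and their Fourier transforms *)

Section gauss1.
Context {R : realType}.
Local Notation leb := (lebesgue_measure : {measure set (measurableTypeR R) -> \bar R}).

Definition gauss (x : R) : R := expR (- (pi * x ^+ 2)).

Lemma gauss_ge0 x : 0 <= gauss x. Proof. exact: expR_ge0. Qed.

Lemma is_derive_gauss (x : R) : is_derive x 1 gauss (- (2 * pi * x) * gauss x).
Proof.
rewrite /gauss.
apply: is_derive_eq.
by rewrite /GRing.scale/=; ring.
Qed.

#[local] Existing Instance is_derive_gauss.

Lemma continuous_gauss : continuous gauss.
Proof.
move=> x; apply: differentiable_continuous; apply/derivable1_diffP.
by have [] := is_derive_gauss x.
Qed.

Lemma measurable_gauss : measurable_fun setT gauss.
Proof. exact: continuous_measurable_fun continuous_gauss. Qed.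

Lemma integral_gauss_dilation (a : R) : 0 < a ->
  (\int[leb]_x (gauss (a * x))%:E = a^-1%:E)%E.
Proof.
move=> a0; have p0 : 0 < Num.sqrt pi :> R by rewrite sqrtr_gt0 pi_gt0.
have pa0 : 0 < Num.sqrt pi * a by rewrite mulr_gt0.
have [_ _ SE] := @lebesgue_scaling R (Num.sqrt pi * a) 0 (lt0r_neq0 pa0).
have := SE (fun x => (gauss_fun x)%:E).
rewrite integralT_gauss gtr0_norm// -EFinM invfM mulrAC mulVf ?gt_eqF// mul1r.
move=> <-.
- apply: eq_integral => x _; rewrite /gauss /gauss_fun addr0 -mulrA [in RHS]exprMn.
  by rewrite sqr_sqrtr ?pi_ge0.
- by apply/measurable_EFinP; exact: measurable_gauss_fun.
- by move=> x; rewrite lee_fin gauss_fun_ge0.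
Qed.

Lemma integrable_gauss_dilation (a : R) : 0 < a ->
  leb.-integrable setT (fun x => (gauss (a * x))%:E).
Proof.
move=> a0; apply/integrableP; split.
  apply/measurable_EFinP; apply: (measurableT_comp measurable_gauss).
  exact: measurable_funM.
under eq_integral do rewrite gee0_abs ?lee_fin ?gauss_ge0//.
by rewrite integral_gauss_dilation// ltry.
Qed.

Lemma normr_mul_gauss_le (x : R) : `|x| * gauss x <= gauss (x / 2).
Proof.
have -> : gauss x = gauss (x / 2) ^+ 4.
  rewrite /gauss -expRM_natl; congr expR; rewrite exprMn exprVn.
  by rewrite -mulr_natl; field.
rewrite exprS mulrCA -[leRHS]mulr1 ler_wpM2l ?gauss_ge0//.
have -> : gauss (x / 2) ^+ 3 = (expR (3 * pi / 4 * x ^+ 2))^-1.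
  by rewrite /gauss -expRM_natl -expRN; congr expR; rewrite exprMn exprVn; field.
rewrite ler_pdivrMr ?expR_gt0// mul1r (le_trans _ (expR_ge1Dx _))//.
have := @pi_ge2 R; set p := pi => p2.
rewrite -(real_normK (num_real x)); have := normr_ge0 x.
move: (`|x|) => y y0.
have : 0 <= (p - 2) * y ^+ 2 by rewrite mulr_ge0 ?sqr_ge0 ?subr_ge0.
have := sqr_ge0 (y - 1); have := sqr_ge0 y; lra.
Qed.

Lemma gauss_shift_le (x e : R) : `|e| <= 1 -> gauss (x + e) <= expR pi * gauss (2^-1 * x).
Proof.
move=> e1; rewrite /gauss -expRD ler_expR.
have := @pi_ge0 R; set p := pi => p0.
have : e ^+ 2 <= 1 by rewrite -(real_normK (num_real e)) expr_le1.
move=> e2.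
have : 0 <= p * (x + e) ^+ 2 + p - p * (2^-1 * x)^+ 2; last by lra.
have : 0 <= p * ((x + e) ^+ 2 + 1 - (2^-1 * x) ^+ 2); last by lra.
rewrite mulr_ge0//.
have : 0 <= (3 * x + 4 * e) ^+ 2 by exact: sqr_ge0.
nra.
Qed.

(** A derivative dominated uniformly under small translations integrates to
    zero, because the integrals of the translates do not depend on the
    translation. *)
Lemma Rintegral_derivative_eq0 (h dh G : R -> R) :
  (forall x : R, is_derive x (1 : R) h (dh x)) -> leb.-integrable setT (EFin \o h) ->
  leb.-integrable setT (EFin \o G) -> (forall x, 0 <= G x) ->
  (forall x e, `|e| <= 1 -> `|dh (x + e)| <= G x) -> \int[leb]_x dh x = 0.
Proof.
move=> hd ih iG G0 dG.
have mh : measurable_fun setT h by apply/measurable_EFinP; exact: measurable_int ih.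
pose f (e : R) (x : R) := h (x + e).
have df (e x : R) : is_derive e (1 : R) (f ^~ x) (dh (x + e)).
  rewrite /f.
  have := hd (x + e) => hxe.
  rewrite -[dh _]mulr1; apply: (@is_derive1_comp R h (fun e => x + e)).
  have := is_deriveD (is_derive_cst x e (1 : R)) (is_derive_id e (1 : R)).
  by rewrite add0r.
have p1E e x : partial1of2 f e x = dh (x + e).
  by rewrite partial1of2E; apply: derive_val.
have I0 : `]-1, 1[%classic (0 : R) by rewrite /= in_itv/= ltrN10 ltr01.
have F e : \int[leb]_x f e x = \int[leb]_x h x.
  have sS := @lebesgue_scaling R 1 e (oner_neq0 _).
  have := scaling_Rintegral sS mh; rewrite normr1 invr1 mul1r => <-.
  by apply: eq_Rintegral => x _; rewrite /f mul1r.
have intf (e : R) : `]-1, 1[%classic e -> leb.-integrable setT (EFin \o f e).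
  move=> _; have sS := @lebesgue_scaling R 1 e (oner_neq0 _).
  have : cintegrable leb (fun x => (h x)%:C) by split=> //=; exact: integrable0.
  move=> /(cintegrable_scaling sS)[+ _] /=; rewrite /f.
  by under eq_fun do rewrite mul1r.
have := @differentiation_under_integral R _ _ leb f setT measurableT 0 (-1) 1 I0
  intf (fun e x _ _ => @ex_derive _ _ _ _ _ _ _ (df e x)) G G0 iG.
rewrite (_ : (fun x' : R => _) = fun=> \int[leb]_x h x); last first.
  by apply/funext => e; rewrite F.
rewrite derive1_cst => E.
rewrite [RHS]E.
  by apply: eq_Rintegral => x _; rewrite p1E addr0.
move=> e x; rewrite /= in_itv/= => /andP[e1 e2] _; rewrite p1E dG//.
by rewrite ler_norml !ltW.
Qed.

(** The Fourier transform of [gauss], which is real because [gauss] is even. *)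
Definition gausscos (w : R) : R := \int[leb]_x (gauss x * cos (2 * pi * (w * x))).

Lemma integrable_gauss_bounded (a : R) (u : R -> R) (M : R) : 0 < a ->
  measurable_fun setT u -> (forall x, `|u x| <= M * gauss (a * x)) ->
  leb.-integrable setT (EFin \o u).
Proof.
move=> a0 mu uM; apply: (le_integrable measurableT _ _
  (integrableZl measurableT M (integrable_gauss_dilation a0))).
  exact/measurable_EFinP.
by move=> x _ /=; rewrite lee_fin (le_trans (uM x))// ler_norm.
Qed.

(** Differentiating under the integral sign and integrating by parts shows that
    the transform solves the differential equation y' = - 2 pi v y of the
    Gaussian. *)
Lemma gausscosE w : gausscos w = gauss w.
Proof.
have mcos (v : R) : measurable_fun setT (fun x : R => cos (2 * pi * (v * x))).
  by have [] := @cmeasurable_cis2pi R _ _ (fun x => v * x) (measurable_funM (measurable_cst v) (@measurable_id _ _ setT)).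
have msin (v : R) : measurable_fun setT (fun x : R => sin (2 * pi * (v * x))).
  by have [] := @cmeasurable_cis2pi R _ _ (fun x => v * x) (measurable_funM (measurable_cst v) (@measurable_id _ _ setT)).
have mg := measurable_gauss.
have igc (v : R) : leb.-integrable setT (EFin \o (fun x => gauss x * cos (2 * pi * (v * x)))).
  apply: (@integrable_gauss_bounded 1 _ 1) => //.
    exact: measurable_funM.
  move=> x; rewrite mul1r mul1r normrM ger0_norm ?gauss_ge0//.
  by rewrite ler_piMr ?gauss_ge0// ler_norml cos_geN1 cos_le1.
have igs (v : R) : leb.-integrable setT (EFin \o (fun x => gauss x * sin (2 * pi * (v * x)))).
  apply: (@integrable_gauss_bounded 1 _ 1) => //.
    exact: measurable_funM.
  move=> x; rewrite mul1r mul1r normrM ger0_norm ?gauss_ge0//.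
  by rewrite ler_piMr ?gauss_ge0// ler_norml sin_geN1 sin_le1.
have ixs (v : R) : leb.-integrable setT (EFin \o (fun x => x * gauss x * sin (2 * pi * (v * x)))).
  apply: (@integrable_gauss_bounded 2^-1 _ 1); first by rewrite invr_gt0.
    by apply: measurable_funM => //; exact: measurable_funM.
  move=> x; rewrite mul1r normrM mulrC (mulrC 2^-1) (le_trans _ (normr_mul_gauss_le x))//.
  rewrite normrM (@ger0_norm _ (gauss x)) ?gauss_ge0//.
  by rewrite ler_piMl ?mulr_ge0 ?gauss_ge0// ler_norml sin_geN1 sin_le1.
(* Integration by parts, as the vanishing of the integral of a derivative. *)
have parts (v : R) : \int[leb]_x (x * gauss x * sin (2 * pi * (v * x))) = v * gausscos v.
  have dh (x : R) : is_derive x (1 : R) (fun x => gauss x * sin (2 * pi * (v * x)))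
    ((2 * pi) * (v * (gauss x * cos (2 * pi * (v * x))) -
       x * gauss x * sin (2 * pi * (v * x)))).
    apply: is_derive_eq; rewrite /GRing.scale/=; ring.
  have G0 (x : R) : 0 <= 2 * pi * (`|v| + 1) * expR pi * gauss (2^-1 * (2^-1 * x)).
    by rewrite mulr_ge0 ?gauss_ge0// mulr_ge0 ?expR_ge0// mulr_ge0 ?addr_ge0// mulr_ge0 ?pi_ge0.
  have iG : leb.-integrable setT (EFin \o (fun x : R =>
      2 * pi * (`|v| + 1) * expR pi * gauss (2^-1 * (2^-1 * x)))).
    apply: (@integrable_gauss_bounded (2^-1 * 2^-1) _ (2 * pi * (`|v| + 1) * expR pi)).
    - by rewrite mulr_gt0 ?invr_gt0.
    - apply: measurable_funM => //; apply: (measurableT_comp measurable_gauss).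
      by apply: measurable_funM => //; exact: measurable_funM.
    - by move=> x; rewrite ger0_norm// mulrA.
  have dG (x e : R) : `|e| <= 1 ->
      `|(2 * pi) * (v * (gauss (x + e) * cos (2 * pi * (v * (x + e)))) -
       (x + e) * gauss (x + e) * sin (2 * pi * (v * (x + e))))| <=
      2 * pi * (`|v| + 1) * expR pi * gauss (2^-1 * (2^-1 * x)).
    move=> e1; rewrite normrM ger0_norm ?mulr_ge0 ?pi_ge0// -!mulrA.
    rewrite ler_wpM2l// ler_wpM2l ?pi_ge0//.
    have gle : gauss (2^-1 * (x + e)) <= expR pi * gauss (2^-1 * (2^-1 * x)).
      rewrite mulrDr; apply: gauss_shift_le.
      by rewrite normrM ger0_norm// ?invr_ge0//; lra.
    have gxe : gauss (x + e) <= gauss (2^-1 * (x + e)).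
      rewrite ler_expR lerN2 ler_wpM2l ?pi_ge0//.
      by have := sqr_ge0 (x + e); nra.
    apply: le_trans (_ : (`|v| + 1) * gauss (2^-1 * (x + e)) <= _); last first.
      by rewrite ler_wpM2l// addr_ge0.
    apply: le_trans (ler_normB _ _) _; rewrite [leRHS]mulrDl mul1r lerD//.
      rewrite !normrM ler_wpM2l// (ger0_norm (gauss_ge0 _)) (le_trans _ gxe)//.
      by rewrite ler_piMr ?gauss_ge0// ler_norml cos_geN1 cos_le1.
    rewrite (mulrC 2^-1) (le_trans _ (normr_mul_gauss_le _))//.
    rewrite !normrM (ger0_norm (gauss_ge0 _)) mulrA.
    by rewrite ler_piMr ?mulr_ge0 ?gauss_ge0// ler_norml sin_geN1 sin_le1.
  have := Rintegral_derivative_eq0 dh (igs v) iG G0 dG.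
  rewrite RintegralZl//; last first.
    rewrite /comp; under eq_fun do rewrite EFinB.
    apply: integrableB => //; last exact: ixs.
    exact: (integrableZl measurableT v (igc v)).
  rewrite RintegralB//; last first.
    exact: (integrableZl measurableT v (igc v)).
  move/eqP; rewrite mulf_eq0 mulf_eq0 pnatr_eq0/= gt_eqF ?pi_gt0//=.
  rewrite subr_eq0 => /eqP <-.
  by rewrite RintegralZl.
have dgc (v : R) : is_derive v (1 : R) gausscos (- (2 * pi * v) * gausscos v).
  have I0 : `](v - 1), (v + 1)[%classic v by rewrite /= in_itv/= ltrBlDr ltrDl ltr01.
  pose f (v x : R) := gauss x * cos (2 * pi * (v * x)).
  have df (e x : R) : is_derive e (1 : R) (f ^~ x) (- (2 * pi) * (x * gauss x * sin (2 * pi * (e * x)))).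
    rewrite /f; apply: is_derive_eq; rewrite /GRing.scale/=; ring.
  have p1E e x : partial1of2 f e x = - (2 * pi) * (x * gauss x * sin (2 * pi * (e * x))).
    by rewrite partial1of2E; apply: derive_val.
  have iG : leb.-integrable setT (EFin \o (fun x => 2 * pi * gauss (2^-1 * x))).
    apply: (@integrable_gauss_bounded 2^-1 _ (2 * pi)); first by rewrite invr_gt0.
      apply: measurable_funM => //; apply: (measurableT_comp measurable_gauss).
      exact: measurable_funM.
    by move=> x; rewrite ger0_norm// mulr_ge0 ?gauss_ge0// mulr_ge0 ?pi_ge0.
  have G0 (x : R) : 0 <= 2 * pi * gauss (2^-1 * x).
    by rewrite mulr_ge0 ?gauss_ge0// mulr_ge0 ?pi_ge0.
  have G_ub (e x : R) : `](v - 1), (v + 1)[%classic e -> setT x ->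
      `|partial1of2 f e x| <= 2 * pi * gauss (2^-1 * x).
    move=> _ _; rewrite p1E normrM normrN (@ger0_norm _ (2 * pi)) ?mulr_ge0 ?pi_ge0//.
    rewrite ler_wpM2l ?mulr_ge0 ?pi_ge0// mulrC (mulrC 2^-1) (le_trans _ (normr_mul_gauss_le x))//.
    rewrite normrM normrM (@ger0_norm _ (gauss x)) ?gauss_ge0//.
    by rewrite ler_piMl ?mulr_ge0 ?gauss_ge0// ler_norml sin_geN1 sin_le1.
  have D := @derivable_under_integral R _ _ leb f setT measurableT v _ _ I0
    (fun e _ => igc e) (fun e x _ _ => @ex_derive _ _ _ _ _ _ _ (df e x)) _ G0 iG G_ub.
  have E := @differentiation_under_integral R _ _ leb f setT measurableT v _ _ I0
    (fun e _ => igc e) (fun e x _ _ => @ex_derive _ _ _ _ _ _ _ (df e x)) _ G0 iG G_ub.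
  apply: DeriveDef; first exact: D.
  rewrite -derive1E E.
  under eq_Rintegral do rewrite p1E.
  by rewrite RintegralZl// parts; ring.
have cst (v : R) : is_derive v (1 : R) (fun v => gausscos v * expR (pi * v ^+ 2)) 0.
  apply: is_derive_eq; rewrite /GRing.scale/=; ring.
have := @is_derive_0_is_cst R _ w 0 cst.
rewrite /= expr0n/= mulr0 expR0 mulr1.
have -> : gausscos 0 = 1.
  rewrite /gausscos /Rintegral.
  under eq_integral do rewrite mul0r mulr0 cos0 mulr1 -[X in gauss X]mul1r.
  by rewrite integral_gauss_dilation//= invr1.
by move=> e; rewrite /gauss expRN -[LHS]mulr1 -(mulfV (lt0r_neq0 (expR_gt0 (pi * w ^+ 2)))) mulrA e mul1r.
Qed.

Lemma cintegrable_gauss1 (w : R) :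
  cintegrable leb (fun x => (gauss x)%:C * cis2pi (w * x)).
Proof.
apply: (@le_cintegrable R _ _ leb _ (fun x => gauss (1 * x))).
- apply: cmeasurableM; first exact: cmeasurableC measurable_gauss.
  by apply: cmeasurable_cis2pi; exact: measurable_funM.
- by move=> x; rewrite normcM normc_cis2pi mulr1 mul1r normcC ger0_norm// gauss_ge0.
- exact: integrable_gauss_dilation.
Qed.

Lemma cintegral_gauss1 (w : R) :
  cintegral leb (fun x => (gauss x)%:C * cis2pi (w * x)) = (gauss w)%:C.
Proof.
apply: complexP => /=.
  rewrite -gausscosE /gausscos; apply: eq_Rintegral => x _.
  by rewrite mul0r subr0.
pose u (x : R) := gauss x * sin (2 * pi * (w * x)) + 0 * cos (2 * pi * (w * x)).
have uE x : u x = gauss x * sin (2 * pi * (w * x)) by rewrite /u mul0r addr0.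
have iu : leb.-integrable setT (EFin \o u) by have [_] := cintegrable_gauss1 w.
have mu : measurable_fun setT u.
  by apply/measurable_EFinP; exact: measurable_int iu.
rewrite -/(\int[leb]_x u x).
have sS := @lebesgue_scaling R (-1) 0 (ltr0_neq0 (ltrN10 R)).
have := scaling_Rintegral sS mu.
rewrite normrN normr1 invr1 mul1r.
have -> : \int[leb]_x u (-1 * x + 0) = - \int[leb]_x u x; last first.
  by move/eqP; rewrite eq_sym -addr_eq0 -mulr2n mulrn_eq0/= => /eqP.
rewrite -[RHS]mulN1r -RintegralZl//.
  apply: eq_Rintegral => x _; rewrite !uE addr0 /gauss mulN1r sqrrN !mulrN sinN; ring.
Qed.

End gauss1.

Section gaussn.
Context {R : realType}.

Lemma dot_cons n (z w : measurableTypeR R * 'rV[R]_n) :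
  dot (rV_cons z) (rV_cons w) = z.1 * w.1 + dot z.2 w.2.
Proof.
rewrite /dot big_ord_recl !rV_cons0; congr (_ + _).
by apply: eq_bigr => i _; rewrite !rV_consS.
Qed.

Lemma dotC n (x y : 'rV[R]_n) : dot x y = dot y x.
Proof. by apply: eq_bigr => i _; rewrite mulrC. Qed.

Lemma dotDl n (x y z : 'rV[R]_n) : dot (x + y) z = dot x z + dot y z.
Proof. by rewrite -big_split; apply: eq_bigr => i _; rewrite mxE mulrDl. Qed.

Lemma dotDr n (x y z : 'rV[R]_n) : dot x (y + z) = dot x y + dot x z.
Proof. by rewrite dotC dotDl !(dotC x). Qed.

Lemma dotZl n a (x z : 'rV[R]_n) : dot (a *: x) z = a * dot x z.
Proof. by rewrite mulr_sumr; apply: eq_bigr => i _; rewrite mxE mulrA. Qed.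

Lemma dotZr n a (x z : 'rV[R]_n) : dot x (a *: z) = a * dot x z.
Proof. by rewrite dotC dotZl dotC. Qed.

Lemma dotNl n (x z : 'rV[R]_n) : dot (- x) z = - dot x z.
Proof. by rewrite -scaleN1r dotZl mulN1r. Qed.

Lemma dotNr n (x z : 'rV[R]_n) : dot x (- z) = - dot x z.
Proof. by rewrite dotC dotNl dotC. Qed.

Lemma dotBl n (x y z : 'rV[R]_n) : dot (x - y) z = dot x z - dot y z.
Proof. by rewrite dotDl dotNl. Qed.

Lemma dotBr n (x y z : 'rV[R]_n) : dot x (y - z) = dot x y - dot x z.
Proof. by rewrite dotDr dotNr. Qed.

Lemma dot_ge0 n (x : 'rV[R]_n) : 0 <= dot x x.
Proof. by apply: sumr_ge0 => i _; rewrite -expr2 sqr_ge0. Qed.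

Lemma dot0l n (x : 'rV[R]_n) : dot 0 x = 0.
Proof. by rewrite /dot big1// => i _; rewrite mxE mul0r. Qed.

Lemma dot0r n (x : 'rV[R]_n) : dot x 0 = 0.
Proof. by rewrite dotC dot0l. Qed.

Lemma measurable_dot d (T : measurableType d) n (f g : T -> 'rV[R]_n) :
  measurable_fun setT f -> measurable_fun setT g ->
  measurable_fun setT (fun x => dot (f x) (g x)).
Proof.
move=> /measurable_fun_rVP mf /measurable_fun_rVP mg.
apply: measurable_sum => i; exact: measurable_funM.
Qed.

Lemma measurable_rVD d (T : measurableType d) n (f g : T -> 'rV[R]_n) :
  measurable_fun setT f -> measurable_fun setT g ->
  measurable_fun setT (fun x => f x + g x).
Proof.
move=> /measurable_fun_rVP mf /measurable_fun_rVP mg.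
apply/measurable_fun_rVP => i; under eq_fun do rewrite mxE.
exact: measurable_funD.
Qed.

Lemma measurable_rVZ d (T : measurableType d) n (a : T -> R) (f : T -> 'rV[R]_n) :
  measurable_fun setT a -> measurable_fun setT f ->
  measurable_fun setT (fun x => a x *: f x).
Proof.
move=> ma /measurable_fun_rVP mf.
apply/measurable_fun_rVP => i; under eq_fun do rewrite mxE.
exact: measurable_funM.
Qed.

Lemma measurable_rVN d (T : measurableType d) n (f : T -> 'rV[R]_n) :
  measurable_fun setT f -> measurable_fun setT (fun x => - f x).
Proof.
by move=> mf; under eq_fun do rewrite -scaleN1r; exact: measurable_rVZ.
Qed.

Lemma measurable_rVB d (T : measurableType d) n (f g : T -> 'rV[R]_n) :
  measurable_fun setT f -> measurable_fun setT g ->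
  measurable_fun setT (fun x => f x - g x).
Proof. by move=> mf mg; apply: measurable_rVD => //; exact: measurable_rVN. Qed.

Definition gaussn n (v : 'rV[R]_n) : R := expR (- (pi * dot v v)).

Lemma gaussn_gt0 n (v : 'rV[R]_n) : 0 < gaussn v. Proof. exact: expR_gt0. Qed.

Lemma gaussn_ge0 n (v : 'rV[R]_n) : 0 <= gaussn v. Proof. exact: expR_ge0. Qed.

Lemma gaussn_le1 n (v : 'rV[R]_n) : gaussn v <= 1.
Proof. by rewrite -expR0 ler_expR oppr_le0 mulr_ge0 ?dot_ge0// pi_ge0. Qed.

Lemma gaussn_cons n (z : measurableTypeR R * 'rV[R]_n) :
  gaussn (rV_cons z) = gauss z.1 * gaussn z.2.
Proof. by rewrite /gaussn dot_cons mulrDr opprD expRD -expr2. Qed.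

Lemma measurable_gaussn n : measurable_fun setT (@gaussn n).
Proof.
apply: (measurableT_comp (@measurable_expR R)); apply: measurableT_comp => //.
by apply: measurable_funM => //; exact: measurable_dot.
Qed.

(** Both the Gaussian and the exponential factor over the coordinates. *)
Lemma gaussn_fourier n (w : 'rV[R]_n) :
  cintegrable (volume n) (fun v => (gaussn v)%:C * cis2pi (dot w v)) /\
  cintegral (volume n) (fun v => (gaussn v)%:C * cis2pi (dot w v)) =
  (gaussn w)%:C.
Proof.
have mf k (u : 'rV[R]_k) : cmeasurable (fun v => (gaussn v)%:C * cis2pi (dot u v)).
  apply: cmeasurableM; first by apply: cmeasurableC; exact: measurable_gaussn.
  by apply: cmeasurable_cis2pi; exact: measurable_dot.
elim: n w => [|n IH] w.
  have v0 (v : 'rV[R]_0) : v = 0 by apply/rowP => -[].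
  split.
    apply/cintegrableP => //; rewrite integral_dirac//; last first.
      apply/measurable_EFinP; exact: cmeasurable_normc.
    by rewrite diracE mem_set// mul1e ltry.
  rewrite /cintegral /Rintegral !integral_dirac//; last 2 first.
  - by apply/measurable_EFinP; have [] := mf _ w.
  - by apply/measurable_EFinP; have [] := mf _ w.
  rewrite diracE mem_set// !mul1e /=.
  by rewrite (v0 w) dot0l mulr0 cos0 sin0 !mulr1 !mulr0 subr0 addr0.
pose wh := rV_uncons w.
have wE : w = rV_cons wh.
  apply/rowP => i; have [j ->|->] := unliftP ord0 i.
    by rewrite rV_consS mxE.
  by rewrite rV_cons0.
have [iIH IHE] := IH wh.2.
have E : (fun z : measurableTypeR R * 'rV[R]_n =>
      (gaussn (rV_cons z))%:C * cis2pi (dot w (rV_cons z))) =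
    (fun z => ((gauss z.1)%:C * cis2pi (wh.1 * z.1)) *
              ((gaussn z.2)%:C * cis2pi (dot wh.2 z.2))).
  apply/funext => z; rewrite gaussn_cons wE dot_cons cis2piD rmorphM/=; ring.
split.
  apply/(cintegrable_volume (mf _ w)); rewrite E.
  exact: (cintegrable_prod (cintegrable_gauss1 wh.1) iIH).
rewrite cintegral_volume// E.
rewrite (cintegral_prod (cintegrable_gauss1 wh.1) iIH).
by rewrite cintegral_gauss1 IHE wE gaussn_cons rmorphM.
Qed.

Lemma gaussn0 n : gaussn (0 : 'rV[R]_n) = 1.
Proof. by rewrite /gaussn dot0l mulr0 oppr0 expR0. Qed.

Lemma integrable_gaussn n : (volume n).-integrable setT (fun v => (@gaussn n v)%:E).
Proof.
have [/cintegrable_normc + _] := @gaussn_fourier n 0.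
by under eq_fun do rewrite normcM normc_cis2pi mulr1 normcC ger0_norm ?gaussn_ge0//.
Qed.

Lemma cintegrable_gaussn n : cintegrable (volume n) (fun v => (gaussn v)%:C).
Proof. by split => /=; [exact: integrable_gaussn|exact: integrable0]. Qed.

Lemma cintegral_gaussn n : cintegral (volume n) (fun v => (gaussn v)%:C) = 1.
Proof.
have [_] := @gaussn_fourier n 0; rewrite gaussn0 -[1%:C]/(1 : R[i]) => <-.
by congr cintegral; apply/funext => v; rewrite dot0l cis2pi0 mulr1.
Qed.

Lemma cintegrable_gaussn_dilation n (s : R) : 0 < s ->
  cintegrable (volume n) (fun v => (gaussn (s *: v))%:C).
Proof.
move=> s0; exact: (cintegrable_scaling (volume_dilation n s0) (@cintegrable_gaussn n)).
Qed.

End gaussn.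

(** * Measurability and sequential continuity *)

Lemma measurable_dotr {R : realType} n (w : 'rV[R]_n) :
  measurable_fun setT (dot w).
Proof. exact: (@measurable_dot _ _ _ _ (fun=> w) id). Qed.

Lemma measurable_rVZr {R : realType} n (a : R) :
  measurable_fun setT (fun v : 'rV[R]_n => a *: v).
Proof. exact: (@measurable_rVZ _ _ _ _ (fun=> a) id). Qed.

Ltac vmeas := lazymatch goal with
 | |- measurable_fun _ (fun _ => ?c) => exact: measurable_cst
 | |- measurable_fun _ (fun x => x) => exact: measurable_id
 | |- measurable_fun _ id => exact: measurable_id
 | |- measurable_fun _ fst => exact: measurable_fst
 | |- measurable_fun _ snd => exact: measurable_snd
 | |- measurable_fun _ (fun x => (x.1)%PAIR) => exact: measurable_fst
 | |- measurable_fun _ (fun x => (x.2)%PAIR) => exact: measurable_snd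
 | |- measurable_fun _ (fun x => (@?f x).1) =>
     apply: (measurableT_comp measurable_fst); vmeas
 | |- measurable_fun _ (fun x => (@?f x).2) =>
     apply: (measurableT_comp measurable_snd); vmeas
 | |- measurable_fun _ (fun x => dot _ _) => apply: measurable_dot; vmeas
 | |- measurable_fun _ (fun x => gaussn _) =>
     apply: (measurableT_comp (@measurable_gaussn _ _)); vmeas
 | |- measurable_fun _ (fun x => expR _) =>
     apply: (measurableT_comp (@measurable_expR _)); vmeas
 | |- measurable_fun _ (fun x => (_, _)) => apply/measurable_fun_pair; vmeas
 | |- measurable_fun _ (fun x => _ + _) =>
     first [apply: measurable_rVD|apply: measurable_funD]; vmeas
 | |- measurable_fun _ (fun x => - _) =>
     first [apply: measurable_rVN|apply: measurableT_comp; first by []]; vmeas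
 | |- measurable_fun _ (fun x => _ *: _) => apply: measurable_rVZ; vmeas
 | |- measurable_fun _ (fun x => _ * _) => apply: measurable_funM; vmeas
 | |- _ => first [by []|exact: measurable_dotr|exact: measurable_gaussn|
     exact: measurable_expR|exact: measurable_rVZr]
 end.

Ltac cmeas := lazymatch goal with
 | |- cmeasurable (fun _ => ?c) => exact: cmeasurable_cst
 | |- cmeasurable (fun x => _ * _) => apply: cmeasurableM; cmeas
 | |- cmeasurable (fun x => _ + _) => apply: cmeasurableD; cmeas
 | |- cmeasurable (fun x => - _) => apply: cmeasurableN; cmeas
 | |- cmeasurable (fun x => Num.conj _) => apply: cmeasurableJ; cmeas
 | |- cmeasurable (fun x => cis2pi _) => apply: cmeasurable_cis2pi; vmeas
 | |- cmeasurable (fun x => ?f (@?g x)) =>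
     first [ assumption | apply: (@cmeasurable_comp _ _ _ _ _ f g);
       [assumption|vmeas] | apply: cmeasurableC; vmeas]
 | |- _ => first [assumption | apply: cmeasurableC; vmeas]
 end.

Section convergence.
Context {R : realType}.

Definition cvgv n (u : nat -> 'rV[R]_n) (l : 'rV[R]_n) : Prop :=
  forall i, u m 0 i @[m --> \oo] --> l 0 i.

(** Dominated convergence is about sequences, hence this form of continuity. *)
Definition seqcont n (f : 'rV[R]_n -> R[i]) : Prop :=
  forall u l, cvgv u l -> cvgc (fun m => f (u m)) (f l).

Lemma cvgv_cst n (l : 'rV[R]_n) : cvgv (fun=> l) l.
Proof. by move=> i; exact: cvg_cst. Qed.

Lemma cvgvD n (u v : nat -> 'rV[R]_n) a b : cvgv u a -> cvgv v b ->
  cvgv (fun m => u m + v m) (a + b).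
Proof.
by move=> ua vb i; rewrite mxE; under eq_fun do rewrite mxE; exact: cvgD.
Qed.

Lemma cvgvN n (u : nat -> 'rV[R]_n) a : cvgv u a ->
  cvgv (fun m => - u m) (- a).
Proof. by move=> ua i; rewrite mxE; under eq_fun do rewrite mxE; exact: cvgN. Qed.

Lemma cvgvB n (u v : nat -> 'rV[R]_n) a b : cvgv u a -> cvgv v b ->
  cvgv (fun m => u m - v m) (a - b).
Proof. by move=> ua vb; apply: cvgvD => //; exact: cvgvN. Qed.

Lemma cvgvZ n (s : nat -> R) (t : R) (u : nat -> 'rV[R]_n) a : s @ \oo --> t ->
  cvgv u a -> cvgv (fun m => s m *: u m) (t *: a).
Proof.
by move=> st ua i; rewrite mxE; under eq_fun do rewrite mxE; exact: cvgM.
Qed.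

Lemma rV_norm_le n (v : 'rV[R]_n) (a : R) : 0 <= a ->
  (forall i, `|v 0 i| <= a) -> `|v| <= a.
Proof.
move=> a0 va; rewrite [leLHS]mx_normrE; apply: bigmax_le => // -[i j] _ /=.
by rewrite (ord1 i).
Qed.

Lemma le_rV_norm n (v : 'rV[R]_n) i : `|v 0 i| <= `|v|.
Proof.
rewrite [leRHS]mx_normrE.
exact: (le_bigmax _ (fun k : 'I_1 * 'I_n => `|v k.1 k.2|) (0, i)).
Qed.

Lemma cvgv_norm n (v : nat -> 'rV[R]_n) (s : nat -> R) : (forall k, `|v k| <= s k) ->
  s @ \oo --> (0 : R) -> cvgv v 0.
Proof.
move=> vs s0 i; rewrite mxE; apply: norm_cvg0.
apply: (@squeeze_cvgr _ _ _ _ (fun=> 0) s) => //; last exact: cvg_cst.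
by near=> k; rewrite normr_ge0/= (le_trans (le_rV_norm _ _)).
Unshelve. all: by end_near.
Qed.

Lemma cvg_dot n (u v : nat -> 'rV[R]_n) a b : cvgv u a -> cvgv v b ->
  dot (u m) (v m) @[m --> \oo] --> dot a b.
Proof.
move=> ua vb; rewrite /dot; elim: (index_enum _) => [|i s IH].
  by under eq_fun do rewrite big_nil; rewrite big_nil; exact: cvg_cst.
under eq_fun do rewrite big_cons.
by rewrite big_cons; apply: cvgD => //; exact: cvgM.
Qed.

Lemma cvgc_cis2pi (u : nat -> R) l : u @ \oo --> l ->
  cvgc (fun m => cis2pi (u m)) (cis2pi l).
Proof.
move=> ul; have ul' : 2 * pi * u m @[m --> \oo] --> 2 * pi * l.
  by apply: cvgM => //; exact: cvg_cst.
split; rewrite /cis2pi/=.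
  by apply: (continuous_cvg _ _ ul'); exact: continuous_cos.
by apply: (continuous_cvg _ _ ul'); exact: continuous_sin.
Qed.

Lemma seqcontM n (f g : 'rV[R]_n -> R[i]) : seqcont f -> seqcont g ->
  seqcont (fun v => f v * g v).
Proof. by move=> cf cg u l ul; apply: cvgcM; [exact: cf|exact: cg]. Qed.

Lemma seqcont_prod n (I : Type) (s : seq I) (f : I -> 'rV[R]_n -> R[i]) :
  (forall i, seqcont (f i)) -> seqcont (fun v => \prod_(i <- s) f i v).
Proof.
move=> cf; elim: s => [|i s IH] u l ul.
  by rewrite big_nil; under eq_fun do rewrite big_nil; exact: cvgc_cst.
rewrite big_cons; under eq_fun do rewrite big_cons.
by apply: cvgcM; [exact: cf|exact: IH].
Qed.

Lemma cvg_expR (u : nat -> R) l : u @ \oo --> l ->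
  expR (u m) @[m --> \oo] --> expR l.
Proof. by move=> ul; apply: (continuous_cvg _ _ ul); exact: continuous_expR. Qed.

Lemma seqcont_gaussn n : seqcont (fun v => (@gaussn R n v)%:C).
Proof.
move=> u l ul; apply: cvgc_real; apply: cvg_expR; apply: cvgN.
by apply: cvgM; [exact: cvg_cst|exact: cvg_dot].
Qed.

End convergence.

(** * Uniqueness almost everywhere *)

Section ae_uniqueness.
Context {R : realType}.

Let orthant n (a : 'rV[R]_n) : set 'rV[R]_n := [set v | forall i, a 0 i < v 0 i].
Let orthants n := range (@orthant n).

Lemma measurable_orthants n : @measurable _ 'rV[R]_n `<=` <<s @orthants n >>.
Proof.
apply: smallest_sub; first exact: smallest_sigma_algebra.
rewrite -bigcup_seq => Z [i _ [A mA <-]]; rewrite setTI /=.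
have [s0 sC sU] := @smallest_sigma_algebra _ setT (@orthants n).
have : (@RGenOInfty.G R).-sigma.-measurable A by rewrite -RGenOInfty.measurableE.
move: A {mA}; apply: smallest_sub.
  split => /=.
  - by rewrite preimage_set0.
  - move=> A HA; rewrite setTD preimage_setC -setTD; exact: sC.
  - by move=> F HF; rewrite preimage_bigcup; exact: sU.
move=> _ [x ->].
rewrite (_ : _ @^-1` _ = \bigcup_N orthant (\row_j (if j == i then x else - N%:R))).
  by apply: sU => N; apply: sub_sigma_algebra; exists (\row_j (if j == i then x else - N%:R)).
apply/seteqP; split => v /=; rewrite in_itv/= andbT.
  move=> xv.
  pose M := \sum_j `|v 0 j|.
  exists (Num.trunc M).+1 => // j; rewrite mxE; case: eqP => [->//|_].
  rewrite ltrNl (le_lt_trans (ler_norm _))// normrN.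
  rewrite (le_lt_trans (_ : _ <= M))//.
    by rewrite /M (bigD1 j)//= lerDl sumr_ge0.
  by apply: truncnS_gt.
by move=> [N _ /(_ i)]; rewrite mxE eqxx.
Qed.

(** Continuous functions increasing to the indicator function of the positive
    half-line. *)
Let step (m : nat) (x : R) : R := 1 - expR (- ((x + `|x|) / 2)) ^+ m.

Let step_itv m x : 0 <= step m x <= 1.
Proof.
rewrite /step subr_ge0 lerBlDr lerDl exprn_ge0 ?expR_ge0// andbT.
rewrite exprn_ile1 ?expR_ge0// -expR0 ler_expR oppr_le0 divr_ge0//.
by have := ler_norm (- x); rewrite normrN; lra.
Qed.

Let cvg_step x : step m x @[m --> \oo] --> (\1_[set y : R | 0 < y] x : R).
Proof.
rewrite indicE; case: (boolP (x \in _)); rewrite ?inE /= => x0.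
  rewrite -[X in _ --> X]subr0; apply: cvgB; first exact: cvg_cst.
  apply: cvg_expr; rewrite ger0_norm ?expR_ge0//.
  by rewrite -expR0 ltr_expR oppr_lt0 gtr0_norm// divr_gt0// addr_gt0.
rewrite (_ : (fun m => step m x) = fun=> 0); first exact: cvg_cst.
apply/funext => m; rewrite /step ler0_norm ?subrr ?mul0r ?oppr0 ?expR0 ?expr1n ?subrr//.
by move: x0; rewrite notin_setE /= => /negP; rewrite -leNgt.
Qed.

Let step_cont m (u : nat -> R) l : u @ \oo --> l ->
  step m (u k) @[k --> \oo] --> step m l.
Proof.
move=> ul; apply: cvgB; first exact: cvg_cst.
apply: (cvg_comp _ (fun x : R => x ^+ m) _ (@exprn_continuous R m _)).
apply: cvg_expR; apply: cvgN; apply: cvgM; last exact: cvg_cst.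
by apply: cvgD => //; exact: cvg_norm.
Qed.

Let measurable_step m : measurable_fun setT (step m).
Proof.
apply: measurable_funB => //; apply: measurable_funX.
apply: (measurableT_comp (@measurable_expR R)); apply: measurableT_comp => //.
by apply: measurable_funM => //; apply: measurable_funD.
Qed.

(** Orthants are increasing limits of continuous functions and generate the
    measurable sets; so the integral of w vanishes over every measurable set,
    by dominated convergence and a monotone class argument. *)
Lemma cintegrable_ae_eq0 n (w : 'rV[R]_n -> R[i]) : cintegrable (volume n) w ->
  (forall k : 'rV[R]_n -> R[i], cmeasurable k -> (forall v, normc (k v) <= 1) ->
    seqcont k -> cintegral (volume n) (fun v => w v * k v) = 0) ->
  {ae volume n, forall v, w v = 0}.
Proof.
move=> iw w0; have mw := cintegrable_cmeasurable iw.
have mind A : measurable A -> cmeasurable (fun v : 'rV[R]_n => (\1_A v : R)%:C).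
  by move=> mA; apply: cmeasurableC; exact: measurable_indic.
have nind A (v : 'rV[R]_n) : normc (\1_A v : R)%:C <= 1.
  by rewrite normcC indicE; case: (_ \in _); rewrite ?normr1 ?normr0.
have iind A : measurable A -> cintegrable (volume n) (fun v => w v * (\1_A v)%:C).
  by move=> mA; apply: (cintegrableMb iw (mind A mA)) => v; exact: nind.
pose H : set (set 'rV[R]_n) := [set A | measurable A /\
  cintegral (volume n) (fun v => w v * (\1_A v)%:C) = 0].
have HG : @orthants n `<=` H.
  move=> _ [a _ <-].
  have mO : measurable (orthant a).
    rewrite [X in measurable X](_ : _ = \big[setI/setT]_(i < n)
      ((fun v : 'rV[R]_n => v ord0 i) @^-1` `]a 0 i, +oo[%classic)).
      apply: bigsetI_measurable => i _; rewrite -[X in measurable X]setTI.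
      exact: measurable_coord_rV.
    rewrite -bigcap_seq; apply/seteqP; split=> v /= Hv i.
      by move=> _; rewrite /= in_itv/= andbT; exact: Hv.
    by have := Hv i (mem_index_enum i); rewrite /= in_itv/= andbT.
  split => //.
  pose k m (v : 'rV[R]_n) : R[i] := \prod_(i < n) (step m (v 0 i - a 0 i))%:C.
  have mk m : cmeasurable (k m).
    apply: cmeasurable_prod => i; apply: cmeasurableC.
    apply: (measurableT_comp (measurable_step m)).
    by apply: measurable_funB => //; exact: measurable_coord_rV.
  have k1 m v : normc (k m v) <= 1.
    rewrite normc_prod; have : 0 <= \prod_(i < n) normc (step m (v 0 i - a 0 i))%:C <= 1.
      elim/big_ind : _ => [|x y /andP[x0 x1] /andP[y0 y1]|i _].
      - by rewrite ler01 lexx.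
      - by rewrite mulr_ge0// mulr_ile1.
      - have /andP[s0 s1] := step_itv m (v 0 i - a 0 i).
        by rewrite normcC ger0_norm// s0 s1.
    by case/andP.
  have ck m : seqcont (k m).
    apply: seqcont_prod => i u l ul; apply: cvgc_real.
    by apply: step_cont; apply: cvgB => //; exact: cvg_cst.
  have kO v : cvgc (fun m => k m v) (\1_(orthant a) v)%:C.
    rewrite (_ : (_)%:C = \prod_(i < n) (\1_[set y : R | 0 < y] (v 0 i - a 0 i))%:C).
      rewrite /k; elim: (index_enum _) => [|i s IH].
        rewrite big_nil (_ : (fun _ => _) = fun=> 1); first exact: cvgc_cst.
        by apply/funext => m; rewrite big_nil.
      rewrite big_cons (_ : (fun _ => _) = fun m => (step m (v 0 i - a 0 i))%:C *
        \prod_(j <- s) (step m (v 0 j - a 0 j))%:C).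
        by apply: cvgcM => //; apply: cvgc_real; exact: cvg_step.
      by apply/funext => m; rewrite big_cons.
    have [vO|vO] := pselect (orthant a v).
      rewrite indicE mem_set//= big1// => i _.
      by rewrite indicE mem_set//= subr_gt0; exact: vO.
    rewrite indicE memNset//=; move/existsNP : vO => [i vi].
    by rewrite (bigD1 i)//= indicE memNset ?mul0r//= subr_gt0.
  apply: (@cvgc_unique _ (fun m => cintegral (volume n) (fun v => w v * k m v))).
    apply: (cdominated_convergence _ _ _ (cintegrable_normc iw)).
    - by move=> m; exact: cmeasurableM.
    - by apply: cmeasurableM => //; exact: mind.
    - by apply: aeW => v; apply: cvgcM => //; exact: cvgc_cst.
    - by move=> m v; rewrite normcM ler_piMr ?normc_ge0.
  under eq_fun do rewrite w0//; exact: cvgc_cst.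
have lH : lambda_system setT H.
  split.
  - by [].
  - split => //; rewrite -[RHS](w0 (fun=> 1)).
    + by congr cintegral; apply/funext => v; rewrite indicT.
    + exact: cmeasurable_cst.
    + by move=> v; rewrite normc1.
    + by move=> u l _; exact: cvgc_cst.
  - move=> A B BA [mA A0] [mB B0]; split; first exact: measurableD.
    rewrite (_ : (fun v => _) = (fun v => w v * (\1_A v)%:C - w v * (\1_B v)%:C)).
      by rewrite (cintegralB (iind _ mA) (iind _ mB)) A0 B0 subr0.
    apply/funext => v; rewrite -mulrBr; congr (_ * _); rewrite -rmorphB/=.
    congr (_%:C); rewrite !indicE in_setD.
    by case: (boolP (v \in B)) => vB; case: (boolP (v \in A)) => vA //=;
      rewrite ?subrr ?subr0//; move: vA vB; rewrite notin_setE !inE => + /BA.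
  - move=> F ndF HF; have mF i : measurable (F i) by have [] := HF i.
    have mU : measurable (\bigcup_i F i) by exact: bigcupT_measurable.
    split => //.
    apply: (@cvgc_unique _ (fun m => cintegral (volume n) (fun v => w v * (\1_(F m) v)%:C))).
      apply: (cdominated_convergence _ _ _ (cintegrable_normc iw)).
      + by move=> m; apply: cmeasurableM => //; exact: mind.
      + by apply: cmeasurableM => //; exact: mind.
      + apply: aeW => v; apply: cvgcM; first exact: cvgc_cst.
        apply: cvgc_real.
        have [[N _ Fv]|nF] := pselect ((\bigcup_i F i) v).
          apply: cvg_near_cst; near=> m; rewrite !indicE (@mem_set _ (\bigcup_i F i)); last by exists N.
          rewrite mem_set//.
          have /subsetPset : (F N <= F m)%O by apply: ndF; near: m; exact: nbhs_infty_ge.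
          exact.
        apply: cvg_near_cst; near=> m; rewrite !indicE !memNset// => Fv.
        by apply: nF; exists m.
      + by move=> m v; rewrite normcM ler_piMr ?normc_ge0.
    under eq_fun => m do rewrite (HF m).2; exact: cvgc_cst.
have setIO : setI_closed (@orthants n).
  move=> _ _ [a _ <-] [b _ <-]; exists (\row_i Num.max (a 0 i) (b 0 i)) => //.
  apply/seteqP; split => v /=.
    by move=> h; split => i; have := h i; rewrite mxE gt_max => /andP[].
  by move=> [h1 h2] i; rewrite mxE gt_max h1 h2.
have Hall A : measurable A -> cintegral (volume n) (fun v => w v * (\1_A v)%:C) = 0.
  move=> /measurable_orthants sA.
  by have [] := @lambda_system_subset _ _ setIO setT H lH HG (fun X _ => @subsetT _ X) A sA.
have key (P : R[i] -> R) : measurable_fun setT (fun v => P (w v)) ->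
   (volume n).-integrable setT (fun v => (P (w v))%:E) ->
   (forall z (r : R), P (z * r%:C) = P z * r) ->
   (forall A, measurable A -> \int[volume n]_v P (w v * (\1_A v)%:C) = 0) ->
   {ae volume n, forall v, P (w v) = 0}.
  move=> mP iP PZ P0.
  have : ae_eq (volume n) setT (fun v => (P (w v))%:E) (cst 0%E).
    apply: integral_ae_eq => //.
    move=> A _ mA; rewrite integral0.
    rewrite -[LHS]fineK; last first.
      by apply: integrable_fin_num => //; exact: (integrableS measurableT).
    congr (_%:E); rewrite -[RHS](P0 A mA) [RHS]/Rintegral; congr fine.
    rewrite integral_mkcond; apply: eq_integral => v _; rewrite patchE indicE PZ.
    by case: (_ \in _); rewrite ?mulr1 ?mulr0.
  by apply: filterS => v /(_ I) [].
have [iw1 iw2] := iw; have [mw1 mw2] := mw.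
have h1 : {ae volume n, forall v, Re (w v) = 0}.
  apply: key => //.
    by move=> z r; rewrite !ReImE/= mulr0 subr0.
  by move=> A mA; have /(congr1 (@complex.Re R)) := Hall A mA.
have h2 : {ae volume n, forall v, Im (w v) = 0}.
  apply: key => //.
    by move=> z r; rewrite !ReImE/= mulr0 add0r.
  by move=> A mA; have /(congr1 (@complex.Im R)) := Hall A mA.
by apply: filterS2 h1 h2 => v e1 e2; apply: complexP.
Unshelve. all: by end_near. Qed.

End ae_uniqueness.

(** * Fourier inversion *)

Section fourier.
Context {R : realType} {n : nat}.
Local Notation vol := (volume n : {sigma_finite_measure set 'rV[R]_n -> \bar R}).
Implicit Types h k : 'rV[R]_n -> R[i].

Definition fourier h (w : 'rV[R]_n) : R[i] :=
  cintegral vol (fun t => h t * cis2pi (- dot w t)).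

Lemma cintegrableMcis h (u : 'rV[R]_n -> R) : cintegrable vol h ->
  measurable_fun setT u -> cintegrable vol (fun t => h t * cis2pi (u t)).
Proof.
move=> ih mu; apply: (cintegrableMb ih (cmeasurable_cis2pi mu)) => t.
by rewrite normc_cis2pi.
Qed.

Lemma normc_cintegralMcis_le h (u : 'rV[R]_n -> R) : cintegrable vol h ->
  measurable_fun setT u ->
  normc (cintegral vol (fun t => h t * cis2pi (u t))) <= \int[vol]_t normc (h t).
Proof.
move=> ih mu; rewrite (le_trans (normc_cintegral (cintegrableMcis ih mu)))//.
rewrite le_eqVlt; apply/orP; left; apply/eqP; apply: eq_Rintegral => t _.
by rewrite normcM normc_cis2pi mulr1.
Qed.

Lemma gaussn_dilation_fourier (s : R) (x : 'rV[R]_n) : 0 < s ->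
  cintegral vol (fun w => (gaussn (s *: w))%:C * cis2pi (dot w x)) =
  (s^-1 ^+ n)%:C * (gaussn (s^-1 *: x))%:C.
Proof.
move=> s0; have [_ <-] := gaussn_fourier (s^-1 *: x).
have mf : cmeasurable (fun v : 'rV[R]_n => (gaussn v)%:C * cis2pi (dot (s^-1 *: x) v)).
  cmeas.
rewrite -(cintegral_scaling (volume_dilation n s0) mf).
congr cintegral; apply/funext => w; congr (_ * cis2pi _).
by rewrite dotZl dotZr mulKf ?gt_eqF// dotC.
Qed.

(** Inserting the convergence factor exp(-pi |s w|^2) makes the double integral
    absolutely convergent and turns the inner integral into an average of the
    test function at scale s; both sides then converge as s tends to 0. *)
Lemma fourier_inversion h : cintegrable vol h -> cintegrable vol (fourier h) ->
  {ae vol, forall t,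
    h t = cintegral vol (fun w => fourier h w * cis2pi (dot w t))}.
Proof.
move=> ih iF; have mh := cintegrable_cmeasurable ih.
have mF := cintegrable_cmeasurable iF.
pose F := fourier h; rewrite -/F in iF mF *.
pose g t := cintegral vol (fun w => F w * cis2pi (dot w t)).
have mg : cmeasurable g.
  apply: (@cmeasurable_cintegral2 _ _ _ _ _ vol
    (fun z : 'rV[R]_n * 'rV[R]_n => F z.1 * cis2pi (dot z.1 z.2))).
  cmeas.
have gM t : normc (g t) <= \int[vol]_w normc (F w).
  by apply: normc_cintegralMcis_le => //; vmeas.
have mG : cmeasurable (fun t : 'rV[R]_n => (gaussn t)%:C) by cmeas.
have nG (t : 'rV[R]_n) : normc (gaussn t)%:C <= 1.
  by rewrite normcC ger0_norm ?gaussn_ge0 ?gaussn_le1.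
have iG := @cintegrable_gaussn R n.
have iw : cintegrable vol (fun t => (h t - g t) * (gaussn t)%:C).
  under eq_fun do rewrite mulrBl; apply: cintegrableD.
    exact: (cintegrableMb ih mG).
  apply: cintegrableN; under eq_fun do rewrite mulrC.
  exact: (cintegrableMb iG mg).
suff : {ae vol, forall t, (h t - g t) * (gaussn t)%:C = 0}.
  apply: filterS => t /eqP; rewrite mulf_eq0 => /orP[|/eqP].
    by rewrite subr_eq0 => /eqP.
  by move=> /(congr1 (@complex.Re R))/= /eqP; rewrite gt_eqF// gaussn_gt0.
apply: (cintegrable_ae_eq0 iw) => k0 mk0 k01 ck0.
(* The Gaussian factor makes the test function integrable. *)
pose k t := (gaussn t)%:C * k0 t.
have mk : cmeasurable k by apply: cmeasurableM.
have ik : cintegrable vol k by apply: (cintegrableMb iG mk0 k01).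
have k1 t : normc (k t) <= 1.
  by rewrite normcM mulr_ile1 ?normc_ge0.
have ck : seqcont k by apply: seqcontM => //; exact: seqcont_gaussn.
have ihk : cintegrable vol (fun t => h t * k t) by exact: (cintegrableMb ih mk k1).
have igk : cintegrable vol (fun t => g t * k t).
  by under eq_fun do rewrite mulrC; exact: (cintegrableMb ik mg gM).
suff hg : cintegral vol (fun t => h t * k t) = cintegral vol (fun t => g t * k t).
  rewrite (_ : (fun v => _) = fun t => h t * k t - g t * k t).
    by rewrite cintegralB// hg subrr.
  by apply/funext => t; rewrite /k; ring.
pose s (m : nat) : R := m.+1%:R^-1.
have s0 m : 0 < s m by rewrite invr_gt0.
pose K w := cintegral vol (fun t => k t * cis2pi (dot w t)).
have mK : cmeasurable K.
  apply: (@cmeasurable_cintegral1 _ _ _ _ _ vol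
    (fun z : 'rV[R]_n * 'rV[R]_n => k z.2 * cis2pi (dot z.1 z.2))).
  cmeas.
have KM w : normc (K w) <= \int[vol]_t normc (k t).
  by apply: normc_cintegralMcis_le => //; vmeas.
(* The average of k at scale [s m] around y, which [AE] expresses by the
   Fourier transform of k with a convergence factor. *)
pose A m (y : 'rV[R]_n) := cintegral vol (fun u => k (s m *: u + y) * (gaussn u)%:C).
have iGs m := @cintegrable_gaussn_dilation R n _ (s0 m).
have iGK m : cintegrable vol (fun w => (gaussn (s m *: w))%:C * K w).
  exact: (cintegrableMb (iGs m) mK KM).
have AE m (y : 'rV[R]_n) : A m y =
    cintegral vol (fun w => (gaussn (s m *: w))%:C * K w * cis2pi (- dot w y)).
  pose f (z : 'rV[R]_n * 'rV[R]_n) :=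
    (gaussn (s m *: z.1))%:C * k z.2 * cis2pi (dot z.1 z.2 - dot z.1 y).
  have iff : cintegrable (vol \x vol)%E f.
    apply: (@cintegrableMb _ _ _ _ _ _ 1 (cintegrable_prod (iGs m) ik)).
      by cmeas.
    by move=> z; rewrite normc_cis2pi.
  transitivity (cintegral vol (fun w => cintegral vol (fun t => f (w, t)))); last first.
    congr cintegral; apply/funext => w; rewrite /K /f.
    rewrite mulrAC -cintegralZl; last by apply: cintegrableMcis => //; vmeas.
    congr cintegral; apply/funext => t /=; rewrite cis2piD; ring.
  rewrite cFubini// /f /=.
  transitivity (cintegral vol (fun t => k t * ((s m)^-1 ^+ n)%:C * (gaussn ((s m)^-1 *: (t - y)))%:C)); last first.
    congr cintegral; apply/funext => t; rewrite -mulrA -gaussn_dilation_fourier// -cintegralZl.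
      by congr cintegral; apply/funext => w; rewrite dotBr; ring.
    by apply: cintegrableMcis => //; vmeas.
  have sS := scaling_comp (volume_shift y) (volume_dilation n (s0 m)).
  rewrite [X in _ = cintegral _ X](_ : _ = fun t =>
    ((s m)^-1 ^+ n)%:C * (k t * (gaussn ((s m)^-1 *: (t - y)))%:C)); last first.
    by apply/funext => t; rewrite mulrAC mulrC.
  rewrite cintegralZl; last first.
    apply: (@cintegrableMb _ _ _ _ _ _ 1 ik); first by cmeas.
    by move=> t; rewrite normcC ger0_norm ?gaussn_ge0 ?gaussn_le1.
  rewrite mul1r in sS.
  rewrite -(cintegral_scaling sS); last by cmeas.
  congr cintegral; apply/funext => u /=; congr (_ * (gaussn _)%:C).
  by rewrite addrK scalerA mulVf ?scale1r// gt_eqF.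
have B m : cintegral vol (fun y => h y * A m y) =
    cintegral vol (fun w => F w * ((gaussn (s m *: w))%:C * K w)).
  pose f (z : 'rV[R]_n * 'rV[R]_n) :=
    h z.1 * ((gaussn (s m *: z.2))%:C * K z.2) * cis2pi (- dot z.2 z.1).
  have iff : cintegrable (vol \x vol)%E f.
    apply: (@cintegrableMb _ _ _ _ _ _ 1 (cintegrable_prod ih (iGK m))).
      by cmeas.
    by move=> z; rewrite normc_cis2pi.
  transitivity (cintegral vol (fun y => cintegral vol (fun w => f (y, w)))).
    congr cintegral; apply/funext => y; rewrite AE -cintegralZl; last first.
      by apply: cintegrableMcis => //; vmeas.
    by congr cintegral; apply/funext => w; rewrite /f/=; ring.
  rewrite cFubini//; congr cintegral; apply/funext => w.
  rewrite /F /fourier -cintegralZr; last by apply: cintegrableMcis => //; vmeas.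
  by congr cintegral; apply/funext => t; rewrite /f/=; ring.
have s_cvg : s m @[m --> \oo] --> (0 : R) by exact: cvg_harmonic.
have mA m : cmeasurable (A m).
  apply: (@cmeasurable_cintegral1 _ _ _ _ _ vol
    (fun z : 'rV[R]_n * 'rV[R]_n => k (s m *: z.2 + z.1) * (gaussn z.2)%:C)).
  by cmeas.
have ikG m (y : 'rV[R]_n) : cintegrable vol (fun u => k (s m *: u + y) * (gaussn u)%:C).
  under eq_fun do rewrite mulrC; apply: (@cintegrableMb _ _ _ _ _ _ 1 iG) => //.
  apply: (cmeasurable_comp mk); vmeas.
have A1 m y : normc (A m y) <= 1.
  rewrite (le_trans (normc_cintegral (ikG m y)))//.
  have -> : 1 = \int[vol]_u normc (gaussn u)%:C :> R.
    rewrite -[LHS]/(Re (1 : R[i])) -(@cintegral_gaussn R n).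
    by apply: eq_Rintegral => u _; rewrite normcC ger0_norm ?gaussn_ge0.
  apply: le_Rintegral => //.
  - by have := cintegrable_normc (ikG m y).
  - by have := cintegrable_normc iG.
  - by move=> u _; rewrite normcM ler_piMl ?normc_ge0.
have Acvg y : cvgc (fun m => A m y) (k y).
  rewrite -[k y]mulr1 -(@cintegral_gaussn R n) -cintegralZl//.
  apply: (cdominated_convergence _ _ _ (integrable_gaussn n)).
  - by move=> m; cmeas.
  - by cmeas.
  - apply: aeW => u; apply: cvgcM; last exact: cvgc_cst.
    apply: ck; rewrite -[X in cvgv _ X]add0r; apply: cvgvD; last exact: cvgv_cst.
    by rewrite -(scale0r u); apply: cvgvZ => //; exact: cvgv_cst.
  - move=> m u; rewrite normcM (le_trans (ler_piMl _ _))// ?normc_ge0//.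
    by rewrite normcC ger0_norm ?gaussn_ge0.
have L1 : cvgc (fun m => cintegral vol (fun y => h y * A m y))
    (cintegral vol (fun t => h t * k t)).
  apply: (cdominated_convergence _ _ _ (cintegrable_normc ih)).
  - by move=> m; exact: cmeasurableM.
  - exact: cmeasurableM.
  - by apply: aeW => t; apply: cvgcM => //; exact: cvgc_cst.
  - by move=> m t; rewrite normcM ler_piMr ?normc_ge0.
have iFK : cintegrable vol (fun w => F w * K w) by exact: (cintegrableMb iF mK KM).
have L2 : cvgc (fun m => cintegral vol (fun w => F w * ((gaussn (s m *: w))%:C * K w)))
    (cintegral vol (fun w => F w * K w)).
  apply: (cdominated_convergence _ _ _ (cintegrable_normc iFK)).
  - by move=> m; cmeas.
  - exact: cmeasurableM.
  - apply: aeW => w; apply: cvgcM; first exact: cvgc_cst.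
    rewrite -[X in cvgc _ X]mul1r; apply: cvgcM; last exact: cvgc_cst.
    rewrite -[1]/(1%:C) -(gaussn0 n) -(scale0r w).
    apply: (@seqcont_gaussn R n).
    by apply: cvgvZ => //; exact: cvgv_cst.
  - move=> m w; rewrite !normcM ler_wpM2l ?normc_ge0// ler_piMl ?normc_ge0//.
rewrite (_ : (fun m => _) = (fun m => cintegral vol (fun y => h y * A m y))) in L2; last first.
  by apply/funext => m; rewrite B.
rewrite (cvgc_unique L1 L2).
pose f (z : 'rV[R]_n * 'rV[R]_n) := F z.1 * k z.2 * cis2pi (dot z.1 z.2).
have iff : cintegrable (vol \x vol)%E f.
  apply: (@cintegrableMb _ _ _ _ _ _ 1 (cintegrable_prod iF ik)).
    by cmeas.
  by move=> z; rewrite normc_cis2pi.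
transitivity (cintegral vol (fun w => cintegral vol (fun t => f (w, t)))).
  congr cintegral; apply/funext => w; rewrite /K -cintegralZl; last first.
    by apply: cintegrableMcis => //; vmeas.
  by congr cintegral; apply/funext => t; rewrite /f/=; ring.
rewrite cFubini//; congr cintegral; apply/funext => t.
rewrite /g -cintegralZr; last by apply: cintegrableMcis => //; vmeas.
by congr cintegral; apply/funext => w; rewrite /f/=; ring.
Qed.

End fourier.

(** * Schwartz windows *)

Lemma measurable_coords {R : realType} n (A : 'I_n -> set R) :
  (forall i, measurable (A i)) ->
  measurable [set v : 'rV[R]_n | forall i, A i (v 0 i)].
Proof.
move=> mA; rewrite [X in measurable X](_ : _ = \big[setI/setT]_(i < n)
    ((fun v : 'rV[R]_n => v ord0 i) @^-1` A i)).
  apply: bigsetI_measurable => i _; rewrite -[X in measurable X]setTI.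
  exact: measurable_coord_rV.
rewrite -bigcap_seq; apply/seteqP; split=> v /= Hv i; first by move=> _; exact: Hv.
exact: (Hv i (mem_index_enum i)).
Qed.

Section seqcont_measurable.
Context {R : realType} {n : nat}.

Let grid (m : nat) (v : 'rV[R]_n) : 'rV[int]_n := \row_i Num.floor (m.+1%:R * v 0 i).
Let node (m : nat) (z : 'rV[int]_n) : 'rV[R]_n := \row_i ((z 0 i)%:~R / m.+1%:R).

Let cvg_grid v : cvgv (fun m => node m (grid m v)) v.
Proof.
move=> i; apply/cvgrPdist_le => e e0.
have h : (fun m => m.+1%:R^-1 : R) @ \oo --> (0 : R) by exact: cvg_harmonic.
move/cvgrPdist_le : h => /(_ _ e0); apply: filterS => m.
rewrite sub0r normrN ger0_norm ?invr_ge0// => me; rewrite !mxE.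
have m0 : 0 < m.+1%:R :> R by [].
have := floor_itv (m.+1%:R * v 0 i); set k := Num.floor _ => /andP[f1 f2].
rewrite (le_trans _ me)// (_ : _ - _ = (m.+1%:R * v 0 i - k%:~R) / m.+1%:R); last by field.
rewrite normrM (@ger0_norm _ (_^-1)) ?invr_ge0// ler_piMl ?invr_ge0//.
by rewrite ger0_norm ?subr_ge0// lerBlDl ltW// -[1 in ltRHS]/(1%:~R) -intrD.
Qed.

(** The values of f at the nodes of finer and finer grids are measurable step
    functions that converge to f. *)
Lemma seqcont_cmeasurable (f : 'rV[R]_n -> R[i]) : seqcont f -> cmeasurable f.
Proof.
move=> cf; apply: (@cmeasurable_cvg _ _ _ (fun m v => f (node m (grid m v)))); last first.
  by move=> v; apply: cf; exact: cvg_grid.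
move=> m.
have mfib (z : 'rV[int]_n) : measurable (grid m @^-1` [set z]).
  rewrite (_ : _ @^-1` _ =
    [set v : 'rV[R]_n | forall i, `[(z 0 i)%:~R / m.+1%:R, ((z 0 i) + 1)%:~R / m.+1%:R[%classic (v 0 i)]).
    exact: (@measurable_coords R n
      (fun i => `[(z 0 i)%:~R / m.+1%:R, ((z 0 i) + 1)%:~R / m.+1%:R[%classic)
      (fun i => measurable_itv _)).
  have m0 : 0 < m.+1%:R :> R by [].
  have E x (k : int) : (`[k%:~R / m.+1%:R, (k + 1)%:~R / m.+1%:R[%classic x) <-> Num.floor (m.+1%:R * x : R) = k.
    rewrite /= in_itv/= ler_pdivrMr// ltr_pdivlMr// mulrC; split.
      by move=> h; apply/eqP; rewrite floor_eq.
    by move/eqP; rewrite floor_eq.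
  apply/seteqP; split => v /=.
    by move=> <- i; apply/E; rewrite mxE.
  by move=> h; apply/rowP => i; rewrite mxE; apply/E; exact: h.
have key (u : 'rV[int]_n -> R) : measurable_fun setT (fun v => u (grid m v)).
  move=> _ Y mY; rewrite setTI.
  rewrite (_ : _ @^-1` _ = \bigcup_z (if u z \in Y then grid m @^-1` [set z] else set0)).
    apply: countable_bigcupT_measurable; first exact: countableP.
    by move=> z; case: ifPn => // _; exact: measurable0.
  apply/seteqP; split => v /=.
    by move=> Yv; exists (grid m v) => //; rewrite mem_set.
  by move=> [z _]; case: ifPn => //; rewrite inE => Yz /= ->.
by split; exact: (key (fun z => _ (f (node m z)))).
Qed.

End seqcont_measurable.

Section schwartz_facts.
Context {R : realType} {d : nat}.
Local Notation time := 'rV[R]_d.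
Implicit Types (u : time -> R).

Lemma rschwartz_bounded u : rschwartz u -> exists M, forall x, `|u x| <= M.
Proof.
by move=> /(_ [::])[_ /(_ 0)[M uM]]; exists M => x; have := uM x; rewrite expr0 mul1r.
Qed.

Lemma rschwartz_dbounded u i : rschwartz u ->
  exists M, forall x, `|'D_(delta_mx 0 i) u x| <= M.
Proof.
by move=> /(_ [:: i])[_ /(_ 0)[M uM]]; exists M => x; have := uM x; rewrite expr0 mul1r.
Qed.

Lemma is_derive_line u (x v : time) (t : R) : derivable u (x + t *: v) v ->
  is_derive t (1 : R) (fun t : R => u (x + t *: v)) ('D_v u (x + t *: v)).
Proof.
move=> du.
have E : (fun h : R => h^-1 *: (((fun t : R => u (x + t *: v)) \o shift t) (h *: (1 : R)) - u (x + t *: v)))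
    = (fun h : R => h^-1 *: ((u \o shift (x + t *: v)) (h *: v) - u (x + t *: v))).
  apply/funext => h /=; congr (_ *: (u _ - _)).
  by rewrite [h *: (1 : R)]mulr1 scalerDl addrCA.
by apply: DeriveDef; rewrite /derivable /derive E.
Qed.

Lemma rschwartz_lipschitz_line u i : rschwartz u -> exists2 M, 0 <= M &
  forall x t, `|u (x + t *: delta_mx 0 i) - u x| <= M * `|t|.
Proof.
move=> su; have [M uM] := rschwartz_dbounded i su.
exists M; first exact: le_trans (normr_ge0 _) (uM 0).
move=> x t; pose g (t : R) := u (x + t *: delta_mx 0 i).
have [du _] := su [::].
have dg (s : R) : is_derive s (1 : R) g ('D_(delta_mx 0 i) u (x + s *: delta_mx 0 i)).
  by apply: is_derive_line; exact: du.
have cg (a b : R) : {within `[a, b], continuous g}.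
  apply: derivable_within_continuous => s _.
  by have [] := dg s.
have -> : u x = g 0 by rewrite /g scale0r addr0.
rewrite -/(g t).
have [t0|t0|->] := ltgtP t 0; last by rewrite subrr !normr0 mulr0.
- have [c _ e] := MVT t0 (fun s _ => dg s) (cg _ _).
  by rewrite distrC e normrM sub0r normrN ler_wpM2r.
- have [c _ e] := MVT t0 (fun s _ => dg s) (cg _ _).
  by rewrite e normrM subr0 ler_wpM2r.
Qed.

(** Bounded partial derivatives make a function Lipschitz in each coordinate
    separately, hence continuous. *)
Lemma rschwartz_seqcont u : rschwartz u ->
  forall v l, cvgv v l -> u (v m) @[m --> \oo] --> u l.
Proof.
move=> su v l vl.
have /choice[M MP] : forall i, exists M, 0 <= M /\
    forall x t, `|u (x + t *: delta_mx 0 i) - u x| <= M * `|t|.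
  by move=> i; have [M M0 H] := rschwartz_lipschitz_line i su; exists M.
have lip (s : seq 'I_d) x (h : time) :
    `|u (x + \sum_(i <- s) h 0 i *: delta_mx 0 i) - u x| <= \sum_(i <- s) M i * `|h 0 i|.
  elim: s x => [|i s IH] x; first by rewrite !big_nil addr0 subrr normr0.
  rewrite !big_cons addrA.
  set y := x + _; rewrite (_ : u _ - _ = (u (y + \sum_(j <- s) h 0 j *: delta_mx 0 j) - u y) + (u y - u x)); last by ring.
  rewrite (le_trans (ler_normD _ _))// addrC lerD//.
  by have [_] := MP i; apply.
apply/cvgrPdist_le => e e0.
have S0 : \sum_i M i * `|v m 0 i - l 0 i| @[m --> \oo] --> (0 : R).
  elim: (index_enum _) => [|i s IH].
    by under eq_fun do rewrite big_nil; exact: cvg_cst.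
  have vi : M i * `|v m 0 i - l 0 i| @[m --> \oo] --> (0 : R).
    rewrite -[X in _ --> X](mulr0 (M i)); apply: cvgM; first exact: cvg_cst.
    apply/norm_cvg0P; rewrite -(subrr (l 0 i)); apply: cvgB; first exact: vl.
    exact: cvg_cst.
  rewrite (_ : (fun m => \sum_(j <- i :: s) M j * `|v m 0 j - l 0 j|) =
      (fun m => M i * `|v m 0 i - l 0 i| + \sum_(j <- s) M j * `|v m 0 j - l 0 j|)).
    by rewrite -[X in _ --> X]addr0; exact: cvgD.
  by apply/funext => m; rewrite big_cons.
move/cvgrPdist_le : S0 => /(_ _ e0); apply: filterS => m.
rewrite sub0r normrN; move=> /(le_trans (ler_norm _)); apply: le_trans.
rewrite distrC; have := lip (index_enum _) l (v m - l).
rewrite (_ : l + _ = v m); last first.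
  rewrite (_ : \sum_(i <- _) _ = v m - l) ?subrKC//.
  by rewrite [RHS]matrix_sum_delta big_ord1.
by move=> /le_trans; apply; apply: ler_sum => i _; rewrite !mxE.
Qed.

Lemma schwartz_seqcont (f : time -> R[i]) : schwartz f -> seqcont f.
Proof.
by move=> [f1 f2] v l vl; split; [exact: (rschwartz_seqcont f1)|exact: (rschwartz_seqcont f2)].
Qed.

Lemma schwartz_bounded (f : time -> R[i]) : schwartz f ->
  exists M, forall x, normc (f x) <= M.
Proof.
move=> [/rschwartz_bounded[M1 f1] /rschwartz_bounded[M2 f2]]; exists (M1 + M2) => x.
by rewrite (le_trans (ler_normc_ReIm _))// lerD.
Qed.

Lemma rschwartz_shift u (a : time) : rschwartz u -> rschwartz (fun x => u (x - a)).
Proof.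
move=> su s.
have dE (g : time -> R) v x : 'D_v (fun x => g (x - a)) x = 'D_v g (x - a) /\
    (derivable g (x - a) v -> derivable (fun x => g (x - a)) x v).
  have E : (fun h : R => h^-1 *: (((fun x => g (x - a)) \o shift x) (h *: v) - g (x - a)))
      = (fun h : R => h^-1 *: ((g \o shift (x - a)) (h *: v) - g (x - a))).
    by apply/funext => h /=; rewrite addrA.
  by split; rewrite /derive /derivable E.
have pE : iter_partial s (fun x => u (x - a)) = fun x => iter_partial s u (x - a).
  elim: s => //= i s IH; apply/funext => x; rewrite IH.
  by have [] := dE (iter_partial s u) (delta_mx 0 i) x.
have [du bu] := su s; rewrite pE; split.
  by move=> i x; have [_] := dE (iter_partial s u) (delta_mx 0 i) x; apply.
move=> k; have [M1 b1] := bu k; have [M2 b2] := bu 0%N.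
(* Since |x| <= 2 max(|x - a|, |a|). *)
exists (2 ^+ k * (M1 + `|a| ^+ k * M2)) => x.
have := b1 (x - a); have := b2 (x - a); rewrite expr0 mul1r.
set U := `|_ : R| => U2 U1; have U0 : 0 <= U by exact: normr_ge0.
apply: (@le_trans _ _ (2 ^+ k * (`|x - a| ^+ k + `|a| ^+ k) * U)).
  rewrite ler_wpM2r// (@le_trans _ _ ((2 * Num.max `|x - a| `|a|) ^+ k))//.
    rewrite lerXn2r ?nnegrE ?mulr_ge0// ?le_max ?normr_ge0//.
    rewrite -{1}(subrK a x) (le_trans (ler_normD _ _))// mulr_natl mulr2n.
    by rewrite lerD// le_max lexx ?orbT.
  rewrite exprMn ler_wpM2l ?exprn_ge0//.
  by case: (leP `|x - a| `|a|) => _; rewrite ?lerDl ?lerDr exprn_ge0.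
rewrite -mulrA ler_wpM2l ?exprn_ge0// mulrDl lerD//.
by rewrite ler_wpM2l ?exprn_ge0.
Qed.

Lemma schwartz_shift (f : time -> R[i]) (a : time) : schwartz f ->
  schwartz (fun x => f (x - a)).
Proof. by move=> [f1 f2]; split; [exact: rschwartz_shift f1|exact: rschwartz_shift f2]. Qed.

(** Boxes have positive volume, so every point is a limit of points of any set
    of full measure. *)
Lemma seqcont_ae_eq0 (f : time -> R[i]) : seqcont f ->
  {ae volume d, forall v, f v = 0} -> forall v, f v = 0.
Proof.
move=> cf [N [mN N0 fN]] t.
have /choice[v vP] : forall m : nat, exists v : time, f v = 0 /\
    forall i, t 0 i - m.+1%:R^-1 <= v 0 i <= t 0 i + m.+1%:R^-1.
  move=> m; apply: contrapT => /forallNP nv.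
  pose a := t - const_mx (m.+1%:R^-1); pose b := t + const_mx (m.+1%:R^-1).
  have ab i : a 0 i <= b 0 i.
    by rewrite !mxE lerD2l ge0_cp// ?invr_ge0.
  pose B : set 'rV[R]_d := [set v | forall i, a 0 i <= v 0 i <= b 0 i].
  have : volume d B = (\prod_i (b 0 i - a 0 i))%:E := volume_box ab.
  have mB : measurable B.
    have := @measurable_coords R d (fun i => `[a 0 i, b 0 i]%classic) (fun i => measurable_itv _).
    by congr measurable; apply/seteqP; split => v /= h i; have := h i; rewrite in_itv/=.
  have -> : volume d B = 0%E.
    apply/eqP; rewrite -measure_le0 -N0 le_measure ?inE//.
    move=> v Bv; apply: fN => /= fv; apply: (nv v); split => // i.
    by have := Bv i; rewrite !mxE.
  move=> [] /esym/eqP; rewrite prodf_seq_eq0 => /hasP[i _] /=.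
  by rewrite !mxE opprD addrACA subrr add0r opprK -mulr2n mulrn_eq0/= invr_eq0 pnatr_eq0.
have vt : cvgv v t.
  move=> i; have h : (fun m => m.+1%:R^-1 : R) @ \oo --> (0 : R) by exact: cvg_harmonic.
  apply/cvgrPdist_le => e e0; move/cvgrPdist_le : h => /(_ _ e0); apply: filterS => m.
  rewrite sub0r normrN ger0_norm ?invr_ge0//; apply: le_trans.
  by have [_ /(_ i)] := vP m; rewrite ler_distlC.
apply: (cvgc_unique (cf _ _ vt)).
by under eq_fun do rewrite (vP _).1; exact: cvgc_cst.
Qed.

End schwartz_facts.

(** * Short-time Fourier transforms and the reconstruction formula *)

Section stft_facts.
Context {R : realType} {d : nat}.
Local Notation time := 'rV[R]_d.
Local Notation phase := ('rV[R]_d * 'rV[R]_d)%type.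
Local Notation vol := (volume d : {sigma_finite_measure set 'rV[R]_d -> \bar R}).
Local Notation pvol := (@phase_volume R d : {sigma_finite_measure set phase -> \bar R}).
Implicit Types (f g k : time -> R[i]) (z : phase).

Lemma stft_fourier g f x w :
  stft g f (x, w) = fourier (fun t => f t * (g (t - x))^*) w.
Proof. by rewrite stftE. Qed.

Lemma cmeasurable_stft g f : cmeasurable g -> cmeasurable f ->
  cmeasurable (stft g f).
Proof.
move=> mg mf.
rewrite (_ : stft g f = fun z => cintegral vol (fun t =>
  (fun p : phase * time => f p.2 * (g (p.2 - p.1.1))^* * cis2pi (- dot p.1.2 p.2)) (z, t))).
  apply: (cmeasurable_cintegral1 vol (f := fun p : phase * time =>
    f p.2 * (g (p.2 - p.1.1))^* * cis2pi (- dot p.1.2 p.2))).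
  apply: cmeasurableM; last by apply: cmeasurable_cis2pi; vmeas.
  apply: cmeasurableM; first exact: (cmeasurable_comp mf).
  apply: cmeasurableJ; apply: (cmeasurable_comp mg).
  apply: measurable_rVB; first by vmeas.
  by apply: (measurableT_comp measurable_fst); vmeas.
by apply/funext => -[x w]; rewrite stftE.
Qed.

Lemma cmeasurable_shift g x : cmeasurable g -> cmeasurable (fun t : time => g (t - x)).
Proof.
by move=> mg; apply: (cmeasurable_comp mg); apply: measurable_rVB; vmeas.
Qed.

Lemma cintegrable_stft_integrand g f x M : cmeasurable g ->
  (forall t, normc (g t) <= M) -> cintegrable vol f ->
  cintegrable vol (fun t => f t * (g (t - x))^*).
Proof.
move=> mg gM ifi; apply: (cintegrableMb ifi (M := M)).
  by apply: cmeasurableJ; exact: cmeasurable_shift.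
by move=> t; rewrite normc_conj.
Qed.

Definition synth (gam : time -> R[i]) (A : phase -> R[i]) (t : time) : R[i] :=
  cintegral pvol (fun a => A a * tfshift a gam t).

(** For almost every x, Fourier inversion gives an identity for almost every t;
    Tonelli's theorem exchanges the two quantifiers. *)
Lemma ae_stft_inversion phi f : cmeasurable phi ->  cmeasurable f ->
  (forall x, cintegrable vol (fun t => f t * (phi (t - x))^*)) ->
  cintegrable pvol (stft phi f) ->
  {ae vol, forall t, {ae vol, forall x, f t * (phi (t - x))^* =
    cintegral vol (fun w => stft phi f (x, w) * cis2pi (dot w t))}}.
Proof.
move=> mphi mf ih iV.
have mV := cmeasurable_stft mphi mf.
pose W (z : phase) := cintegral vol (fun w => stft phi f (z.1, w) * cis2pi (dot w z.2)).
have mW : cmeasurable W.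
  apply: (cmeasurable_cintegral1 vol
    (f := fun p : phase * time => stft phi f (p.1.1, p.2) * cis2pi (dot p.2 p.1.2))).
  apply: cmeasurableM; last by apply: cmeasurable_cis2pi; vmeas.
  by apply: (cmeasurable_comp mV); vmeas.
pose D z := f z.2 * (phi (z.2 - z.1))^* - W z.
have mD : cmeasurable D.
  apply: cmeasurableB => //; apply: cmeasurableM; first exact: (cmeasurable_comp mf).
  apply: cmeasurableJ; apply: (cmeasurable_comp mphi).
  by apply: measurable_rVB; vmeas.
have mN : measurable_fun setT (fun z => (normc (D z))%:E).
  by apply/measurable_EFinP; exact: cmeasurable_normc.
have N0 z : (0 <= (normc (D z))%:E)%E by rewrite lee_fin normc_ge0.
have I0 : (\int[vol]_x \int[vol]_t (normc (D (x, t)))%:E = 0)%E.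
  rewrite -[RHS](integral0 vol setT); apply: ge0_ae_eq_integral => //.
  - exact: (@measurable_fun_fubini_tonelli_F _ _ _ _ _ vol _ mN N0).
  - by move=> x _; exact: integral_ge0.
  - have := ae_cintegrable1 (iV : cintegrable (vol \x vol)%E (stft phi f)).
    apply: filterS => x ix _.
    rewrite -[RHS](integral0 vol setT); apply: ge0_ae_eq_integral => //.
      by apply: (measurableT_comp mN); exact: measurable_pair1.
    have iF : cintegrable vol (fourier (fun t => f t * (phi (t - x))^*)).
      by move: ix; under eq_fun do rewrite stft_fourier.
    have := fourier_inversion (ih x) iF; apply: filterS => t e _ /=.
    rewrite /D /W /= e; under [in X in _ - X]eq_fun do rewrite stft_fourier.
    by rewrite subrr normc0.
have I1 : (\int[vol]_t \int[vol]_x (normc (D (x, t)))%:E = 0)%E.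
  rewrite -[RHS]I0; symmetry.
  exact: (@fubini_tonelli _ _ _ _ _ vol vol _ mN N0).
have mG := @measurable_fun_fubini_tonelli_G _ _ _ _ _ vol _ mN N0.
have : ae_eq vol setT (fun t => \int[vol]_x (normc (D (x, t)))%:E)%E (cst 0%E).
  apply/ae_eq_integral_abs => //.
  by under eq_integral do rewrite gee0_abs ?integral_ge0//.
apply: filterS => t /(_ I) /= t0.
have : ae_eq vol setT (fun x => (normc (D (x, t)))%:E) (cst 0%E).
  apply/ae_eq_integral_abs => //.
    by apply: (measurableT_comp mN); exact: measurable_pair2.
  by under eq_integral do rewrite gee0_abs//.
apply: filterS => x /(_ I) /= -[] /normc_eq0 /eqP.
by rewrite subr_eq0 => /eqP.
Qed.

Lemma cmeasurable_tfshift gam (t : time) : cmeasurable gam ->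
  cmeasurable (fun a : phase => tfshift a gam t).
Proof.
move=> mgam; apply: cmeasurableM; first by apply: cmeasurable_cis2pi; vmeas.
by apply: (cmeasurable_comp mgam); apply: measurable_rVB; vmeas.
Qed.

Lemma normc_tfshift gam (a : phase) t : normc (tfshift a gam t) = normc (gam (t - a.1)).
Proof. by rewrite normcM normc_cis2pi mul1r. Qed.

(** Integrating the identity of [ae_stft_inversion] against gam(t - x) removes
    the window phi, at the price of the constant [inner gam phi]. *)
Lemma stft_reconstruction phi gam f (M Mp : R) : cmeasurable phi ->
  (forall t, normc (phi t) <= Mp) -> cmeasurable gam ->
  (forall t, normc (gam t) <= M) -> cintegrable vol gam -> cmeasurable f ->
  (forall x, cintegrable vol (fun t => f t * (phi (t - x))^*)) ->
  cintegrable pvol (stft phi f) ->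
  {ae vol, forall t, f t * inner gam phi = synth gam (stft phi f) t}.
Proof.
move=> mphi phiM mgam gamM igam mf ih iV.
have := ae_stft_inversion mphi mf ih iV; apply: filterS => t fE.
have mV := cmeasurable_stft mphi mf.
have iVg : cintegrable pvol (fun a => stft phi f a * tfshift a gam t).
  apply: (cintegrableMb iV (cmeasurable_tfshift t mgam) (M := M)) => a.
  by rewrite normc_tfshift.
rewrite /synth -(cFubini1 (iVg : cintegrable (vol \x vol)%E _)).
have ipg : cintegrable vol (fun u => gam u * (phi u)^*).
  apply: (cintegrableMb igam (cmeasurableJ mphi) (M := Mp)) => u.
  by rewrite normc_conj.
have -> : inner gam phi = cintegral vol (fun x => gam (t - x) * (phi (t - x))^*).
  rewrite (cintegral_scaling (volume_opp t) (f := fun u => gam u * (phi u)^*)).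
    by rewrite mul1r.
  exact: cintegrable_cmeasurable ipg.
rewrite -cintegralZl; last exact: (cintegrable_scaling (volume_opp t) ipg).
apply: ae_eq_cintegral.
- apply: cmeasurableM; first exact: cmeasurable_cst.
  exact: cintegrable_cmeasurable (cintegrable_scaling (volume_opp t) ipg).
- apply: (cmeasurable_cintegral1 vol (f := fun a => stft phi f a * tfshift a gam t)).
  exact: cintegrable_cmeasurable iVg.
have := ae_cintegrable1 (iV : cintegrable (vol \x vol)%E (stft phi f)).
apply: filterS2 fE => x e ix.
rewrite mulrCA mulrC e -cintegralZr; last by apply: cintegrableMcis => //; vmeas.
by congr cintegral; apply/funext => w; rewrite /tfshift/=; ring.
Qed.

Lemma stft_ae_eq g g' f f' : cmeasurable g -> cmeasurable g' ->
  cmeasurable f -> cmeasurable f' ->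
  {ae vol, forall t, g t = g' t} -> {ae vol, forall t, f t = f' t} ->
  stft g f = stft g' f'.
Proof.
move=> mg mg' mf mf' gg ff; apply/funext => -[x w]; rewrite !stftE.
have m (a b : time -> R[i]) : cmeasurable a -> cmeasurable b ->
    cmeasurable (fun t => b t * (a (t - x))^* * cis2pi (- dot w t)).
  move=> ma mb; apply: cmeasurableM; last by apply: cmeasurable_cis2pi; vmeas.
  by apply: cmeasurableM => //; apply: cmeasurableJ; exact: cmeasurable_shift.
apply: ae_eq_cintegral; [exact: m|exact: m|].
have := scaling_ae (volume_shift (- x)) gg.
by apply: filterS2 ff => t -> ->.
Qed.

End stft_facts.

(** * Superpositions of shifted windows *)

Section superpositions.
Context {R : realType} {d : nat}.
Local Notation time := 'rV[R]_d.
Local Notation phase := ('rV[R]_d * 'rV[R]_d)%type.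
Local Notation vol := (volume d : {sigma_finite_measure set 'rV[R]_d -> \bar R}).
Local Notation pvol := (@phase_volume R d : {sigma_finite_measure set phase -> \bar R}).
Implicit Types (f g k gam : time -> R[i]) (z : phase) (A U V : phase -> R[i]).

(** The regularity that a superposition of shifts of a window inherits from the
    window. *)
Definition nice f : Prop :=
  [/\ seqcont f, exists M, forall t, normc (f t) <= M & cintegrable vol f].

Lemma nice_cmeasurable f : nice f -> cmeasurable f.
Proof. by case=> /seqcont_cmeasurable. Qed.

Lemma cintegrable_scaled d1 d2 (T1 : measurableType d1) (T2 : measurableType d2)
    (m1 : {sigma_finite_measure set T1 -> \bar R})
    (m2 : {sigma_finite_measure set T2 -> \bar R})
    (S : T1 -> T2 -> T2) (a : T1 -> R[i]) (b : T2 -> R[i]) :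
  (forall x, scaling m2 1 (S x)) ->
  measurable_fun setT (fun p : T1 * T2 => S p.1 p.2) ->
  cintegrable m1 a -> cintegrable m2 b ->
  cintegrable (m1 \x m2)%E (fun p => a p.1 * b (S p.1 p.2)).
Proof.
move=> sS mS ia ib.
have ma := cintegrable_cmeasurable ia; have mb := cintegrable_cmeasurable ib.
apply: cintegrable12.
  apply: cmeasurableM; first by apply: (cmeasurable_comp ma).
  exact: (cmeasurable_comp mb mS).
have mnb : measurable_fun setT (fun y => (normc (b y))%:E).
  by apply/measurable_EFinP; exact: cmeasurable_normc.
under eq_integral => x _.
  under eq_integral do rewrite /= normcM EFinM.
  have [_ mSx SE] := sS x.
  rewrite ge0_integralZl//; last 3 first.
  - by apply: (measurableT_comp mnb mSx).
  - by move=> y _; rewrite lee_fin normc_ge0.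
  - by rewrite lee_fin normc_ge0.
  rewrite (SE (fun y => (normc (b y))%:E))//; last first.
    by move=> y; rewrite lee_fin normc_ge0.
  rewrite mul1e.
  over.
rewrite ge0_integralZr//; last 3 first.
- by apply/measurable_EFinP; exact: cmeasurable_normc.
- by move=> y _; rewrite lee_fin normc_ge0.
- by apply: integral_ge0 => y _; rewrite lee_fin normc_ge0.
have foo := (cintegrableP m1 ma).1 ia; have goo := (cintegrableP m2 mb).1 ib.
have f0 : (0 <= \int[m1]_x (normc (a x))%:E)%E.
  by apply: integral_ge0 => y _; rewrite lee_fin normc_ge0.
by apply: lte_mul_pinfty => //; rewrite ge0_fin_numE.
Qed.

Lemma cintegrable_synth_prod gam A : cintegrable vol gam -> cintegrable pvol A ->
  cintegrable (pvol \x vol)%E (fun p => A p.1 * tfshift p.1 gam p.2).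
Proof.
move=> ig iA.
have i0 := @cintegrable_scaled _ _ _ _ pvol vol (fun a t => t + - a.1) A gam
  (fun a => volume_shift (- a.1)) _ iA ig.
have mg := cintegrable_cmeasurable ig; have mA := cintegrable_cmeasurable iA.
apply: (cintegrable_dom (g := fun p : phase * time => A p.1 * gam (p.2 + - p.1.1))).
- apply: cmeasurableM; first by apply: (cmeasurable_comp mA).
  apply: cmeasurableM.
    apply: cmeasurable_cis2pi; apply: measurable_dot; last by vmeas.
    by apply: (measurableT_comp measurable_snd); vmeas.
  apply: (cmeasurable_comp mg); apply: measurable_rVB; first by vmeas.
  by apply: (measurableT_comp measurable_fst); vmeas.
- by move=> p; rewrite !normcM normc_cis2pi mul1r.
apply: i0; apply: measurable_rVB; first by vmeas.
by apply: (measurableT_comp measurable_fst); vmeas.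
Qed.

Lemma nice_synth gam A : nice gam -> cintegrable pvol A -> nice (synth gam A).
Proof.
move=> ng iA; have [cg [M gM] ig] := ng; have mg := nice_cmeasurable ng.
have mA := cintegrable_cmeasurable iA.
have M0 : 0 <= M by exact: le_trans (normc_ge0 _) (gM 0).
have iAg t : cintegrable pvol (fun a => A a * tfshift a gam t).
  apply: (cintegrableMb iA (cmeasurable_tfshift t mg) (M := M)) => a.
  by rewrite normc_tfshift.
split.
- move=> u l ul; rewrite /synth.
  apply: (cdominated_convergence _ _ _ (cintegrable_normc (cintegrableZl M%:C iA))).
  + by move=> m; exact: cintegrable_cmeasurable (iAg _).
  + exact: cintegrable_cmeasurable (iAg _).
  + apply: aeW => a; apply: cvgcM; first exact: cvgc_cst.
    apply: cvgcM.
      by apply: cvgc_cis2pi; apply: cvg_dot => //; exact: cvgv_cst.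
    by apply: cg; apply: cvgvB => //; exact: cvgv_cst.
  + move=> m a; rewrite !normcM normc_cis2pi mul1r mulrC normcC (ger0_norm M0).
    by rewrite ler_wpM2r ?normc_ge0.
- exists (\int[pvol]_a (normc (M%:C * A a))) => t.
  rewrite (le_trans (normc_cintegral (iAg t)))// le_Rintegral//.
  + exact: cintegrable_normc (iAg t).
  + exact: cintegrable_normc (cintegrableZl _ iA).
  + move=> a _; rewrite !normcM normc_cis2pi mul1r mulrC normcC (ger0_norm M0).
    by rewrite ler_wpM2r ?normc_ge0.
- exact: (cintegrable_cintegral2 (cintegrable_synth_prod ig iA)).
Qed.

Lemma stft_synth k gam A z : nice k -> nice gam -> cintegrable pvol A ->
  stft k (synth gam A) z =
  cintegral pvol (fun a => A a * inner (tfshift a gam) (tfshift z k)).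
Proof.
move=> nk ng iA; have [ck [M kM] ik] := nk; have [cg _ ig] := ng.
have mk := nice_cmeasurable nk; have mg := nice_cmeasurable ng.
have mkz : cmeasurable (tfshift z k).
  apply: cmeasurableM; first by apply: cmeasurable_cis2pi; vmeas.
  exact: cmeasurable_shift.
have kzM t : normc (tfshift z k t)^* <= M by rewrite normc_conj normc_tfshift.
have i0 := cintegrable_synth_prod ig iA.
have i1 : cintegrable (pvol \x vol)%E
    (fun p => A p.1 * tfshift p.1 gam p.2 * (tfshift z k p.2)^*).
  apply: (cintegrableMb i0 (M := M)) => [|p]; last exact: kzM.
  by apply: cmeasurableJ; apply: (cmeasurable_comp mkz).
have mAg := cintegrable_cmeasurable i0.
have iAg t : cintegrable pvol (fun a => A a * tfshift a gam t).
  have [_ [N gN] _] := ng.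
  apply: (cintegrableMb iA (cmeasurable_tfshift t mg) (M := N)) => a.
  by rewrite normc_tfshift.
rewrite /stft /inner /synth.
transitivity (cintegral vol (fun t => cintegral pvol (fun a =>
    A a * tfshift a gam t * (tfshift z k t)^*))).
  by congr cintegral; apply/funext => t; rewrite -cintegralZr.
rewrite -(cFubini i1); congr cintegral; apply/funext => a /=.
rewrite -cintegralZl; first by congr cintegral; apply/funext => t; rewrite mulrA.
apply: (cintegrableMb (M := M)) => //; last exact: cmeasurableJ.
have -> : tfshift a gam = fun t => gam (t + - a.1) * cis2pi (dot a.2 t).
  by apply/funext => t; rewrite /tfshift mulrC.
apply: cintegrableMcis; last by vmeas.
exact: (cintegrable_scaling (volume_shift (- a.1)) ig).
Qed.

Lemma normc_inner_tfshift f g (a z : phase) : nice f -> nice g ->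
  normc (inner (tfshift a f) (tfshift z g)) = normc (stft g f (z - a)).
Proof.
move=> nf ng; have [_ _ fi] := nf.
have mf := nice_cmeasurable nf; have mg := nice_cmeasurable ng.
have [_ [M gM] _] := ng.
pose F t := tfshift a f t * (tfshift z g t)^*.
have mF : cmeasurable F.
  apply: cmeasurableM.
    apply: cmeasurableM; first by apply: cmeasurable_cis2pi; vmeas.
    exact: cmeasurable_shift.
  apply: cmeasurableJ; apply: cmeasurableM; first by apply: cmeasurable_cis2pi; vmeas.
  exact: cmeasurable_shift.
rewrite /inner -[cintegral _ _]mul1r -(cintegral_scaling (volume_shift a.1) mF).
rewrite stftE.
have -> : (fun t => F (t + a.1)) = fun t => cis2pi (dot a.2 a.1 - dot z.2 a.1) *
    (f t * (g (t - (z - a).1))^* * cis2pi (- dot (z - a).2 t)).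
  apply/funext => t; rewrite /F /tfshift conjcM -cis2piN addrK /=.
  rewrite -[t + a.1 - z.1]addrA (_ : a.1 - z.1 = - (z.1 - a.1)) ?opprB//.
  rewrite dotBl !dotDr !opprD !opprK !cis2piD; ring.
rewrite cintegralZl ?normcM ?normc_cis2pi ?mul1r//.
apply: cintegrableMcis; last by vmeas.
exact: (cintegrable_stft_integrand (z - a).1 mg gM fi).
Qed.

Lemma normc_stft_swap f g z : nice f -> nice g ->
  normc (stft f g z) = normc (stft g f (- z)).
Proof.
move=> nf ng; rewrite -[in RHS](sub0r z).
rewrite -(normc_inner_tfshift z 0 nf ng).
have -> : tfshift 0 g = g.
  by apply/funext => t; rewrite /tfshift dot0l cis2pi0 mul1r subr0.
have [_ _ gi] := ng; have [_ [M fM] _] := nf; have mf := nice_cmeasurable nf.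
have mfz : cmeasurable (tfshift z f).
  apply: cmeasurableM; first by apply: cmeasurable_cis2pi; vmeas.
  exact: cmeasurable_shift.
rewrite -normc_conj /inner -cintegralJ.
  by congr (normc (cintegral _ _)); apply/funext => t;
    rewrite conjcM mulrC Num.Theory.conjCK.
apply: (cintegrableMb gi (M := M)); first exact: cmeasurableJ.
by move=> t; rewrite normc_conj normc_tfshift.
Qed.

(** The Wiener amalgam space of functions with bounded integrable local suprema.
    The dominating function H stands for the local supremum, which need not be
    measurable. *)
Definition amalgam U : Prop := exists H : phase -> R,
  [/\ cintegrable pvol (fun z => (H z)%:C), exists M, forall z, H z <= M &
      forall z w : phase, `|w| <= 1 -> normc (U (z + w)) <= H z].

Lemma amalgam_cintegrable U : cmeasurable U -> amalgam U -> cintegrable pvol U.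
Proof.
move=> mU [H [iH _ UH]]; apply: (cintegrable_dom _ _ iH) => // z.
have := UH z 0; rewrite normr0 addr0 => /(_ ler01) h.
by rewrite normcC (le_trans h)// ler_norm.
Qed.

Lemma amalgam_bounded U : amalgam U -> exists M, forall z, normc (U z) <= M.
Proof.
move=> [H [_ [M HM] UH]]; exists M => z.
by have := UH z 0; rewrite normr0 addr0 => /(_ ler01) /le_trans; exact.
Qed.

Lemma amalgam_opp U : amalgam U -> amalgam (fun z => U (- z)).
Proof.
move=> [H [iH [M HM] UH]]; exists (fun z => H (- z)); split.
- have := cintegrable_scaling (phase_opp 0) iH.
  by under eq_fun do rewrite sub0r.
- by exists M.
- by move=> z w w1; rewrite opprD UH// normrN.
Qed.

Lemma amalgam_Mb U V (N : R) :
  (forall z, normc (V z) <= normc (U z) * N) -> amalgam U -> amalgam V.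
Proof.
move=> VU [H [iH [M HM] UH]].
have H0 z : 0 <= H z.
  by have := UH z 0; rewrite normr0 => /(_ ler01); apply: le_trans; exact: normc_ge0.
exists (fun z => `|N| * H z); split.
- by have := cintegrableZl `|N|%:C iH; under eq_fun do rewrite -rmorphM.
- by exists (`|N| * M) => z; rewrite ler_wpM2l.
- move=> z w w1; apply: le_trans (VU _) _; rewrite mulrC.
  apply: (@le_trans _ _ (`|N| * normc (U (z + w)))).
    by rewrite ler_wpM2r ?normc_ge0 ?ler_norm.
  by rewrite ler_wpM2l ?UH.
Qed.

Lemma measurable_phaseB (disp : measure_display) (T : measurableType disp)
    (a b : T -> phase) : measurable_fun setT a -> measurable_fun setT b ->
  measurable_fun setT (fun x => a x - b x).
Proof.
move=> ma mb; apply/measurable_fun_pair => /=.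
  by apply: measurable_rVB; apply: (measurableT_comp measurable_fst).
by apply: measurable_rVB; apply: (measurableT_comp measurable_snd).
Qed.

(** The local supremum of a convolution is at most the convolution with the
    local supremum. *)
Lemma amalgam_convolution A U V : cintegrable pvol A -> amalgam U -> cmeasurable U ->
  (forall z, normc (V z) <= \int[pvol]_a (normc (A a) * normc (U (z - a)))) ->
  amalgam V.
Proof.
move=> iA [H [iH [M HM] UH]] mU VU.
have mA := cintegrable_cmeasurable iA; have mH := cintegrable_cmeasurable iH.
have H0 z : 0 <= H z.
  by have := UH z 0; rewrite normr0 => /(_ ler01); apply: le_trans; exact: normc_ge0.
pose K (z a : phase) : R[i] := (normc (A a))%:C * (H (z - a))%:C.
have inA : cintegrable pvol (fun a => (normc (A a))%:C).
  apply: (cintegrable_dom _ _ iA).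
    by apply: cmeasurableC; exact: cmeasurable_normc.
  by move=> a; rewrite normcC ger0_norm ?normc_ge0.
have iK z : cintegrable pvol (K z).
  apply: (cintegrableMb inA (M := M)).
    by apply: (cmeasurable_comp mH); apply: measurable_phaseB; vmeas.
  by move=> a; rewrite normcC ger0_norm.
have KE z a : (K z a) = (normc (A a) * H (z - a))%:C by rewrite rmorphM.
have UM z : cintegrable pvol (fun a => (normc (A a))%:C * U (z - a)).
  apply: (cintegrableMb inA (M := M)).
    by apply: (cmeasurable_comp mU); apply: measurable_phaseB; vmeas.
  move=> a; have := UH (z - a) 0; rewrite normr0 addr0 => /(_ ler01).
  by move/le_trans; apply.
exists (fun z => Re (cintegral pvol (K z))); split.
- have := @cintegrable_scaled _ _ _ _ pvol pvol (fun a z => z + - a) _ _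
    (fun a => phase_shift (- a)) _ inA iH.
  case/(_ _)/cintegrable_cintegral2.
    by apply: measurable_phaseB; vmeas.
  by move=> i1 _; split => //=; exact: integrable0.
- exists (\int[pvol]_a (M * normc (A a))) => z /=.
  apply: le_Rintegral => //.
  + by have [] := iK z.
  + have := cintegrable_normc (cintegrableZl M%:C iA).
    by under eq_fun do rewrite normcM normcC (ger0_norm (le_trans (H0 0) (HM 0))).
  + move=> a _; change (Re (K z a) <= M * normc (A a)).
    by rewrite KE/= mulrC ler_wpM2r ?normc_ge0.
- move=> z w w1; rewrite (le_trans (VU _))//= le_Rintegral//.
  + have := cintegrable_normc (UM (z + w)).
    by under eq_fun do rewrite normcM normcC (ger0_norm (normc_ge0 _)).
  + by have [] := iK z.
  + move=> a _; change (normc (A a) * normc (U (z + w - a)) <= Re (K z a)).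
    by rewrite KE/= ler_wpM2l ?normc_ge0// addrAC; exact: UH.
Qed.

(** Up to phase factors, the transform of a superposition is the convolution of
    its coefficients with the transform of the window. *)
Lemma amalgam_stft_synth k gam A : nice k -> nice gam -> cintegrable pvol A ->
  amalgam (stft k gam) -> amalgam (stft k (synth gam A)).
Proof.
move=> nk ng iA aU.
have mU : cmeasurable (stft k gam).
  by apply: cmeasurable_stft; exact: nice_cmeasurable.
have [M UM] := amalgam_bounded aU.
have mA := cintegrable_cmeasurable iA.
have i1 z : cintegrable pvol (fun a => A a * stft k gam (z - a)).
  apply: (cintegrableMb iA (M := M)) => //.
  by apply: (cmeasurable_comp mU); apply: measurable_phaseB; vmeas.
apply: (amalgam_convolution iA aU mU) => z.
rewrite stft_synth//.
have nE a : normc (A a * inner (tfshift a gam) (tfshift z k)) =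
    normc (A a) * normc (stft k gam (z - a)).
  by rewrite normcM normc_inner_tfshift.
have i2 : cintegrable pvol (fun a => A a * inner (tfshift a gam) (tfshift z k)).
  apply: (cintegrable_dom _ _ (i1 z)); last by move=> a; rewrite nE normcM.
  apply: cmeasurableM => //.
  have mk := nice_cmeasurable nk; have mg := nice_cmeasurable ng.
  apply: (cmeasurable_cintegral1 vol (f := fun p : phase * time =>
    tfshift p.1 gam p.2 * (tfshift z k p.2)^*)).
  apply: cmeasurableM.
    apply: cmeasurableM.
      apply: cmeasurable_cis2pi; apply: measurable_dot; last by vmeas.
      by apply: (measurableT_comp measurable_snd); vmeas.
    apply: (cmeasurable_comp mg); apply: measurable_rVB; first by vmeas.
    by apply: (measurableT_comp measurable_fst); vmeas.
  apply: cmeasurableJ; apply: cmeasurableM; first by apply: cmeasurable_cis2pi; vmeas.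
  by apply: (cmeasurable_comp mk); apply: measurable_rVB; vmeas.
rewrite (le_trans (normc_cintegral i2))// le_eqVlt; apply/orP; left; apply/eqP.
by apply: eq_Rintegral => a _; rewrite nE.
Qed.

Lemma amalgam_stft_swap f g : nice f -> nice g ->
  amalgam (stft f g) -> amalgam (stft g f).
Proof.
move=> nf ng /amalgam_opp; apply: (amalgam_Mb (N := 1)) => z.
by rewrite mulr1 normc_stft_swap.
Qed.

Lemma amalgam_stft_synth2 gam A B : nice gam -> amalgam (stft gam gam) ->
  cintegrable pvol A -> cintegrable pvol B ->
  amalgam (stft (synth gam B) (synth gam A)).
Proof.
move=> ng ag iA iB; have nB := nice_synth ng iB.
apply: amalgam_stft_synth => //; apply: amalgam_stft_swap => //.
exact: amalgam_stft_synth.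
Qed.

(** * The modulated Gaussian window *)

(** Without the modulation, the Gaussian could be orthogonal to phi. *)
Definition gwin (w t : time) : R[i] := cis2pi (dot w t) * (expR (- (pi / 2 * dot t t)))%:C.

Let half_sqrt : R := Num.sqrt 2^-1.

Let gwinE w t : gwin w t = (gaussn (half_sqrt *: t))%:C * cis2pi (dot w t).
Proof.
rewrite /gwin mulrC /gaussn dotZl dotZr (mulrA half_sqrt) -expr2 sqr_sqrtr ?invr_ge0//.
by rewrite mulrA.
Qed.

Lemma nice_gwin w : nice (gwin w).
Proof.
have s0 : 0 < half_sqrt by rewrite sqrtr_gt0 invr_gt0.
have -> : gwin w = fun t => (gaussn (half_sqrt *: t))%:C * cis2pi (dot w t).
  by apply/funext => t; rewrite gwinE.
split.
- apply: seqcontM => u l ul.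
    apply: (@seqcont_gaussn R d); apply: cvgvZ => //; exact: cvg_cst.
  by apply: cvgc_cis2pi; apply: cvg_dot => //; exact: cvgv_cst.
- exists 1 => t; rewrite normcM normc_cis2pi mulr1 normcC ger0_norm ?gaussn_ge0//.
  exact: gaussn_le1.
- apply: cintegrableMcis; last by vmeas.
  exact: cintegrable_gaussn_dilation.
Qed.

(** The parallelogram identity makes the product of two shifted Gaussians a
    Gaussian centred at the midpoint. *)
Lemma normc_stft_gwin w z :
  normc (stft (gwin w) (gwin w) z) = gaussn (2^-1 *: z.1) * gaussn z.2.
Proof.
case: z => x v.
pose F (u : time) : R[i] := (gaussn u)%:C * cis2pi (dot (- v) u).
have mF : cmeasurable F by apply: cmeasurableM; [cmeas|apply: cmeasurable_cis2pi; vmeas].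
have E t : gwin w t * (gwin w (t - x))^* * cis2pi (- dot v t) =
    (gaussn (2^-1 *: x))%:C * cis2pi (dot w x - dot v (2^-1 *: x)) *
      F (t + - (2^-1 *: x)).
  have -> : F (t + - (2^-1 *: x)) = (gaussn (t - 2^-1 *: x))%:C *
      cis2pi (dot v (2^-1 *: x) - dot v t).
    by rewrite /F dotNl dotBr opprB.
  rewrite /gwin conjcM -cis2piN conjcC (dotBr w) opprB.
  have eE : (expR (- (pi / 2 * dot t t)))%:C * (expR (- (pi / 2 * dot (t - x) (t - x))))%:C =
    (gaussn (2^-1 *: x))%:C * (gaussn (t - 2^-1 *: x))%:C :> R[i].
    rewrite -!rmorphM/= /gaussn -!expRD; congr (expR _)%:C.
    by rewrite !dotBl !dotBr !dotZl !dotZr (dotC x t); field.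
  transitivity (cis2pi (dot w t) * cis2pi (dot w x - dot w t) * cis2pi (- dot v t) *
    ((expR (- (pi / 2 * dot t t)))%:C * (expR (- (pi / 2 * dot (t - x) (t - x))))%:C)).
    by ring.
  rewrite eE -!cis2piD.
  transitivity (cis2pi (dot w x - dot v (2^-1 *: x)) *
    cis2pi (dot v (2^-1 *: x) - dot v t) *
    ((gaussn (2^-1 *: x))%:C * (gaussn (t - 2^-1 *: x))%:C)); last by ring.
  by rewrite -!cis2piD; congr (cis2pi _ * _); ring.
rewrite stftE (_ : (fun t => _) = fun t =>
    (gaussn (2^-1 *: x))%:C * cis2pi (dot w x - dot v (2^-1 *: x)) *
      F (t + - (2^-1 *: x))); last by apply/funext => t; exact: E.
have [iF FE] := gaussn_fourier (- v : time).
have sS := volume_shift (- (2^-1 *: x) : time).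
rewrite cintegralZl; last exact: (cintegrable_scaling sS iF).
rewrite (cintegral_scaling sS mF) mul1r FE !normcM normc_cis2pi mulr1 !normcC.
rewrite !ger0_norm ?gaussn_ge0//; congr (_ * _).
by rewrite /gaussn dotNl dotNr opprK.
Qed.

Let gaussn_local (a : R) (x y : time) : `|y| <= 1 ->
  gaussn (a *: (x + y)) <= expR (pi * a ^+ 2 * d%:R) * gaussn (a / 2 *: x).
Proof.
move=> y1; rewrite /gaussn -expRD ler_expR !dotZl !dotZr.
have dy : dot y y <= d%:R.
  rewrite -[X in X%:R]card_ord -sumr_const ler_sum// => i _.
  rewrite -expr2 -real_normK ?num_real// expr_le1//.
  by rewrite (le_trans _ y1)//; exact: le_rV_norm.
have h : dot x x <= 4 * (dot (x + y) (x + y) + dot y y).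
  have := dot_ge0 (x + 2 *: y); rewrite !dotDl !dotDr !dotZl !dotZr (dotC y x).
  have := dot_ge0 (x + y); rewrite !dotDl !dotDr (dotC y x).
  have := dot_ge0 x; have := dot_ge0 y; lra.
have p0 := @pi_ge0 R.
rewrite -subr_ge0 (_ : _ - _ = pi * (a ^+ 2 * (d%:R + dot (x + y) (x + y) - dot x x / 4))); last first.
  by field.
rewrite mulr_ge0// mulr_ge0 ?sqr_ge0//; lra.
Qed.

Lemma amalgam_gwin w : amalgam (stft (gwin w) (gwin w)).
Proof.
pose C1 := expR (pi * 2^-1 ^+ 2 * d%:R) : R; pose C2 := expR (pi * 1 ^+ 2 * d%:R) : R.
exists (fun z => C1 * C2 * (gaussn (2^-1 / 2 *: z.1) * gaussn (1 / 2 *: z.2))); split.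
- have h1 : 0 < 2^-1 / 2 :> R by rewrite divr_gt0 ?invr_gt0.
  have h2 : 0 < 1 / 2 :> R by rewrite divr_gt0.
  have := cintegrableZl (C1 * C2)%:C (cintegrable_prod
    (@cintegrable_gaussn_dilation R d _ h1) (@cintegrable_gaussn_dilation R d _ h2)).
  by under eq_fun do rewrite -!rmorphM.
- exists (C1 * C2) => z; rewrite ler_piMr ?mulr_ge0 ?expR_ge0//.
  by rewrite mulr_ile1 ?gaussn_ge0 ?gaussn_le1.
- move=> z y y1; rewrite normc_stft_gwin.
  have [y1' y2'] : `|y.1| <= 1 /\ `|y.2| <= 1.
    by move: y1; rewrite prod_normE ge_max => /andP[].
  rewrite mulrACA ler_pM ?gaussn_ge0//.
    exact: gaussn_local.
  by rewrite -[X in gaussn X]scale1r gaussn_local.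
Qed.

(** The inner products with all modulations of the Gaussian are the values of a
    Fourier transform, which vanishes for the zero function only. *)
Lemma gwin_not_orthogonal phi : seqcont phi -> (exists M, forall t, normc (phi t) <= M) ->
  (exists t, phi t <> 0) -> exists w, inner (gwin w) phi <> 0.
Proof.
move=> cphi [M phiM] [t0 pt0]; apply: contrapT => /forallNP no.
have mphi := seqcont_cmeasurable cphi.
pose h t := gwin 0 t * (phi t)^*.
have [_ _ ig] := nice_gwin 0.
have ih : cintegrable vol h.
  apply: (cintegrableMb ig (M := M)); first exact: cmeasurableJ.
  by move=> t; rewrite normc_conj.
have F0 w : fourier h w = 0.
  have := no (- w) => /contrapT <-; congr cintegral; apply/funext => t.
  by rewrite /h /gwin dot0l cis2pi0 dotNl; ring.
have iF : cintegrable vol (fourier h).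
  by rewrite (_ : fourier h = fun=> 0); [exact: cintegrable0|apply/funext].
apply: pt0; apply: (seqcont_ae_eq0 cphi).
apply: filterS (fourier_inversion ih iF) => t e.
have : h t = 0.
  rewrite e; under eq_fun do rewrite F0 mul0r; exact: cintegral0.
move/(congr1 normc); rewrite normcM normc_conj normc0 => /eqP.
rewrite mulf_eq0 => /orP[|/eqP/normc_eq0//].
by rewrite normcM normc_cis2pi mul1r normcC normr_eq0 gt_eqF ?expR_gt0.
Qed.

(** * Elements of M^1 as superpositions *)

(** The window phi is traded for a Gaussian, whose short-time Fourier transform
    is explicit. *)
Lemma M1_synth phi : schwartz phi -> (exists t, phi t <> 0) ->
  exists gam, [/\ nice gam, amalgam (stft gam gam) &
    forall f, M1 phi f -> exists2 A, cintegrable pvol A &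
      {ae vol, forall t, f t = synth gam A t}].
Proof.
move=> sphi phi0; have cphi := schwartz_seqcont sphi.
have [M phiM] := schwartz_bounded sphi.
have mphi := seqcont_cmeasurable cphi.
have [w w0] := gwin_not_orthogonal cphi (ex_intro _ M phiM) phi0.
exists (gwin w); split; [exact: nice_gwin|exact: amalgam_gwin|].
move=> f [[mf tf] Vf]; have ng := nice_gwin w.
have [_ [Mg gM] ig] := ng; have mg := nice_cmeasurable ng.
have mV := cmeasurable_stft mphi mf.
have iV : cintegrable pvol (stft phi f) by apply/cintegrableP.
have ih x : cintegrable vol (fun t => f t * (phi (t - x))^*).
  apply: (cintegrable_dom _ _ (tf _ (schwartz_shift x sphi))).
    by apply: cmeasurableM => //; apply: cmeasurableJ; exact: cmeasurable_shift.
  by move=> t; rewrite !normcM normc_conj.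
pose c := inner (gwin w) phi.
exists (fun a => c^-1 * stft phi f a); first exact: cintegrableZl.
have := stft_reconstruction mphi phiM mg gM ig mf ih iV.
apply: filterS => t e.
rewrite /synth; under eq_fun do rewrite -mulrA; rewrite cintegralZl; last first.
  apply: (cintegrableMb iV (cmeasurable_tfshift t mg) (M := Mg)) => a.
  by rewrite normc_tfshift.
rewrite -[cintegral _ _]e mulrCA mulVf ?mulr1//.
by apply/eqP.
Qed.

End superpositions.

(** * The Fourier transform of a product of short-time Fourier transforms *)

Section moyal.
Context {R : realType} {d : nat}.
Local Notation time := 'rV[R]_d.
Local Notation phase := ('rV[R]_d * 'rV[R]_d)%type.
Local Notation vol := (volume d : {sigma_finite_measure set 'rV[R]_d -> \bar R}).
Local Notation pvol := (@phase_volume R d : {sigma_finite_measure set phase -> \bar R}).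

Lemma stft_le g f (M : R) : nice f -> cmeasurable g ->
  (forall t, normc (g t) <= M) -> exists N, forall z, normc (@stft R d g f z) <= N.
Proof.
move=> [_ _ fi] mg gM; exists (\int[vol]_t (normc (M%:C * f t))) => -[x w].
have M0 : 0 <= M by exact: le_trans (normc_ge0 _) (gM 0).
rewrite stftE.
have ih := cintegrable_stft_integrand x mg gM fi.
rewrite (le_trans (normc_cintegralMcis_le ih _))//; first by vmeas.
apply: le_Rintegral => //.
- exact: cintegrable_normc ih.
- exact: cintegrable_normc (cintegrableZl _ fi).
- move=> t _; rewrite !normcM normc_conj normcC (ger0_norm M0) mulrC.
  by rewrite ler_wpM2r ?normc_ge0.
Qed.

(** Parseval's identity in the frequency variable leaves an integral that
    factors after the change of variables (x, t) -> (t - x, t). *)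
Lemma moyal f1 f2 g1 g2 (w : phase) : nice f1 -> nice f2 -> nice g1 -> nice g2 ->
  cintegrable pvol (stft g1 f1) ->
  cintegral pvol (fun z => stft g1 f1 z * (stft g2 f2 z)^* * cis2pi (Omega z w)) =
  stft g1 g2 w * (stft f1 f2 w)^*.
Proof.
case: w => y v nf1 nf2 ng1 ng2 iV1.
have [_ [Mf1 f1M] if1] := nf1; have [_ [Mf2 f2M] if2] := nf2.
have [_ [Mg1 g1M] ig1] := ng1; have [_ [Mg2 g2M] ig2] := ng2.
have mf1 := nice_cmeasurable nf1; have mf2 := nice_cmeasurable nf2.
have mg1 := nice_cmeasurable ng1; have mg2 := nice_cmeasurable ng2.
have mV1 := cmeasurable_stft mg1 mf1; have mV2 := cmeasurable_stft mg2 mf2.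
have [N2 V2N] := stft_le nf2 mg2 g2M.
have iVV : cintegrable pvol (fun z => stft g1 f1 z * (stft g2 f2 z)^*).
  apply: (cintegrableMb iV1 (M := N2)); first exact: cmeasurableJ.
  by move=> z; rewrite normc_conj.
have mOm : measurable_fun setT (fun z : phase => Omega z (y, v)).
  apply: measurable_funB; apply: measurable_dot; vmeas.
have iF : cintegrable pvol (fun z => stft g1 f1 z * (stft g2 f2 z)^* * cis2pi (Omega z (y, v))).
  apply: (cintegrableMb iVV (M := 1)); first by apply: cmeasurable_cis2pi.
  by move=> z; rewrite normc_cis2pi.
rewrite -(cFubini1 (iF : cintegrable (vol \x vol)%E _)).
pose k (p : time * time) := f1 (p.2 - y) * g2 (- p.1 + p.2) *
  ((g1 (p.2 - y - p.1))^* * (f2 p.2)^* * cis2pi (dot p.1 v)).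
have ik : cintegrable (vol \x vol)%E k.
  have if1y : cintegrable vol (fun t => f1 (t - y)).
    exact: (cintegrable_scaling (volume_shift (- y)) if1).
  have i0 : cintegrable (vol \x vol)%E (fun p => f1 (p.1 - y) * g2 (p.1 - p.2)).
    apply: (@cintegrable_scaled R _ _ _ _ vol vol (fun t x => t - x)
      (fun t => f1 (t - y)) g2 (fun t => volume_opp t) _ if1y ig2).
    by apply: measurable_rVB; vmeas.
  have i1 := cintegrable_swap i0.
  have -> : k = fun p => f1 (p.2 - y) * g2 (p.2 - p.1) *
      ((g1 (p.2 - y - p.1))^* * (f2 p.2)^* * cis2pi (dot p.1 v)).
    by apply/funext => p; rewrite /k (addrC (- p.1)).
  apply: (cintegrableMb i1 (M := Mg1 * Mf2)).
    apply: cmeasurableM; last by apply: cmeasurable_cis2pi; vmeas.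
    apply: cmeasurableM; apply: cmeasurableJ; last by apply: (cmeasurable_comp mf2).
    apply: (cmeasurable_comp mg1); apply: measurable_rVB; last by vmeas.
    by apply: measurable_rVB; vmeas.
  move=> p; rewrite !normcM normc_cis2pi mulr1 !normc_conj.
  by rewrite ler_pM ?normc_ge0.
transitivity (cintegral vol (fun x => cintegral vol (fun t => k (x, t)))).
  apply: ae_eq_cintegral.
  - apply: (cmeasurable_cintegral1 vol (f := fun z => stft g1 f1 z * (stft g2 f2 z)^* * cis2pi (Omega z (y, v)))).
    exact: cintegrable_cmeasurable iF.
  - exact: (cmeasurable_cintegral1 vol (cintegrable_cmeasurable ik)).
  have := ae_cintegrable1 (iV1 : cintegrable (vol \x vol)%E (stft g1 f1)).
  apply: filterS => x iV1x.
  pose h1 t := f1 t * (g1 (t - x))^*.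
  pose h2 t := f2 t * (g2 (t - x))^*.
  have ih1 : cintegrable vol h1 by exact: (cintegrable_stft_integrand x mg1 g1M if1).
  have ih2 : cintegrable vol h2 by exact: (cintegrable_stft_integrand x mg2 g2M if2).
  have mh2 := cintegrable_cmeasurable ih2.
  have iF1 : cintegrable vol (fourier h1).
    by move: iV1x; under eq_fun do rewrite stft_fourier.
  have inv := scaling_ae (volume_shift (- y)) (fourier_inversion ih1 iF1).
  pose q (p : time * time) := fourier h1 p.1 * (h2 p.2)^* * cis2pi (dot p.1 (p.2 - y)).
  have iq : cintegrable (vol \x vol)%E q.
    apply: (cintegrableMb (cintegrable_prod iF1 (cintegrableJ ih2)) (M := 1)).
      apply: cmeasurable_cis2pi; apply: measurable_dot; first by vmeas.
      by apply: measurable_rVB; vmeas.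
    by move=> p; rewrite normc_cis2pi.
  transitivity (cis2pi (dot x v) * cintegral vol (fun w => cintegral vol (fun t => q (w, t)))).
    rewrite -cintegralZl; last exact: cintegrable_cintegral1 iq.
    congr cintegral; apply/funext => w.
    rewrite !stft_fourier -/h1 -/h2 /Omega /= cis2piD.
    rewrite {2}/fourier -cintegralJ; last by apply: cintegrableMcis => //; vmeas.
    have -> : (fun t => q (w, t)) = fun t => fourier h1 w * cis2pi (- dot w y) *
        (h2 t * cis2pi (- dot w t))^*.
      by apply/funext => t; rewrite /q /= dotBr cis2piD conjcM -cis2piN opprK; ring.
    rewrite cintegralZl; last first.
      by apply: cintegrableJ; apply: cintegrableMcis => //; vmeas.
    by ring.
  rewrite (cFubini iq) -cintegralZl; last exact: cintegrable_cintegral2 iq.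
  apply: ae_eq_cintegral.
  - apply: cmeasurableM; first exact: cmeasurable_cst.
    exact: (cmeasurable_cintegral2 vol (cintegrable_cmeasurable iq)).
  - exact: (cmeasurable_pair1 x (cintegrable_cmeasurable ik)).
  apply: filterS inv => t e.
  rewrite /q /=; under eq_fun do rewrite mulrAC.
  rewrite cintegralZr; last by apply: cintegrableMcis => //; vmeas.
  rewrite -e /k /= /h1 /h2 conjcM Num.Theory.conjCK (addrC (- x)); ring.
rewrite (cFubini ik).
transitivity (cintegral vol (fun t => (f2 t * (f1 (t - y))^* * cis2pi (- dot v t))^* * stft g1 g2 (y, v))).
  congr cintegral; apply/funext => t; rewrite stftE.
  rewrite -cintegralZl; last first.
    apply: cintegrableMcis; last by vmeas.
    exact: (cintegrable_stft_integrand y mg1 g1M ig2).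
  have mq : cmeasurable (fun u => (f2 t * (f1 (t - y))^* * cis2pi (- dot v t))^* *
      (g2 u * (g1 (u - y))^* * cis2pi (- dot v u))).
    apply: cmeasurableM; first exact: cmeasurable_cst.
    apply: cmeasurableM; last by apply: cmeasurable_cis2pi; vmeas.
    by apply: cmeasurableM => //; apply: cmeasurableJ; exact: cmeasurable_shift.
  rewrite -[RHS]mul1r -(cintegral_scaling (volume_opp t) mq).
  congr cintegral; apply/funext => x; rewrite /k /= !conjcM Num.Theory.conjCK -cis2piN opprK.
  rewrite dotBr (dotC x v) opprB cis2piD (addrC (- x)) (_ : t - y - x = t - x - y); last first.
    by rewrite addrAC.
  have := cis2piVr (dot v t); move: (cis2pi (dot v t)) (cis2pi (- dot v t)) => a b ab.
  transitivity (f1 (t - y) * g2 (t - x) * ((g1 (t - x - y))^* * (f2 t)^* * cis2pi (dot v x)) * (a * b)).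
    by rewrite ab mulr1.
  by ring.
rewrite cintegralZr; last first.
  apply: cintegrableJ; apply: cintegrableMcis; last by vmeas.
  exact: (cintegrable_stft_integrand y mf1 f1M if2).
rewrite mulrC; congr (_ * _); rewrite cintegralJ; first by rewrite stftE.
apply: cintegrableMcis; last by vmeas.
exact: (cintegrable_stft_integrand y mf1 f1M if2).
Qed.

End moyal.

(** * Bases of discrete subgroups of R^n *)

Section norms.
Context {R : realType}.

(** A bound for the norm of the linear map defined by B. *)
Definition mxsum m n (B : 'M[R]_(m, n)) : R := \sum_i \sum_j `|B i j|.

Lemma mxsum_ge0 m n (B : 'M[R]_(m, n)) : 0 <= mxsum B.
Proof. by apply: sumr_ge0 => i _; apply: sumr_ge0. Qed.

Lemma norm_mulmx_le m n (B : 'M[R]_(m, n)) (c : 'rV[R]_m) (e : R) :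
  (forall i, `|c 0 i| <= e) -> `|c *m B| <= e * mxsum B.
Proof.
move=> ce.
have [m0|e0] : m = 0%N \/ 0 <= e.
  case: m B c ce => [|m] B c ce; first by left.
  by right; exact: le_trans (ce ord0).
  subst m; rewrite /mxsum big_ord0 mulr0; apply: rV_norm_le => // i.
  by rewrite mxE big_ord0 normr0.
apply: rV_norm_le => [|j]; first by rewrite mulr_ge0 ?mxsum_ge0.
rewrite mxE; apply: le_trans (ler_norm_sum _ _ _) _.
rewrite /mxsum mulr_sumr; apply: ler_sum => i _; rewrite normrM mulr_sumr (bigD1 j)//=.
apply: (@le_trans _ _ (e * `|B i j|)); first exact: ler_wpM2r.
by rewrite lerDl; apply: sumr_ge0 => k _; rewrite mulr_ge0.
Qed.

End norms.

Section subgroups.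
Context {R : realType} {n : nat}.
Implicit Types (S : set 'rV[R]_n) (v : 'rV[R]_n).

Definition subgroup S : Prop := S 0 /\ forall u v, S u -> S v -> S (u - v).

Lemma subgroupN S v : subgroup S -> S v -> S (- v).
Proof. by move=> [S0 SB] Sv; rewrite -(sub0r v); exact: SB. Qed.

Lemma subgroupD S u v : subgroup S -> S u -> S v -> S (u + v).
Proof. by move=> sS Su Sv; rewrite -(opprK v); apply: sS.2 => //; exact: subgroupN. Qed.

Lemma subgroupZ S v (a : int) : subgroup S -> S v -> S (a%:~R *: v).
Proof.
move=> sS Sv; rewrite scaler_int; case: a => k.
  by rewrite -pmulrn; elim: k => [|k IH]; [rewrite mulr0n; exact: sS.1|rewrite mulrS; exact: subgroupD].
rewrite NegzE mulrNz; apply: subgroupN => //; rewrite -pmulrn.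
by elim: k.+1 => [|j IH]; [rewrite mulr0n; exact: sS.1|rewrite mulrS; exact: subgroupD].
Qed.

Lemma subgroup_span S m (B : 'M[R]_(m, n)) (a : 'rV[int]_m) : subgroup S ->
  (forall i, S (row i B)) -> S (map_mx intr a *m B).
Proof.
move=> sS SB; rewrite mulmx_sum_row; elim/big_ind : _ => [|u v|i _].
- exact: sS.1.
- exact: subgroupD.
- by rewrite mxE; exact: subgroupZ.
Qed.

(** Reduce the first multiples of v modulo the basis: if the unit cell is cut
    into sufficiently small cubes, two of the reductions fall into the same
    cube, and discreteness makes them equal. The number of cubes does not
    depend on v, hence a common multiple works for all v. *)
Lemma discrete_subgroup_commensurable S (B : 'M[R]_n) (e : R) : subgroup S ->
  0 < e -> (forall v, S v -> `|v| < e -> v = 0) ->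
  B \in unitmx -> (forall i, S (row i B)) ->
  exists2 N : nat, (0 < N)%N & forall v, S v -> exists a : 'rV[int]_n,
    N%:R *: v = map_mx intr a *m B.
Proof.
move=> sS e0 Se uB SB.
have [M' M'e] : exists M' : nat, (M'.+1%:R)^-1 * mxsum B < e.
  exists (Num.truncn (mxsum B / e)); rewrite mulrC ltr_pdivrMr// mulrC -ltr_pdivrMr//.
  exact: truncnS_gt.
pose M := M'.+1; pose K := (M ^ n)%N; exists K`! => [|v Sv]; first exact: fact_gt0.
pose x (k : nat) i := ((k%:R *: v) *m invmx B) 0 i.
pose fl (k : nat) : 'rV[int]_n := \row_i Num.floor (x k i).
pose fr k i := x k i - (fl k 0 i)%:~R.
have fr01 k i : 0 <= fr k i < 1.
  rewrite /fr mxE subr_ge0 floor_le_tmp/= ltrBlDl.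
  by have := floorD1_gt (x k i); rewrite intrD.
pose cell (k : 'I_K.+1) : {ffun 'I_n -> 'I_M} := [ffun i => inord (Num.truncn (M%:R * fr k i))].
have cellE k i : (cell k i : nat) = Num.truncn (M%:R * fr k i).
  rewrite ffunE inordK//.
  have /andP[f0 f1] := fr01 k i.
  by rewrite truncn_lt_nat ?mulr_ge0// -[ltRHS]mulr1 ltr_pM2l ?ltr0n.
have /injectivePn[j [k jk cjk]] : ~~ injectiveb cell.
  apply/negP => /injectiveP /leq_card.
  by rewrite card_ffun !card_ord ltnn.
have frjk i : `|fr j i - fr k i| <= M%:R^-1.
  have /andP[fj0 _] := fr01 j i; have /andP[fk0 _] := fr01 k i.
  have Mf0 l : 0 <= M%:R * fr l i by have /andP[? _] := fr01 l i; rewrite mulr_ge0.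
  have /andP[a1 a2] := truncn_itv (Mf0 j); have /andP[b1 b2] := truncn_itv (Mf0 k).
  rewrite -(cellE j) cjk in a1 a2; rewrite -(cellE k) in b1 b2.
  rewrite -(ler_pM2l (_ : 0 < M%:R)) ?ltr0n// mulfV ?pnatr_eq0//.
  rewrite -{1}(ger0_norm (ler0n R M)) -normrM mulrBr ler_norml.
  rewrite -natr1 in a2 b2; apply/andP; split; lra.
have xB l : map_mx intr (fl l) *m B = l%:R *: v - (\row_i fr l i) *m B.
  rewrite [in RHS](_ : \row_i fr l i = (l%:R *: v) *m invmx B - map_mx intr (fl l)).
    by rewrite mulmxBl mulmxKV// opprB addrC subrK.
  by apply/rowP => i; rewrite /fr /x mxE [RHS]mxE; congr (_ + _); rewrite [RHS]mxE [in RHS]mxE.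
have frE : (\row_i fr j i) *m B = (\row_i fr k i) *m B.
  apply/eqP; rewrite -subr_eq0; apply/eqP; apply: Se.
    have h l : S ((\row_i fr l i) *m B).
      rewrite -[X in S X](subKr (l%:R *: v)) -xB; apply: sS.2; last exact: subgroup_span.
      by have := @subgroupZ S v l%:Z sS Sv; rewrite -pmulrn.
    exact: sS.2.
  rewrite -mulmxBl; apply: le_lt_trans M'e; apply: norm_mulmx_le => i.
  by rewrite !mxE.
have key : exists2 a : 'rV[int]_n, (0 < `|j%:Z - k%:Z|%N <= K)%N &
    (`|j%:Z - k%:Z|%N)%:R *: v = map_mx intr a *m B.
  have key0 (p q : 'I_K.+1) : (q < p)%N -> (\row_i fr p i) *m B = (\row_i fr q i) *m B ->
      exists2 a : 'rV[int]_n, (0 < `|p%:Z - q%:Z|%N <= K)%N &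
      (`|p%:Z - q%:Z|%N)%:R *: v = map_mx intr a *m B.
    move=> qp pq; exists (fl p - fl q).
      rewrite distnEl ?(ltnW qp)// subn_gt0 qp/=.
      by apply: leq_trans (leq_subr _ _) _; rewrite -ltnS.
    rewrite distnEl ?(ltnW qp)// natrB ?(ltnW qp)// map_mxB mulmxBl !xB pq scalerBl.
    by rewrite opprB addrA subrK.
  case: (ltngtP j k) => [jlk|klj|/val_inj ejk].
  - by have := key0 k j jlk (esym frE); rewrite distnC.
  - exact: key0.
  - by rewrite ejk eqxx in jk.
have [a /andP[D0 DK] Da] := key.
have /dvdnP[q qE] : (`|j%:Z - k%:Z| %| K`!)%N by apply: dvdn_fact; rewrite D0.
exists (q%:Z *: a); rewrite qE natrM -scalerA Da scalemxAl; congr (_ *m _).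
by apply/matrixP => s t; rewrite !mxE intrM.
Qed.

(** The cofactors along row i do not involve that row. *)
Lemma det_replace_row (A : 'M[R]_n) (c : 'rV[R]_n) i :
  \det (\matrix_k (if k == i then c *m A else row k A)) = c 0 i * \det A.
Proof.
pose E : 'M[R]_n := \matrix_k (if k == i then c else row k 1%:M).
have -> : (\matrix_k (if k == i then c *m A else row k A)) = E *m A.
  apply/row_matrixP => k; rewrite row_mul !rowK; case: ifP => // _.
  by rewrite -row_mul mul1mx.
rewrite det_mulmx; congr (_ * _); rewrite (expand_det_row _ i).
have adj1 : \adj (1%:M : 'M[R]_n) = 1%:M.
  by have := mul_mx_adj (1%:M : 'M[R]_n); rewrite mul1mx det1.
rewrite (bigD1 i)//= big1 ?addr0 => [|j ji].
  rewrite !mxE eqxx (_ : cofactor E i i = \adj (1%:M : 'M[R]_n) i i).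
    by rewrite adj1 mxE eqxx mulr1.
  rewrite mxE /cofactor; congr (_ * \det _); apply/matrixP => s t; rewrite !mxE.
  by rewrite eq_sym (negbTE (neq_lift _ _)) !mxE.
rewrite (_ : cofactor E i j = \adj (1%:M : 'M[R]_n) j i).
  by rewrite adj1 [X in _ * X]mxE (negbTE ji) mulr0.
rewrite [in RHS]mxE /cofactor; congr (_ * \det _); apply/matrixP => s t; rewrite !mxE.
by rewrite eq_sym (negbTE (neq_lift _ _)) !mxE.
Qed.

(** By commensurability, the determinants of the bases of R^n made of elements
    of S are multiples of a fixed number. A basis of least determinant generates
    S: replacing one of its rows by a vector of S with a fractional coordinate
    there would decrease the determinant. *)
Lemma discrete_subgroup_basis S (B : 'M[R]_n) (e : R) : subgroup S ->
  0 < e -> (forall v, S v -> `|v| < e -> v = 0) ->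
  B \in unitmx -> (forall i, S (row i B)) ->
  exists2 C : 'M[R]_n, C \in unitmx &
    forall v, S v <-> exists a : 'rV[int]_n, v = map_mx intr a *m C.
Proof.
move=> sS e0 Se uB SB.
have [N N0 SN] := discrete_subgroup_commensurable sS e0 Se uB SB.
have N0' : (N%:R : R) != 0 by rewrite pnatr_eq0 -lt0n.
pose good (A : 'M[int]_n) := forall i, S (row i (N%:R^-1 *: (map_mx intr A *m B))).
pose P k := `[< exists A : 'M[int]_n, [/\ good A, `|\det A|%N = k & (0 < k)%N] >].
have exP : exists k, P k.
  exists (`|\det ((N%:Z)%:M : 'M[int]_n)|%N); apply/asboolP; exists (N%:Z)%:M; split => //.
    move=> i; rewrite map_scalar_mx mul_scalar_mx scalerA mulVf// scale1r.
    exact: SB.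
  by rewrite absz_gt0 det_scalar expf_neq0// eqz_nat -lt0n.
case: (ex_minnP exP) => k /asboolP[A [gA <- A0]] kmin.
set C := N%:R^-1 *: (map_mx intr A *m B).
have dA : (\det A)%:~R != 0 :> R by rewrite intr_eq0 -absz_gt0.
have uA : (map_mx intr A : 'M[R]_n) \in unitmx by rewrite unitmxE det_map_mx unitfE.
have uC : C \in unitmx.
  by rewrite unitmxZ ?unitmx_mul ?uA// unitfE invr_eq0.
exists C => // v; split=> [Sv|[a ->]]; last exact: subgroup_span.
pose c := v *m invmx C; exists (\row_i Num.floor (c 0 i)).
apply: contrapT => nv.
pose f : 'rV[R]_n := \row_i (c 0 i - (Num.floor (c 0 i))%:~R).
have cE : v = c *m C by rewrite mulmxKV.
have fC : f *m C = v - map_mx intr (\row_i Num.floor (c 0 i)) *m C.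
  rewrite [in RHS]cE -mulmxBl; congr (_ *m _); apply/rowP => i.
  by rewrite mxE [RHS]mxE; congr (_ + _); rewrite [RHS]mxE [in RHS]mxE [in RHS]mxE.
have SfC : S (f *m C) by rewrite fC; apply: sS.2 => //; exact: subgroup_span.
have [i fi] : exists i, f 0 i != 0.
  apply: contrapT => /forallNP f0; apply: nv.
  have -> : v = f *m C + map_mx intr (\row_i Num.floor (c 0 i)) *m C by rewrite fC subrK.
  rewrite (_ : f = 0) ?mul0mx ?add0r//; apply/rowP => i.
  by rewrite [RHS]mxE; apply/eqP/negPn/negP/f0.
have /andP[fi0 fi1] : 0 < f 0 i < 1.
  rewrite lt0r fi/= mxE subr_ge0 floor_le_tmp/= ltrBlDl.
  by have := floorD1_gt (c 0 i); rewrite intrD.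
have [b bE] := SN _ SfC.
pose A' : 'M[int]_n := \matrix_k (if k == i then b else row k A).
have fA : f *m map_mx intr A = map_mx intr b :> 'rV[R]_n.
  apply: (can_inj (mulmxK uB)); rewrite -bE -mulmxA /C -scalemxAr scalerA mulfV//.
  by rewrite scale1r.
have A'E : map_mx intr A' =
    \matrix_k (if k == i then f *m map_mx intr A else row k (map_mx intr A)) :> 'M[R]_n.
  apply/matrixP => j t; rewrite mxE [RHS]mxE mxE.
  by case: ifP => _; [rewrite fA [RHS]mxE|rewrite [RHS]mxE [RHS]mxE mxE].
have dA' : (\det A')%:~R = f 0 i * (\det A)%:~R :> R.
  by rewrite -!det_map_mx A'E det_replace_row.
have A'0 : (0 < `|\det A'|)%N.
  by rewrite absz_gt0 -(intr_eq0 R) dA' mulf_neq0.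
have gA' : good A'.
  move=> j; rewrite linearZ/= row_mul A'E rowK.
  case: ifP => _; first by rewrite -mulmxA scalemxAr.
  by have := gA j; rewrite linearZ/= row_mul.
have /kmin : P `|\det A'|%N by apply/asboolP; exists A'; split.
rewrite leqNgt => /negP; apply.
rewrite -(ltr_nat R) !natr_absz !intr_norm dA' normrM gtr0_norm//.
by rewrite gtr_pMl// normr_gt0.
Qed.

(** The elements of S lie in the span of a family of maximal rank, which is all
    of R^n if no functional vanishes on S. *)
Lemma subgroup_spanning_rows S : S 0 ->
  (forall u : 'cV[R]_n, (forall v, S v -> v *m u = 0) -> u = 0) ->
  exists2 B : 'M[R]_n, B \in unitmx & forall i, S (row i B).
Proof.
move=> S0 Su.
pose P k := `[< exists m, exists2 V : 'M[R]_(m, n), \rank V = k & forall i, S (row i V) >].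
have exP : exists k, P k.
  by exists (\rank (0 : 'M[R]_(0, n))); apply/asboolP; exists 0%N; exists 0 => // -[].
have ubP k : P k -> (k <= n)%N.
  by move=> /asboolP[m [V <- _]]; exact: rank_leq_col.
case: (ex_maxnP exP ubP) => k /asboolP[m [V <- SV]] kmax.
have sub v : S v -> (v <= V)%MS.
  move=> Sv; have : P (\rank (col_mx V v)).
    apply/asboolP; exists (m + 1)%N; exists (col_mx V v) => // i.
    case: (split_ordP i) => j ->; first by rewrite rowKu.
    by rewrite rowKd (ord1 j) row_id.
  move=> /kmax; rewrite -addsmxE => h.
  apply: submx_trans (addsmxSr V v) _.
  by rewrite -(mxrank_leqif_sup (addsmxSl V v)) eqn_leq h mxrankS// addsmxSl.
have fV : row_full V.
  rewrite -cokermx_eq0; apply/eqP/matrixP => i j; rewrite [RHS]mxE.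
  have /colP/(_ i) : col j (cokermx V) = 0; last by rewrite !mxE.
  apply: Su => v /sub /submxP[D ->].
  rewrite colE -mulmxA (mulmxA V) mulmx_coker mul0mx mulmx0 //.
exists (rowsub (fullrankfun fV) V) => [|i]; last by rewrite row_rowsub.
exact: fullrowsub_unit.
Qed.

End subgroups.

Section lattice_basis.
Context {R : realType} {d : nat}.
Local Notation time := 'rV[R]_d.
Local Notation phase := ('rV[R]_d * 'rV[R]_d)%type.
Implicit Types (L : zmodClosed phase) (z w : phase).

Definition flat z : 'rV[R]_(d + d) := row_mx z.1 z.2.
Definition unflat (v : 'rV[R]_(d + d)) : phase := (lsubmx v, rsubmx v).

Lemma flatK : cancel flat unflat.
Proof. by move=> [x w]; rewrite /flat /unflat row_mxKl row_mxKr. Qed.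

Lemma unflatK : cancel unflat flat.
Proof. by move=> v; rewrite /flat /unflat hsubmxK. Qed.

Lemma flatB z w : flat (z - w) = flat z - flat w.
Proof. by rewrite /flat opp_row_mx add_row_mx. Qed.

Lemma norm_flat z : `|flat z| = `|z|.
Proof.
rewrite prod_normE; apply/eqP; rewrite eq_le; apply/andP; split.
  apply: rV_norm_le => [|i]; first by rewrite le_max normr_ge0.
  rewrite /flat; case: (split_ordP i) => j ->.
    by rewrite row_mxEl le_max le_rV_norm.
  by rewrite row_mxEr le_max le_rV_norm orbT.
rewrite ge_max; apply/andP; split; apply: rV_norm_le => // i.
  by rewrite -(row_mxEl z.1 z.2); exact: le_rV_norm.
by rewrite -(row_mxEr z.1 z.2); exact: le_rV_norm.
Qed.

(** A linear functional that vanishes on a cocompact subgroup descends to a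
    continuous, hence bounded, function on the quotient; so it is zero. *)
Lemma cocompact_spanning L (u : 'cV[R]_(d + d)) : cocompact L ->
  (forall z, z \in L -> flat z *m u = 0) -> u = 0.
Proof.
move=> cL uL; apply: contrapT => u0.
pose Q := quotient_topology (Quotient.quot L).
pose l z : R := (flat z *m u) 0 0.
have lB z w : l (z - w) = l z - l w.
  by rewrite /l flatB mulmxBl mxE; congr (_ + _); rewrite mxE.
have lZ (a : R) z : l (a *: z) = a * l z.
  by rewrite /l (_ : flat (a *: z) = a *: flat z) -?scalemxAl ?mxE// /flat scale_row_mx.
have cl : continuous (l : phase -> R^o).
  move=> z; apply/cvgrPdist_lt => e e0.
  near=> w; rewrite -lB; apply: (@le_lt_trans _ _ (`|z - w| * mxsum u)).
    rewrite -norm_flat; apply: le_trans (le_rV_norm _ _) _.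
    by apply: norm_mulmx_le => i; exact: le_rV_norm.
  rewrite (@le_lt_trans _ _ (`|z - w| * (mxsum u + 1)))//.
    by rewrite ler_wpM2l// lerDl.
  rewrite -ltr_pdivlMr ?ltr_wpDl ?mxsum_ge0//.
  near: w; have e'0 : 0 < e / (mxsum u + 1) by rewrite divr_gt0 ?ltr_wpDl ?mxsum_ge0.
  have := @nbhsx_ballx R phase z _ e'0.
  by rewrite -(@ball_normE R phase).
have cq : continuous ((l : phase -> R^o) \o (repr : Q -> phase)).
  apply: (@repr_comp_continuous _ _ _ (l : phase -> R^o)) => // z w /eqP zw.
  have : z - w \in L by rewrite Quotient.idealrBE; apply/eqP.
  move=> /uL h; rewrite -subr_eq0 -lB /l h mxE //.
have := continuous_compact (continuous_subspaceT cq) cL.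
move=> /compact_bounded [M [_ Mb]].
have lM z : `|l z| <= M + 1.
  have : `|l (repr ((\pi_Q z)%qT : Q))| <= M + 1.
    by apply: Mb; [rewrite ltrDl|exists (\pi_Q z)%qT].
  rewrite (_ : l (repr _) = l z)//.
  apply/eqP; rewrite -subr_eq0 -lB /l uL ?mxE//.
  by rewrite Quotient.idealrBE; apply/eqP; rewrite reprK.
have [z lz] : exists z, l z != 0.
  apply: contrapT => /forallNP h; apply: u0; apply/colP => i; rewrite [RHS]mxE.
  have /negP/negPn/eqP := h (unflat (delta_mx 0 i)).
  by rewrite /l unflatK -rowE mxE.
have := lM (((M + 2) / l z) *: z); rewrite lZ mulfVK//.
have M0 : 0 <= M + 1 := le_trans (normr_ge0 _) (lM 0).
by rewrite ger0_norm; lra.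
Unshelve. all: by end_near.
Qed.

Definition coords (B : 'M[R]_(d + d)) z : 'rV[R]_(d + d) := flat z *m invmx B.
Definition ofcoords (B : 'M[R]_(d + d)) (s : 'rV[R]_(d + d)) : phase := unflat (s *m B).
Definition symplectic : 'M[R]_(d + d) := block_mx 0 1%:M (- 1%:M) 0.
(** Coordinates in the basis dual to the rows of B for the symplectic form, see
    [Omega_dual]. *)
Definition dual (B : 'M[R]_(d + d)) (s : 'rV[R]_(d + d)) : phase :=
  unflat (s *m (invmx B)^T *m symplectic).

Lemma dot_mulmx n (x y : 'rV[R]_n) : dot x y = (x *m y^T) 0 0.
Proof. by rewrite mxE; apply: eq_bigr => i _; rewrite mxE. Qed.

Lemma OmegaE z w : Omega z w = (flat z *m symplectic *m (flat w)^T) 0 0.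
Proof.
rewrite /Omega !dot_mulmx /flat /symplectic mul_row_block !mulmx0 add0r addr0.
rewrite !mulmx1 mulmxN mulmx1 tr_row_mx mul_row_col mulNmx addrC.
by rewrite [RHS]mxE; congr (_ + _); rewrite [RHS]mxE.
Qed.

Lemma symplectic_orthogonal : symplectic *m symplectic^T = 1%:M.
Proof.
rewrite /symplectic tr_block_mx !trmx0 trmx1 linearN/= trmx1 mulmx_block.
by rewrite !mul0mx !mulmx0 !mulmx1 !mulNmx !mulmxN !mul1mx opprK !add0r !addr0 -scalar_mx_block.
Qed.

Section basis.
Variables (B : 'M[R]_(d + d)) (uB : B \in unitmx).

Lemma coordsK : cancel (coords B) (ofcoords B).
Proof. by move=> z; rewrite /ofcoords /coords mulmxKV// flatK. Qed.

Lemma ofcoordsK : cancel (ofcoords B) (coords B).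
Proof. by move=> v; rewrite /ofcoords /coords unflatK mulmxK. Qed.

Lemma coordsB z w : coords B (z - w) = coords B z - coords B w.
Proof. by rewrite /coords flatB mulmxBl. Qed.

Lemma ofcoordsB s t : ofcoords B (s - t) = ofcoords B s - ofcoords B t.
Proof. by apply: (can_inj coordsK); rewrite coordsB !ofcoordsK. Qed.

Lemma Omega_dual z s : Omega z (dual B s) = dot (coords B z) s.
Proof.
rewrite OmegaE dot_mulmx /dual unflatK !trmx_mul trmxK !mulmxA.
by rewrite -(mulmxA _ symplectic) symplectic_orthogonal mulmx1.
Qed.

Lemma dualK s : flat (dual B s) *m (symplectic^T *m B^T) = s.
Proof.
rewrite /dual unflatK mulmxA -(mulmxA _ symplectic) symplectic_orthogonal mulmx1.
by rewrite -mulmxA -trmx_mul mulmxV// trmx1 mulmx1.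
Qed.

Lemma dual_surjective w : w = dual B (flat w *m (symplectic^T *m B^T)).
Proof.
apply: (can_inj flatK); rewrite /dual unflatK.
rewrite -!mulmxA (mulmxA B^T) -trmx_mul mulVmx// trmx1 mul1mx.
by rewrite (mulmx1C symplectic_orthogonal) mulmx1.
Qed.

Lemma dualB s t : dual B (s - t) = dual B s - dual B t.
Proof. by apply: (can_inj flatK); rewrite flatB /dual !unflatK !mulmxBl. Qed.

End basis.

Definition intv n (a : 'rV[int]_n) : 'rV[R]_n := map_mx intr a.

Lemma intvB n (a b : 'rV[int]_n) : intv (a - b) = intv a - intv b.
Proof. exact: map_mxB. Qed.

Lemma intv_inj n : injective (@intv n).
Proof.
move=> a b /rowP ab; apply/rowP => i; have := ab i; rewrite !mxE.
exact: intr_inj.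
Qed.

Lemma norm_intv_ge1 n (a : 'rV[int]_n) : a != 0 -> 1 <= `|intv a|.
Proof.
move=> a0; have [i ai] : exists i, a 0 i != 0.
  apply: contrapT => /forallNP h; move/negP: a0; apply; apply/eqP/rowP => i.
  by rewrite [RHS]mxE; apply/eqP/negPn/negP/h.
apply: le_trans (le_rV_norm _ i); rewrite mxE -intr_norm (ler_int R 1).
by rewrite -gtz0_ge1 normr_gt0.
Qed.

Definition spread n (pt : 'rV[int]_n -> phase) : Prop :=
  exists2 r : R, 0 < r & forall a b, a != b -> r <= `|pt a - pt b|.

(** Distinct integer vectors have distance at least 1, and a linear map
    stretches distances by a bounded factor. *)
Lemma linear_spread n (pt : 'rV[int]_n -> phase) (M : 'M[R]_(d + d, n)) :
  (forall a b, pt (a - b) = pt a - pt b) ->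
  (forall a, flat (pt a) *m M = intv a) -> spread pt.
Proof.
move=> ptB ptM; exists (mxsum M + 1)^-1 => [|a b ab].
  by rewrite invr_gt0 ltr_wpDl ?mxsum_ge0.
have ab0 : a - b != 0 by rewrite subr_eq0.
have := norm_intv_ge1 ab0; rewrite -ptM -ptB => h.
rewrite -div1r ler_pdivrMr ?ltr_wpDl ?mxsum_ge0//; apply: (le_trans h).
rewrite -norm_flat; apply: (@le_trans _ _ (`|flat (pt (a - b))| * mxsum M)).
  by apply: norm_mulmx_le => i; exact: le_rV_norm.
by rewrite ler_wpM2l// lerDl.
Qed.

Lemma cis2pi_int (k : int) : cis2pi (k%:~R : R) = 1.
Proof.
have c1 : cis2pi (1 : R) = 1.
  by apply: complexP; rewrite /cis2pi/= mulr1 mulr_natl ?cos2pi ?sin2pi.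
have cn m : cis2pi (m%:R : R) = 1.
  by elim: m => [|m IH]; rewrite ?cis2pi0// -natr1 cis2piD IH c1 mulr1.
case: k => m; first by rewrite -pmulrn cn.
rewrite NegzE mulrNz cis2piN -pmulrn cn; exact: conjcC.
Qed.

Lemma cis2pi_eq1 (s : R) : cis2pi s = 1 <-> exists k : int, s = k%:~R.
Proof.
split=> [cs|[k ->]]; last exact: cis2pi_int.
have half (r : R) : 0 <= r <= 2^-1 -> cis2pi r = 1 -> r = 0.
  move=> /andP[r0 r1] /(congr1 (@complex.Re R))/= cr; have p0 := @pi_gt0 R.
  have : 2 * pi * r = 0.
    apply: cos_inj; rewrite ?cos0 ?in_itv//= ?lexx ?pi_ge0//.
    rewrite !mulr_ge0 ?pi_ge0//= mulrC mulrA -[leRHS]mul1r ler_pM2r//.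
    by rewrite -ler_pdivlMr// mul1r.
  by move/eqP; rewrite !mulf_eq0 pnatr_eq0 (gt_eqF p0) /= => /eqP.
pose k := Num.floor s; exists k; pose r := s - k%:~R.
have r01 : 0 <= r < 1.
  rewrite subr_ge0 floor_le_tmp/= ltrBlDl.
  by have := floorD1_gt s; rewrite intrD.
have cr : cis2pi r = 1.
  by rewrite cis2piD cs mul1r -mulrNz cis2pi_int.
apply/eqP; rewrite -subr_eq0 -/r; apply/eqP.
have /andP[r0 r1] := r01.
have [rh|rh] := leP r 2^-1; first by apply: half => //; rewrite r0.
have : 1 - r = 0; last by lra.
apply: half; first by lra.
by rewrite cis2piD cis2piN cr (cis2pi_int 1) mul1r; exact: conjcC.
Qed.

(** In the coordinates of a basis of L, membership in the adjoint lattice is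
    tested on the basis vectors; it says that the dual coordinates are
    integers. *)
Lemma lattice_basis L : lattice L -> exists2 B : 'M[R]_(d + d), B \in unitmx &
  (forall z, z \in L <-> exists a, z = ofcoords B (intv a)) /\
  (forall w, adjoint_lattice L w <-> exists a, w = dual B (intv a)).
Proof.
move=> [dL cL]; pose S : set 'rV[R]_(d + d) := [set v | unflat v \in L].
have uB u v : unflat (u - v) = unflat u - unflat v.
  by apply: (can_inj flatK); rewrite flatB !unflatK.
have u0 : unflat 0 = 0 by apply: (can_inj flatK); rewrite unflatK /flat row_mx0.
have sS : subgroup S.
  by split=> [|u v Su Sv]; rewrite /S /= ?u0 ?rpred0// uB rpredB.
have [B0 uB0 SB0] : exists2 B : 'M[R]_(d + d), B \in unitmx & forall i, S (row i B).
  apply: subgroup_spanning_rows; first exact: sS.1.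
  move=> u Su; apply: (cocompact_spanning cL) => z zL; apply: Su.
  by rewrite /S /= flatK.
have [e e0 Se] : exists2 e : R, 0 < e & forall v, S v -> `|v| < e -> v = 0.
  have /(@nbhs_ballP R phase 0)[e e0] := dL _ (rpred0 L).
  rewrite -(@ball_normE R phase) => h; exists e => // v Sv ve.
  apply: (can_inj unflatK); rewrite u0; apply: h => //=.
  by rewrite sub0r normrN -norm_flat unflatK.
have [B uuB SB] := discrete_subgroup_basis sS e0 Se uB0 SB0.
have LB z : z \in L <-> exists a, z = ofcoords B (intv a).
  rewrite -{1}(flatK z); split=> [/SB[a e1]|[a ->]].
    by exists a; rewrite -(flatK z) e1.
  by rewrite /ofcoords unflatK; apply/SB; exists a.
exists B => //; split=> // w; split=> [wL|[a ->] l /LB[b ->]]; last first.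
  rewrite Omega_dual ofcoordsK//; apply/cis2pi_eq1.
  exists (\sum_i b 0 i * a 0 i); rewrite rmorph_sum; apply: eq_bigr => i _.
  by rewrite !mxE rmorphM.
set s := flat w *m (symplectic^T *m B^T).
have ws : w = dual B s by exact: dual_surjective.
have si i : exists k : int, s 0 i = k%:~R.
  apply/cis2pi_eq1; have := wL (ofcoords B (intv (delta_mx 0 i))).
  rewrite ws Omega_dual ofcoordsK// => <-.
    congr cis2pi; rewrite /dot (bigD1 i)//= big1 ?addr0 => [|j ji].
      by rewrite !mxE !eqxx mul1r.
    by rewrite !mxE eqxx (negbTE ji) mul0r.
  by apply/LB; exists (delta_mx 0 i).
have [a ea] := choice si; exists (\row_i a i); rewrite ws; congr dual.
by apply/rowP => i; rewrite ea mxE mxE.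
Qed.

End lattice_basis.

(** * Sums over a countable set as integrals *)

Section slices.
Context {R : realType}.

Lemma cintegral_indic d (T : measurableType d) (mu : {measure set T -> \bar R}) (A : set T) :
  measurable A -> (mu A < +oo)%E ->
  cintegrable mu (fun x => (\1_A x)%:C : R[i]) /\
  cintegral mu (fun x => (\1_A x)%:C) = (fine (mu A))%:C :> R[i].
Proof.
move=> mA Aoo; split.
  split => /=; last exact: integrable0.
  apply/integrableP; split; first by apply/measurable_EFinP; exact: measurable_indic.
  under eq_integral => x _ do rewrite gee0_abs ?lee_fin//.
  by rewrite integral_indic// setIT.
apply: complexP => /=; last by rewrite /Rintegral integral0.
by rewrite /Rintegral integral_indic// setIT.
Qed.

Lemma cmeasurable_slices d (T : measurableType d) (f : T * nat -> R[i]) :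
  (forall k, cmeasurable (fun x => f (x, k))) -> cmeasurable f.
Proof.
move=> mf.
have aux (u : T * nat -> R) : (forall k, measurable_fun setT (fun x => u (x, k))) ->
    measurable_fun setT u.
  move=> mu _ Y mY; rewrite setTI.
  have -> : u @^-1` Y = \bigcup_k ((fun x => u (x, k)) @^-1` Y `*` [set k]).
    apply/seteqP; split=> [[x k] /= h|[x k] [j _ [/= h ->]]//].
    by exists k.
  apply: bigcupT_measurable => k; apply: measurableX => //.
  by rewrite -[X in measurable X]setTI; exact: mu.
by split; apply: aux => k; have [] := mf k.
Qed.

End slices.

HB.instance Definition _ (R : realType) :=
  Measure_isSigmaFinite.Build _ _ R (@counting nat R) (sigma_finite_counting R).

Section countable_sums.
Context {R : realType} {I : countType}.
Local Notation cnt := (@counting nat R : {sigma_finite_measure set nat -> \bar R}).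
Implicit Types (a b : I -> R[i]).

Definition seqof a (k : nat) : R[i] := oapp a 0 (pickle_inv k).

(** As integrals against the counting measure of nat, through an enumeration
    padded with zeros, sums are subject to Fubini's theorem and to dominated
    convergence. *)
Definition isummable a : Prop := cintegrable cnt (seqof a).
Definition isum a : R[i] := cintegral cnt (seqof a).

Lemma cmeasurable_nat (f : nat -> R[i]) : cmeasurable f.
Proof. by split. Qed.

Lemma seqof_pickle a i : seqof a (pickle i) = a i.
Proof. by rewrite /seqof pickleK_inv. Qed.

Lemma integral_seqof (u : I -> R) : (forall i, 0 <= u i) ->
  (\int[cnt]_k (oapp u 0 (pickle_inv k))%:E = \esum_(i in [set: I]) (u i)%:E)%E.
Proof.
move=> u0.
have u0' k : (0 <= (oapp u 0 (pickle_inv k))%:E)%E.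
  by rewrite lee_fin; case: pickle_inv => /=.
rewrite ge0_integral_count// nneseries_esumT//.
have -> : (\esum_(k in [set: nat]) (oapp u 0 (pickle_inv k))%:E =
    \esum_(k in range (@pickle I)) (oapp u 0 (pickle_inv k))%:E)%E.
  rewrite [RHS]esum_mkcond; apply: eq_esum => k _.
  case: ifPn => // /negP nk; case e : (pickle_inv k) => [i|]//=.
  by exfalso; apply: nk; rewrite inE; exists i => //; have := @pickle_invK I k; rewrite e.
rewrite (reindex_esum [set: I] _ (@pickle I)).
- by apply: eq_esum => i _; rewrite pickleK_inv.
- split=> [i _||k [i _ <-]]; [by exists i| |by exists i].
  by move=> i j _ _; exact: (pcan_inj pickleK_inv).
Qed.

Lemma isummableP a : isummable a <-> (\esum_(i in [set: I]) (normc (a i))%:E < +oo)%E.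
Proof.
rewrite -integral_seqof; last by move=> i; exact: normc_ge0.
rewrite (_ : (fun k => _) = fun k => (normc (seqof a k))%:E); last first.
  by apply/funext => k; rewrite /seqof; case: pickle_inv => [i|] //; rewrite /oapp normc0.
exact/cintegrableP/cmeasurable_nat.
Qed.

Lemma Rintegral_seqof (u : I -> R) : cnt.-integrable setT (fun k => (oapp u 0 (pickle_inv k))%:E) ->
  \int[cnt]_k oapp u 0 (pickle_inv k) =
  fine (\esum_(i in [set: I]) (u^\+ i)%:E)%E - fine (\esum_(i in [set: I]) (u^\- i)%:E)%E.
Proof.
move=> iu; rewrite /Rintegral integralE fineB; last 2 first.
- exact: integrable_pos_fin_num.
- exact: integrable_neg_fin_num.
rewrite -!integral_seqof; last 2 first.
- by move=> i; rewrite funrneg_ge0.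
- by move=> i; rewrite funrpos_ge0.
congr (fine _ - fine _); apply: eq_integral => k _.
  rewrite funeposE; case: pickle_inv => [i|]; rewrite /oapp -EFin_max; congr EFin.
  exact: maxxx.
rewrite funenegE; case: pickle_inv => [i|]; rewrite /oapp -EFinN -EFin_max; congr EFin.
by rewrite oppr0 maxxx.
Qed.

Lemma esum_single (u : I -> \bar R) i : (0 <= u i)%E -> (forall j, j != i -> u j = 0%E) ->
  (\esum_(j in [set: I]) u j)%E = u i.
Proof.
move=> ui u0; rewrite -[RHS]esum_set1// [RHS]esum_mkcond; apply: eq_esum => j _.
by case: ifPn => // /negP ji; apply: u0; apply/negP => /eqP e; apply: ji; rewrite e inE.
Qed.

Lemma csum_isum (T : choiceType) (S : set T) (h : I -> T) (F : T -> R[i]) :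
  set_bij [set: I] S h -> isummable (F \o h) ->
  csummable S F /\ csum S F = isum (F \o h).
Proof.
move=> bh ih.
have re (v : T -> \bar R) : (forall l, 0 <= v l)%E ->
    (\esum_(l in S) v l = \esum_(i in [set: I]) v (h i))%E.
  by move=> v0; rewrite (reindex_esum [set: I] S h).
split.
  rewrite /csummable /summable.
  have -> : (fun l => `|(normc (F l))%:E|%E) = fun l => (normc (F l))%:E.
    by apply/funext => l; rewrite gee0_abs// lee_fin normc_ge0.
  rewrite re => [|l]; last by rewrite lee_fin normc_ge0.
  exact/isummableP.
have [ih1 ih2] := ih.
have s1 k : Re (seqof (F \o h) k) = oapp (fun i => Re (F (h i))) 0 (pickle_inv k).
  by rewrite /seqof; case: pickle_inv.
have s2 k : Im (seqof (F \o h) k) = oapp (fun i => Im (F (h i))) 0 (pickle_inv k).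
  by rewrite /seqof; case: pickle_inv.
apply: complexP; rewrite /csum /isum /cintegral /= /rsum.
  rewrite (eq_fun s1) Rintegral_seqof -?(eq_fun (fun k => congr1 EFin (s1 k)))//.
  by rewrite !re// => l; rewrite lee_fin ?funrpos_ge0 ?funrneg_ge0.
rewrite (eq_fun s2) Rintegral_seqof -?(eq_fun (fun k => congr1 EFin (s2 k)))//.
by rewrite !re// => l; rewrite lee_fin ?funrpos_ge0 ?funrneg_ge0.
Qed.

Lemma isum_single a i : (forall j, j != i -> a j = 0) -> isummable a /\ isum a = a i.
Proof.
move=> a0.
have mi : (@counting nat R [set pickle i] < +oo)%E.
  by rewrite /counting asboolT// ltry.
have c1 : @counting nat R [set pickle i] = 1%:E.
  by rewrite /counting asboolT// fset_set1 finmap.cardfs1.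
have [i1 e1] := @cintegral_indic R _ nat cnt [set pickle i] Logic.I mi.
have sE : seqof a = fun k => a i * (\1_[set pickle i] k)%:C.
  apply/funext => k; rewrite indicE; have [->|ki] := eqVneq k (pickle i).
    by rewrite seqof_pickle mem_set// mulr1.
  rewrite memNset; last by move=> /= /eqP; apply/negP.
  rewrite mulr0 /seqof; case e : (pickle_inv k) => [j|]//=; apply: a0.
  apply/negP => /eqP ji; move/negP: ki; apply; apply/eqP; rewrite -ji.
  by have := @pickle_invK I k; rewrite e.
split; first by rewrite /isummable sE; exact: cintegrableZl.
rewrite /isum sE cintegralZl// e1 (_ : fine _ = 1); first by rewrite mulr1.
exact: (congr1 fine c1).
Qed.

Lemma isummable_le a (u : I -> R) : isummable (fun i => (u i)%:C) ->
  (forall i, normc (a i) <= u i) -> isummable a.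
Proof.
move=> iu au; apply: (cintegrable_dom (cmeasurable_nat _) _ iu) => k.
rewrite /seqof; case: pickle_inv => [i|] //.
rewrite [leRHS](_ : _ = normc (u i)%:C)// normcC.
by rewrite ger0_norm ?au// (le_trans (normc_ge0 _) (au i)).
Qed.

Lemma normc_isum_le a (u : I -> R) : isummable (fun i => (u i)%:C) ->
  (forall i, normc (a i) <= u i) -> normc (isum a) <= Re (isum (fun i => (u i)%:C)).
Proof.
move=> iu au; have ia := isummable_le iu au.
apply: le_trans (normc_cintegral ia) _; rewrite /isum /cintegral /=.
apply: le_Rintegral => //; first exact: cintegrable_normc.
  exact: iu.1.
move=> k _; rewrite /seqof; case: pickle_inv => [i|]; [exact: au|by rewrite [X in normc X]/= normc0].
Qed.

Lemma isummableZl (c : R[i]) a : isummable a -> isummable (fun i => c * a i).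
Proof.
move=> ia; rewrite /isummable (_ : seqof _ = fun k => c * seqof a k).
  exact: cintegrableZl.
by apply/funext => k; rewrite /seqof; case: pickle_inv => //=; rewrite mulr0.
Qed.

Lemma isum_dominated (F : nat -> I -> R[i]) a (u : I -> R) : isummable (fun i => (u i)%:C) ->
  (forall n i, normc (F n i) <= u i) -> (forall i, cvgc (F^~ i) (a i)) ->
  cvgc (fun n => isum (F n)) (isum a).
Proof.
move=> iu Fu Fa.
apply: (cdominated_convergence (g := fun k => Re (seqof (fun i => (u i)%:C) k))) => //.
- apply: aeW => k; rewrite /seqof; case: pickle_inv => [i|]; first exact: Fa.
  exact: cvgc_cst.
- exact: iu.1.
- move=> n k; rewrite /seqof; case: pickle_inv => [i|]; first exact: Fu.
  by rewrite [X in normc X]/= normc0.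
Qed.

Lemma isumZl (c : R[i]) a : isummable a -> isum (fun i => c * a i) = c * isum a.
Proof.
move=> ia; rewrite /isum -cintegralZl//; congr cintegral; apply/funext => k.
by rewrite /seqof; case: pickle_inv => //=; rewrite mulr0.
Qed.

Section sum_integral.
Context {disp : measure_display} {T : measurableType disp}.
Variable m : {sigma_finite_measure set T -> \bar R}.
Implicit Types (F : I -> T -> R[i]).

Definition jsummable F : Prop :=
  cintegrable (m \x cnt)%E (fun p => seqof (fun i => F i p.1) p.2).

Lemma cmeasurable_seqof F : (forall i, cmeasurable (F i)) ->
  cmeasurable (fun p : T * nat => seqof (fun i => F i p.1) p.2).
Proof.
move=> mF; apply: cmeasurable_slices => k; rewrite /seqof /=.
by case: pickle_inv => [i|]/=; [exact: mF|exact: cmeasurable_cst].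
Qed.

Lemma cmeasurable_isum F : (forall i, cmeasurable (F i)) ->
  cmeasurable (fun x => isum (fun i => F i x)).
Proof. by move=> mF; exact: (cmeasurable_cintegral1 cnt (cmeasurable_seqof mF)). Qed.

Lemma seqof_cintegral F k :
  cintegral m (fun x => seqof (fun i => F i x) k) = seqof (fun i => cintegral m (F i)) k.
Proof. by rewrite /seqof; case: pickle_inv => //=; exact: cintegral0. Qed.

Lemma jsummable_cintegral F : jsummable F ->
  [/\ cintegrable m (fun x => isum (fun i => F i x)),
      isummable (fun i => cintegral m (F i)) &
      cintegral m (fun x => isum (fun i => F i x)) = isum (fun i => cintegral m (F i))].
Proof.
move=> jF; split; first exact: (cintegrable_cintegral1 jF).
  have := cintegrable_cintegral2 jF.
  by rewrite (_ : (fun y => _) = seqof (fun i => cintegral m (F i)))//;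
    apply/funext => k; exact: seqof_cintegral.
rewrite [LHS](cFubini jF); congr cintegral; apply/funext => k; exact: seqof_cintegral.
Qed.

(** At every point at most one term is non-zero, so that f dominates the sum of
    the moduli. *)
Lemma jsummable_disjoint (A : I -> set T) (f : T -> R[i]) : (forall i, measurable (A i)) ->
  (forall x i j, A i x -> A j x -> i = j) -> cintegrable m f ->
  jsummable (fun i x => (\1_(A i) x)%:C * f x).
Proof.
move=> mA dA imf; have mf := cintegrable_cmeasurable imf.
apply: cintegrable12.
  apply: (@cmeasurable_seqof (fun i x => (\1_(A i) x)%:C * f x)) => i.
  apply: cmeasurableM => //; by apply: cmeasurableC; exact: measurable_indic.
have foo := (cintegrableP m mf).1 imf; apply: le_lt_trans foo.
apply: ge0_le_integral => //.
- by move=> x _; apply: integral_ge0 => k _; rewrite lee_fin normc_ge0.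
- apply: (@measurable_fun_fubini_tonelli_F _ _ _ _ _ cnt
    (fun p => (normc (seqof (fun i => (\1_(A i) p.1)%:C * f p.1) p.2))%:E)).
    apply/measurable_EFinP; apply: cmeasurable_normc.
    apply: (@cmeasurable_seqof (fun i x => (\1_(A i) x)%:C * f x)) => i.
    by apply: cmeasurableM => //; apply: cmeasurableC; exact: measurable_indic.
  by move=> p; rewrite lee_fin normc_ge0.
- by apply/measurable_EFinP; exact: cmeasurable_normc.
move=> x _.
rewrite (_ : (fun k => _) = fun k =>
    (oapp (fun i => normc ((\1_(A i) x)%:C * f x)) 0 (pickle_inv k))%:E); last first.
  by apply/funext => k; rewrite /seqof; case: pickle_inv => [i|] //; rewrite /oapp normc0.
rewrite integral_seqof; last by move=> i; exact: normc_ge0.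
have [[i Ai]|nA] := pselect (exists i, A i x).
  rewrite (@esum_single _ i); last 2 first.
  - by rewrite lee_fin normc_ge0.
  - move=> j ji; rewrite indicE memNset ?mul0r ?normc0// => Aj.
    by move/eqP: ji; apply; exact: dA Aj Ai.
  by rewrite indicE mem_set// mul1r.
rewrite esum1 ?lee_fin ?normc_ge0// => i _.
by rewrite indicE memNset ?mul0r ?normc0// => Ai; apply: nA; exists i.
Qed.

Lemma jsummable_cmeasurable F i : jsummable F -> cmeasurable (F i).
Proof.
move=> /cintegrable_cmeasurable/(cmeasurable_pair2 (pickle i)).
by under eq_fun do rewrite seqof_pickle.
Qed.

(** The terms may be transported separately, since summability only depends on
    the integrals of their moduli. *)
Lemma jsummable_scaling F (S : I -> T -> T) : (forall i, scaling m 1 (S i)) ->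
  jsummable F -> jsummable (fun i x => F i (S i x)).
Proof.
move=> sS jF; have mF i := @jsummable_cmeasurable F i jF.
have mFS i : cmeasurable (fun x => F i (S i x)).
  by apply: cmeasurable_comp => //; have [] := sS i.
apply: cintegrable21; first exact: (@cmeasurable_seqof (fun i x => F i (S i x))).
have := (cintegrableP _ (cintegrable_cmeasurable jF)).1 jF.
rewrite fubini_tonelli2; last 2 first.
- by apply/measurable_EFinP; apply: cmeasurable_normc; exact: cmeasurable_seqof.
- by move=> p; rewrite lee_fin normc_ge0.
congr (_ < _)%E; apply: eq_integral => k _; rewrite /fubini_G /seqof /=.
case: pickle_inv => [i|] //=.
have [_ _ SE] := sS i.
rewrite (SE (fun x => (normc (F i x))%:E)) ?mul1e//.
  by apply/measurable_EFinP; exact: cmeasurable_normc.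
by move=> x; rewrite lee_fin normc_ge0.
Qed.

Lemma jsummable_prod (f : T -> R[i]) a (g : I -> T -> R[i]) (M : R) : cintegrable m f ->
  isummable a -> (forall i, cmeasurable (g i)) -> (forall i x, normc (g i x) <= M) ->
  jsummable (fun i x => f x * a i * g i x).
Proof.
move=> imf ia mg gM.
have := cintegrableMb (cintegrable_prod imf ia) (cmeasurable_seqof mg) (M := `|M|).
have -> : (fun p : T * nat => f p.1 * seqof a p.2 * seqof (fun i => g i p.1) p.2) =
    fun p => seqof (fun i => f p.1 * a i * g i p.1) p.2.
  by apply/funext => p; rewrite /seqof; case: pickle_inv => [i|] //=; rewrite !mulr0.
apply => p; rewrite /seqof; case: pickle_inv => [i|].
  exact: le_trans (gM i p.1) (ler_norm M).
by rewrite [X in normc X]/= normc0.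
Qed.

End sum_integral.

End countable_sums.

(** * Periodization over a lattice *)

Section periodization.
Context {R : realType} {d : nat}.
Local Notation time := 'rV[R]_d.
Local Notation phase := ('rV[R]_d * 'rV[R]_d)%type.
Local Notation pvol := (@phase_volume R d : {sigma_finite_measure set phase -> \bar R}).
Local Notation index := 'rV[int]_(d + d).

Definition pball (r : R) : set phase := [set z | `|z| <= r].

Let box (r : R) : set time := [set v | forall i, - r <= v 0 i <= r].

Let pballE r : 0 <= r -> pball r = box r `*` box r.
Proof.
move=> r0; apply/seteqP; split=> [[x w]|[x w] [/= hx hw]]; rewrite /pball /= prod_normE ge_max.
  by move=> /andP[xr wr]; split=> i /=; rewrite -ler_norml; apply: le_trans (le_rV_norm _ _) _.
by apply/andP; split; apply: rV_norm_le => // i; rewrite ler_norml.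
Qed.

Let measurable_box r : measurable (box r).
Proof.
apply: (@measurable_coords R d (fun _ => [set s | - r <= s <= r])) => i.
rewrite (_ : [set s | _] = `[- r, r]%classic); first exact: measurable_itv.
by apply/seteqP; split=> s /=; rewrite in_itv.
Qed.

Lemma measurable_pball r : 0 <= r -> measurable (pball r).
Proof. by move=> r0; rewrite pballE//; apply: measurableX; exact: measurable_box. Qed.

Lemma pvol_pball r : 0 <= r -> pvol (pball r) = ((2 * r) ^+ d * (2 * r) ^+ d)%:E.
Proof.
move=> r0; rewrite pballE// /= /phase_volume product_measure1E; try exact: measurable_box.
have vb : volume d (box r) = ((2 * r) ^+ d)%:E.
  have -> : box r = [set v | forall i, (const_mx (- r) : time) 0 i <= v 0 i <= (const_mx r : time) 0 i].
    by apply/seteqP; split=> v /= h i; have := h i; rewrite !mxE.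
  rewrite volume_box => [|i]; last by rewrite !mxE; lra.
  congr EFin; rewrite (eq_bigr (fun=> 2 * r)) => [|i _]; last by rewrite !mxE; lra.
  by rewrite prodr_const card_ord.
by rewrite EFinM; congr (_ * _)%E; exact: vb.
Qed.

(** The local suprema of U dominate its values by averages over small balls
    around the points of the family, and these balls are disjoint. *)
Lemma amalgam_sum (pt : index -> phase) U : spread pt -> amalgam U ->
  exists C, forall z0, exists T : index -> R, [/\ isummable (fun a => (T a)%:C),
    forall a z, `|z - z0| <= 2^-1 -> normc (U (z + pt a)) <= T a &
    forall F : index -> R[i], (forall a, normc (F a) <= T a) -> normc (isum F) <= C].
Proof.
move=> [r r0 rpt] [H [iH _ UH]].
have H0 z : 0 <= H z.
  by have := UH z 0; rewrite normr0 => /(_ ler01); apply: le_trans; exact: normc_ge0.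
pose q := Num.min (r / 3) 2^-1.
have q0 : 0 < q by rewrite lt_min invr_gt0 ltr0n andbT divr_gt0.
have q0' := ltW q0.
have qr : q <= r / 3 by rewrite ge_min lexx.
have q2 : q <= 2^-1 by rewrite ge_min lexx orbT.
pose vQ := (2 * q) ^+ d * (2 * q) ^+ d.
have vQ0 : 0 < vQ by rewrite mulr_gt0 ?exprn_gt0 ?mulr_gt0.
exists (vQ^-1 * \int[pvol]_z H z) => z0.
pose A a : set phase := (fun u => u + - (pt a + z0)) @^-1` pball q.
have mA a : measurable (A a).
  rewrite -[X in measurable X]setTI; have [_ mS _] := phase_shift (- (pt a + z0)).
  by apply: mS => //; exact: measurable_pball.
have dA u a b : A a u -> A b u -> a = b.
  move=> /= ua ub; apply/eqP/negPn/negP => /rpt; apply/negP; rewrite -ltNge.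
  have -> : pt a - pt b = (u - (pt b + z0)) - (u - (pt a + z0)).
    by rewrite opprB [RHS]addrC addrA subrK opprD addrACA subrr addr0.
  rewrite (le_lt_trans (ler_normB _ _))//.
  by have := lerD ub ua; rewrite /pball /=; lra.
have vA a : pvol (A a) = vQ%:E.
  rewrite (scaling_measure (phase_shift _)); last exact: measurable_pball.
  by rewrite mul1e; exact: pvol_pball.
have jS := jsummable_disjoint mA dA iH.
have [_ sG eG] := jsummable_cintegral jS.
pose G a := cintegral pvol (fun u => (\1_(A a) u)%:C * (H u)%:C).
have iG a : cintegrable pvol (fun u => (\1_(A a) u)%:C * (H u)%:C).
  have -> : (fun u => (\1_(A a) u)%:C * (H u)%:C) = fun u => (H u)%:C * (\1_(A a) u)%:C.
    by apply/funext => u; rewrite mulrC.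
  apply: (cintegrableMb iH (M := 1)).
    by apply: cmeasurableC; exact: measurable_indic.
  by move=> u; rewrite normcC indicE; case: (_ \in _); rewrite ?normr1 ?normr0.
have GE a : G a = (Re (G a))%:C.
  apply: complexP => //=; rewrite [LHS](_ : _ = \int[pvol]_x 0).
    by rewrite /Rintegral integral0.
  by congr Rintegral; apply/funext => u /=; rewrite mul0r mulr0 addr0.
have ReE a u : Re ((\1_(A a) u)%:C * (H u)%:C) = \1_(A a) u * H u.
  by rewrite /= mul0r subr0.
pose T a := vQ^-1 * Re (G a).
have TE a : (T a)%:C = (vQ^-1)%:C * G a by rewrite rmorphM/= -GE.
have sT : isummable (fun a => (T a)%:C).
  by under eq_fun do rewrite TE; exact: isummableZl.
exists T; split => // [a z zz0|F FT].
  rewrite /T -ler_pdivrMl ?invr_gt0// invrK mulrC.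
  set n := normc _.
  have Aoo : (pvol (A a) < +oo)%E by rewrite vA ltry.
  have [i1 e1] := cintegral_indic (mA a) Aoo.
  have -> : n * vQ = Re (cintegral pvol (fun u => n%:C * (\1_(A a) u)%:C)).
    rewrite cintegralZl// e1 (_ : fine _ = vQ); last exact: (congr1 fine (vA a)).
    by rewrite /= mul0r subr0.
  rewrite /G /cintegral /=; apply: le_Rintegral => //.
  - by have [] := cintegrableZl n%:C i1.
  - by have [] := iG a.
  - move=> u _; rewrite !mul0r !subr0 mulrC indicE.
    have [|] := boolP (u \in A a); last by rewrite !mul0r.
    rewrite inE => /= uA; rewrite !mul1r /n.
    have -> : z + pt a = u + (- (u - (pt a + z0)) + (z - z0)).
      by rewrite addrA subKr -addrA (addrC z0) subrK addrC.
    apply: UH; rewrite (le_trans (ler_normD _ _))// normrN.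
    by have := lerD uA zz0; lra.
apply: le_trans (normc_isum_le sT FT) _.
have -> : isum (fun a => (T a)%:C) = (vQ^-1)%:C * isum G.
  by under eq_fun do rewrite TE; rewrite isumZl.
rewrite [leLHS](_ : _ = vQ^-1 * Re (isum G)); last by rewrite ReImE /= mul0r subr0.
rewrite ler_pM2l ?invr_gt0//.
rewrite (esym eG : isum G = _); apply: le_trans (ler_norm _) _; apply: le_trans (ler_Re_normc _) _.
have [iS _ _] := jsummable_cintegral jS.
apply: le_trans (normc_cintegral iS) _; apply: le_Rintegral => //.
- exact: cintegrable_normc.
- exact: iH.1.
move=> u _.
have [[a Aa]|nA] := pselect (exists a, A a u).
  have [|_ ->] := @isum_single R index (fun a => (\1_(A a) u)%:C * (H u)%:C) a.
    move=> b ba; rewrite indicE memNset ?mul0r// => Ab.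
    by move/eqP: ba; apply; exact: dA Ab Aa.
  by rewrite indicE mem_set// mul1r normcC ger0_norm.
have A0 b : (\1_(A b) u)%:C * (H u)%:C = 0.
  by rewrite indicE memNset ?mul0r// => Ab; apply: nA; exists b.
have [_ ->] := @isum_single R index (fun a => (\1_(A a) u)%:C * (H u)%:C) 0 (fun b _ => A0 b).
by rewrite A0 normc0.
Qed.

Section domains.
Variables (B : 'M[R]_(d + d)) (uB : B \in unitmx).
Local Notation lam a := (ofcoords B (intv a) : phase).

(** Fundamental domains, with the lattice points indexed by integer vectors so
    as to sum over them. *)
Definition fdom (D : set phase) : Prop :=
  measurable D /\ forall z, exists! a : index, D (z - lam a).

Lemma fdom_isum D z (h : index -> R[i]) : fdom D -> exists a, D (z - lam a) /\
  isum (fun b => (\1_D (z - lam b))%:C * h b) = h a.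
Proof.
move=> [_ /(_ z)[a [Da ua]]]; exists a; split => //.
have [|_ ->] := @isum_single R index (fun b => (\1_D (z - lam b))%:C * h b) a.
  by move=> b ba; rewrite indicE memNset ?mul0r// => /ua ab; rewrite ab eqxx in ba.
by rewrite indicE mem_set// mul1r.
Qed.

Lemma lamN a : lam (- a) = - lam a.
Proof.
have lB b c : lam (b - c) = lam b - lam c by rewrite intvB ofcoordsB.
by rewrite -(sub0r a) lB -{1}(subrr 0) lB subrr sub0r.
Qed.

Lemma fdom_isumD D z (h : index -> R[i]) : fdom D -> exists a, D (z + lam a) /\
  isum (fun b => (\1_D (z + lam b))%:C * h b) = h a.
Proof.
move=> [_ /(_ z)[a [Da ua]]]; exists (- a); rewrite lamN; split => //.
have [|_ ->] := @isum_single R index (fun b => (\1_D (z + lam b))%:C * h b) (- a).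
  move=> b ba; rewrite indicE memNset ?mul0r// => Db.
  have /ua ab : D (z - lam (- b)) by rewrite lamN opprK.
  by rewrite ab opprK eqxx in ba.
by rewrite indicE mem_set ?mul1r// lamN.
Qed.

(** Cut phase space into the translates of D. *)
Lemma unfolding D (F : phase -> R[i]) : fdom D -> cintegrable pvol F ->
  let G a z := (\1_D z)%:C * F (z + lam a) in
  jsummable pvol G /\ cintegral pvol F = cintegral pvol (fun z => isum (fun a => G a z)).
Proof.
move=> fD iF G; have [mD uD] := fD.
pose A a : set phase := (fun z => z + - lam a) @^-1` D.
have mA a : measurable (A a).
  rewrite -[X in measurable X]setTI; have [_ mS _] := phase_shift (- lam a).
  exact: mS.
have dA z a b : A a z -> A b z -> a = b.
  by have [c [_ uc]] := uD z; move=> /uc <- /uc <-.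
have AE a z : \1_(A a) (z + lam a) = \1_D z :> R.
  rewrite !indicE; congr ((_ : bool)%:R).
  by apply/idP/idP; rewrite !inE /A /= addrK.
have A1 a z : \1_(A a) z = \1_D (z - lam a) :> R.
  by rewrite !indicE; congr ((_ : bool)%:R); apply/idP/idP; rewrite !inE.
have jA := jsummable_disjoint mA dA iF.
have sS a := phase_shift (lam a).
have jG : jsummable pvol G.
  have := jsummable_scaling sS jA; congr (jsummable pvol _).
  by apply/funext => a; apply/funext => z; rewrite /G AE.
split => //.
have [_ _ e1] := jsummable_cintegral jA; have [_ _ e2] := jsummable_cintegral jG.
rewrite e2; transitivity (isum (fun a => cintegral pvol (fun z => (\1_(A a) z)%:C * F z))).
  rewrite -e1; congr cintegral; apply/funext => z.
  have [a [_ e]] := fdom_isum z (fun=> F z) fD.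
  transitivity (isum (fun b => (\1_D (z - lam b))%:C * F z)); first by rewrite e.
  by congr isum; apply/funext => b; rewrite A1.
congr isum; apply/funext => a.
rewrite -[LHS]mul1r -(cintegral_scaling (sS a) (jsummable_cmeasurable a jA)).
by congr cintegral; apply/funext => z; rewrite /G AE.
Qed.

(** Unfold the indicator function of one domain over the other. *)
Lemma fdom_measure D D' : fdom D -> fdom D' -> (pvol D < +oo)%E ->
  fine (pvol D') = fine (pvol D).
Proof.
move=> fD fD' Doo; have [mD _] := fD; have [mD' _] := fD'.
have [iD eD] := cintegral_indic mD Doo.
have [jG e] := unfolding fD' iD.
have [iS _ _] := jsummable_cintegral jG.
have E : (fun z => isum (fun a => (\1_D' z)%:C * (\1_D (z + lam a))%:C)) =
    fun z => (\1_D' z)%:C :> R[i].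
  apply/funext => z; under eq_fun do rewrite mulrC.
  by have [a [_ ->]] := fdom_isumD z (fun=> (\1_D' z)%:C) fD.
rewrite E in iS e; rewrite eD in e.
have D'oo : (pvol D' < +oo)%E.
  have [/integrableP[_ +] _] := iS; apply: le_lt_trans.
  rewrite -[X in pvol X]setIT -integral_indic//; apply: ge0_le_integral => //.
  - by apply/measurable_EFinP; exact: measurable_indic.
  - by apply: measurableT_comp => //; apply/measurable_EFinP; exact: measurable_indic.
  - by move=> z _ /=; rewrite lee_fin ler_norm.
have [_ eD'] := cintegral_indic mD' D'oo.
by move: e; rewrite eD' => -[].
Qed.

Definition cell : set phase := [set z | forall i, - 2^-1 <= coords B z 0 i < 2^-1].

Lemma measurable_coords_phase : measurable_fun setT (coords B : phase -> 'rV[R]_(d + d)).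
Proof.
apply/measurable_fun_rVP => i; rewrite /coords.
under eq_fun do rewrite mxE.
apply: measurable_sum => j; apply: measurable_funM; last exact: measurable_cst.
rewrite /flat; case: (split_ordP j) => k ->.
  under eq_fun do rewrite row_mxEl.
  apply: (measurableT_comp (measurable_coord_rV k)); exact: measurable_fst.
under eq_fun do rewrite row_mxEr.
apply: (measurableT_comp (measurable_coord_rV k)); exact: measurable_snd.
Qed.

Lemma fdom_cell : fdom cell.
Proof.
split.
  rewrite -[X in measurable X]setTI.
  apply: (measurable_coords_phase measurableT (Y := [set v | forall i, - 2^-1 <= v 0 i < 2^-1])).
  apply: (@measurable_coords R _ (fun _ => [set s | - 2^-1 <= s < 2^-1])) => i.
  rewrite (_ : [set s | _] = `[- 2^-1, 2^-1[%classic); first exact: measurable_itv.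
  by apply/seteqP; split=> s /=; rewrite in_itv.
move=> z; exists (\row_i Num.floor (coords B z 0 i + 2^-1)).
have cE a i : coords B (z - lam a) 0 i = coords B z 0 i - (a 0 i)%:~R.
  by rewrite coordsB ofcoordsK// mxE; congr (_ + _); rewrite 2!mxE.
split=> [i|a Da].
  rewrite cE mxE; set s := coords B z 0 i.
  have := floor_le_tmp (s + 2^-1); have := floorD1_gt (s + 2^-1); rewrite intrD.
  by move=> h1 h2; apply/andP; split; lra.
apply/rowP => i; rewrite mxE; have := Da i; rewrite cE => /andP[h1 h2].
by apply: floor_def; rewrite intrD; apply/andP; split; lra.
Qed.

Lemma coords_le z i : `|coords B z 0 i| <= `|z| * mxsum (invmx B).
Proof.
rewrite -norm_flat; apply: le_trans (le_rV_norm _ _) _.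
by apply: norm_mulmx_le => j; exact: le_rV_norm.
Qed.

Lemma norm_le_coords z (e : R) : (forall i, `|coords B z 0 i| <= e) -> `|z| <= e * mxsum B.
Proof.
by move=> ze; rewrite -norm_flat -{1}(coordsK uB z) /ofcoords unflatK; exact: norm_mulmx_le.
Qed.

Lemma cell_sub_pball : cell `<=` pball (2^-1 * mxsum B).
Proof.
move=> z zD; apply: norm_le_coords => i; have /andP[h1 h2] := zD i.
by rewrite ler_norml h1 ltW.
Qed.

Lemma pball_sub_cell : exists2 e : R, 0 < e & pball e `<=` cell.
Proof.
exists (3^-1 / (mxsum (invmx B) + 1)).
  by rewrite divr_gt0 ?invr_gt0 ?ltr_wpDl ?mxsum_ge0.
move=> z; rewrite /pball /= ler_pdivlMr ?ltr_wpDl ?mxsum_ge0// mulrDr mulr1 => h i.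
have := coords_le z i; rewrite ler_norml => /andP[h1 h2]; have := normr_ge0 z.
by move=> h3; apply/andP; split; lra.
Qed.

Lemma pvol_cell : (pvol cell < +oo)%E /\ 0 < fine (pvol cell).
Proof.
have [mD _] := fdom_cell.
have m0 : 0 <= 2^-1 * mxsum B :> R by rewrite mulr_ge0 ?mxsum_ge0.
have Doo : (pvol cell < +oo)%E.
  apply: (@le_lt_trans _ _ (pvol (pball (2^-1 * mxsum B)))).
    by apply: le_measure; rewrite ?inE//; [exact: measurable_pball|exact: cell_sub_pball].
  by rewrite pvol_pball// ltry.
split=> //; have [e e0 De] := pball_sub_cell.
have : (pvol (pball e) <= pvol cell)%E.
  by apply: le_measure; rewrite ?inE//; apply: measurable_pball; exact: ltW.
rewrite pvol_pball ?(ltW e0)// => h.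
rewrite -lte_fin fineK; last by rewrite ge0_fin_numE.
by apply: lt_le_trans h; rewrite lte_fin mulr_gt0 ?exprn_gt0 ?mulr_gt0.
Qed.

End domains.

End periodization.

(** * Poisson summation *)

Section poisson.
Context {R : realType} {d : nat}.
Local Notation phase := ('rV[R]_d * 'rV[R]_d)%type.
Local Notation pvol := (@phase_volume R d : {sigma_finite_measure set phase -> \bar R}).
Local Notation index := 'rV[int]_(d + d).
Variables (B : 'M[R]_(d + d)) (uB : B \in unitmx).
Local Notation lam a := (ofcoords B (intv a) : phase).
Local Notation D := (cell B : set phase).
Implicit Types (W F : phase -> R[i]) (a b : index) (z : phase).

Definition chi a z : R[i] := cis2pi (dot (coords B z) (intv a)).

Lemma coordsD z w : coords B (z + w) = coords B z + coords B w.
Proof. by rewrite /coords /flat -mulmxDl add_row_mx. Qed.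

Lemma intvD n (a b : 'rV[int]_n) : intv (a + b) = intv a + intv b :> 'rV[R]_n.
Proof. exact: map_mxD. Qed.

Lemma chiD a b z : chi (a + b) z = chi a z * chi b z.
Proof. by rewrite /chi intvD dotDr cis2piD. Qed.

Lemma chi0 z : chi 0 z = 1.
Proof. by rewrite /chi (_ : intv 0 = 0) ?dot0r ?cis2pi0//; apply/rowP => i; rewrite !mxE. Qed.

Lemma chiB a b z : chi (a - b) z = chi a z * (chi b z)^*.
Proof. by rewrite /chi intvB dotBr cis2piD cis2piN. Qed.

Lemma chi_translate a z w : chi a (z + w) = chi a z * chi a w.
Proof. by rewrite /chi coordsD dotDl cis2piD. Qed.

Lemma chi_lattice a b : chi a (lam b) = 1.
Proof.
rewrite /chi ofcoordsK//.
rewrite (_ : dot _ _ = (\sum_i b 0 i * a 0 i)%:~R) ?cis2pi_int//.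
by rewrite rmorph_sum; apply: eq_bigr => i _; rewrite !mxE rmorphM.
Qed.

Lemma normc_chi a z : normc (chi a z) = 1. Proof. exact: normc_cis2pi. Qed.

Lemma normc_chi_le1 a z : normc (chi a z) <= 1. Proof. by rewrite normc_chi. Qed.

Lemma cmeasurable_chi a : cmeasurable (chi a).
Proof.
apply: cmeasurable_cis2pi; apply: measurable_dot; last exact: measurable_cst.
exact: measurable_coords_phase.
Qed.

Definition vcell : R := fine (pvol D).

Lemma vcell_gt0 : 0 < vcell. Proof. by have [] := pvol_cell uB. Qed.

Lemma cintegrable_cell W (M : R) : cmeasurable W -> (forall z, normc (W z) <= M) ->
  cintegrable pvol (fun z => (\1_D z)%:C * W z).
Proof.
move=> mW WM; have [mD _] := fdom_cell uB; have [Doo _] := pvol_cell uB.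
exact: (cintegrableMb (cintegral_indic mD Doo).1 mW WM).
Qed.

(** The cell may be replaced by any of its translates, and translation by half a
    period changes the sign of the character. *)
Lemma cell_chi a : cintegral pvol (fun z => (\1_D z)%:C * chi a z) =
  if a == 0 then vcell%:C else 0.
Proof.
have fD := fdom_cell uB; have [mD _] := fD; have [Doo _] := pvol_cell uB.
have [->|a0] := eqVneq.
  under eq_fun do rewrite chi0 mulr1.
  by have [_ ->] := cintegral_indic mD Doo.
have [i ai] : exists i, a 0 i != 0.
  apply: contrapT => /forallNP h; move/negP: a0; apply; apply/eqP/rowP => i.
  by rewrite [RHS]mxE; apply/eqP/negPn/negP/h.
pose w : phase := ofcoords B ((2 * (a 0 i)%:~R)^-1 *: delta_mx 0 i).
have chiw : chi a w = - 1.
  rewrite /chi ofcoordsK// dotZl (_ : dot _ _ = (a 0 i)%:~R); last first.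
    rewrite /dot (bigD1 i)//= big1 ?addr0 => [|j ji].
      by rewrite !mxE !eqxx mul1r.
    by rewrite !mxE eqxx (negbTE ji) mul0r.
  rewrite invfM -mulrA mulVf ?intr_eq0// mulr1.
  apply: complexP; rewrite /cis2pi /= (_ : 2 * pi * 2^-1 = pi) ?cospi ?sinpi//; by field.
set J := cintegral _ _.
have iJ := cintegrable_cell (@cmeasurable_chi a) (fun z => normc_chi_le1 a z).
have sw := phase_shift (- w).
have iF := cintegrable_scaling (phase_shift (- w)) (cintegrableMb (cintegral_indic mD Doo).1
  (g := fun z => chi a (z + w)) (M := 1) (cmeasurable_comp (@cmeasurable_chi a) (let: And3 _ m _ := phase_shift w in m))
  (fun z => normc_chi_le1 a (z + w))).
have [_ e] := unfolding fD iF.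
have JN : J = - J.
  have Je : J = cintegral pvol (fun z => isum (fun b =>
      (\1_D z)%:C * ((\1_D (z + lam b - w))%:C * chi a (z + lam b - w + w)))).
    congr cintegral; apply/funext => z.
    have [b [_ E]] := fdom_isumD uB (z - w) (fun=> (\1_D z)%:C * chi a z) fD.
    rewrite -[LHS]E; congr isum; apply/funext => b'.
    rewrite subrK chi_translate chi_lattice mulr1 (addrAC z) mulrCA //.
  rewrite {1}Je -e (cintegral_scaling sw (f := fun z => (\1_D z)%:C * chi a (z + w))); last first.
    apply: cmeasurableM; first by apply: cmeasurableC; exact: measurable_indic.
    apply: (cmeasurable_comp (@cmeasurable_chi a)); by have [] := phase_shift w.
  rewrite mul1r /J -cintegralN//; congr cintegral; apply/funext => z.
  by rewrite chi_translate chiw mulrN1 mulrN.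
by move/eqP: JN; rewrite -addr_eq0 -mulr2n -mulr_natl mulf_eq0 pnatr_eq0 /= => /eqP.
Qed.

(** Orthogonality over the cell to all characters of phase space modulo the
    lattice. *)
Definition orth W : Prop := [/\ cmeasurable W, exists M, forall z, normc (W z) <= M &
  forall a, cintegral pvol (fun z => (\1_D z)%:C * (W z * chi a z)) = 0].

(** A trigonometric polynomial with values between 0 and 1, equal to 1 at the
    integers only. *)
Definition tau (s : R) : R := (1 + cos (2 * pi * s)) / 2.

Lemma tau_ge0 s : 0 <= tau s.
Proof. by rewrite /tau divr_ge0// -(opprK 1) addrC subr_ge0 cos_geN1. Qed.

Lemma tau_le1 s : tau s <= 1.
Proof. by rewrite /tau; have := cos_le1 (2 * pi * s); lra. Qed.

Lemma tau_cis s (x : R[i]) : (tau s)%:C * x =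
  (2^-1)%:C * x + (4^-1)%:C * (x * cis2pi s) + (4^-1)%:C * (x * cis2pi (- s)).
Proof.
by apply: complexP; rewrite !ReImE /cis2pi /= mulrN cosN sinN /tau; field.
Qed.

(** Multiplication by tau combines neighbouring Fourier coefficients. *)
Lemma orth_tau W i : orth W -> orth (fun z => W z * (tau (coords B z 0 i))%:C).
Proof.
move=> [mW [M WM] oW].
have mt : cmeasurable (fun z => (tau (coords B z 0 i))%:C).
  apply: cmeasurableC; apply: measurable_funM; last exact: measurable_cst.
  apply: measurable_funD; first exact: measurable_cst.
  apply: (measurableT_comp (continuous_measurable_fun (@continuous_cos R))).
  apply: measurable_funM; first exact: measurable_cst.
  exact: (measurableT_comp (measurable_coord_rV i) (@measurable_coords_phase R d B)).
split; first exact: cmeasurableM.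
  exists M => z; rewrite normcM normcC ger0_norm ?tau_ge0//.
  by rewrite (le_trans _ (WM z))// ler_piMr ?normc_ge0// tau_le1.
move=> a; pose e : index := delta_mx 0 i.
have chie z : chi e z = cis2pi (coords B z 0 i).
  rewrite /chi; congr cis2pi; rewrite /dot (bigD1 i)//= big1 ?addr0 => [|j ji].
    by rewrite !mxE !eqxx mulr1.
  by rewrite !mxE eqxx (negbTE ji) mulr0.
have iW b : cintegrable pvol (fun z => (\1_D z)%:C * (W z * chi b z)).
  apply: (cintegrable_cell (M := M)); first by apply: cmeasurableM => //; exact: cmeasurable_chi.
  by move=> z; rewrite normcM normc_chi mulr1.
rewrite [X in cintegral _ X](_ : _ = fun z => (2^-1)%:C * ((\1_D z)%:C * (W z * chi a z)) +
    ((4^-1)%:C * ((\1_D z)%:C * (W z * chi (a + e) z)) +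
     (4^-1)%:C * ((\1_D z)%:C * (W z * chi (a - e) z)))); last first.
  apply/funext => z; rewrite chiB chiD chie -cis2piN.
  rewrite (_ : (\1_D z)%:C * _ = (tau (coords B z 0 i))%:C * ((\1_D z)%:C * (W z * chi a z))).
    by rewrite tau_cis; ring.
  by ring.
rewrite cintegralD; [|exact: cintegrableZl|]; last by apply: cintegrableD; exact: cintegrableZl.
rewrite cintegralD; try exact: cintegrableZl.
by rewrite !cintegralZl// !oW !mulr0 !addr0.
Qed.

Definition kern z : R := \prod_i tau (coords B z 0 i).

Lemma kern_ge0 z : 0 <= kern z.
Proof. by apply: prodr_ge0 => i _; exact: tau_ge0. Qed.

Lemma orth_kern W N : orth W -> orth (fun z => W z * (kern z ^+ N)%:C).
Proof.
have prod V : orth V -> orth (fun z => V z * (kern z)%:C).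
  move=> oV; rewrite /kern.
  suff : forall s : seq 'I_(d + d), orth (fun z => V z * (\prod_(i <- s) tau (coords B z 0 i))%:C).
    by apply.
  elim=> [|i s IH]; first by under eq_fun do rewrite big_nil mulr1.
  under eq_fun do rewrite big_cons mulrC rmorphM/= mulrAC -mulrA mulrC.
  by have := orth_tau i IH; congr orth; apply/funext => z; ring.
move=> oW; elim: N => [|N IH]; first by under eq_fun do rewrite expr0 mulr1.
have := prod _ IH; congr orth; apply/funext => z.
by rewrite exprSr rmorphM/= mulrA.
Qed.

Definition cont0 W : Prop := forall e : R, 0 < e -> exists2 r : R, 0 < r &
  forall z, `|z| <= r -> normc (W z - W 0) <= e.

Lemma sequential_cont0 W : (forall u : nat -> phase, (forall k, `|u k| <= 2^-1) ->
    `|u k| @[k --> \oo] --> (0 : R) -> cvgc (W \o u) (W 0)) -> cont0 W.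
Proof.
move=> sW e e0; apply: contrapT => nr.
have ex (k : nat) : exists z, `|z| <= k.+2%:R^-1 /\ e < normc (W z - W 0).
  apply: contrapT => /forallNP h; apply: nr; exists k.+2%:R^-1; first by rewrite invr_gt0.
  move=> z zk; rewrite leNgt; apply/negP => ez; exact: (h z).
have [u hu] := choice ex.
have /cvgc_normcB/cvgrPdist_lt/(_ e e0) : cvgc (W \o u) (W 0).
  apply: sW => [k|].
    have [+ _] := hu k; move/le_trans; apply.
    by rewrite lef_pV2 ?posrE// ler_nat.
  apply: (@squeeze_cvgr _ _ _ _ (fun=> 0) (fun k => k.+1%:R^-1)).
  - near=> k; rewrite normr_ge0/=; have [+ _] := hu k; move/le_trans; apply.
    by rewrite lef_pV2 ?posrE// ler_nat.
  - exact: cvg_cst.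
  - exact: cvg_harmonic.
case=> N _ /(_ N (leqnn N)) /=.
rewrite sub0r normrN ger0_norm ?normc_ge0// ltNge => /negP; apply.
by have [_ /ltW] := hu N.
Unshelve. all: by end_near.
Qed.

Lemma cvgv_coords (u : nat -> phase) : `|u k| @[k --> \oo] --> (0 : R) ->
  cvgv (fun k => coords B (u k)) (0 : 'rV[R]_(d + d)).
Proof.
move=> u0; apply: (cvgv_norm (s := fun k => `|u k| * mxsum (invmx B))) => [k|].
  by apply: rV_norm_le => [|i]; [rewrite mulr_ge0 ?mxsum_ge0|exact: coords_le].
by rewrite -(mul0r (mxsum (invmx B))); apply: cvgM => //; exact: cvg_cst.
Qed.

Lemma kern_cont0 : cont0 (fun z => (kern z)%:C).
Proof.
apply: sequential_cont0 => u _ /cvgv_coords u0.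
pose f (i : 'I_(d + d)) (v : 'rV[R]_(d + d)) : R[i] := (tau (v 0 i))%:C.
have kE z : (kern z)%:C = \prod_(i <- index_enum _) f i (coords B z).
  by rewrite /kern rmorph_prod.
have c00 : coords B 0 = 0 by rewrite -(subrr 0) coordsB subrr.
rewrite (_ : _ \o _ = fun k => \prod_(i <- index_enum _) f i (coords B (u k))); last first.
  by apply/funext => k /=; exact: kE.
rewrite kE c00.
apply: (@seqcont_prod R (d + d) _ _ f) => // i w v wv; apply: cvgc_real.
apply: cvgM; last exact: cvg_cst; apply: cvgD; first exact: cvg_cst.
apply: (continuous_cvg _ (@continuous_cos R _)); apply: cvgM; first exact: cvg_cst.
exact: wv.
Qed.

Lemma kern_away (r : R) : 0 < r ->
  exists2 q, 0 <= q < 1 & forall z, D z -> r < `|z| -> kern z <= q.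
Proof.
move=> r0; pose s := Num.min (r / (mxsum B + 1)) 2^-1.
have B0 : 0 < mxsum B + 1 by rewrite ltr_wpDl ?mxsum_ge0.
have s0 : 0 < s by rewrite lt_min invr_gt0 ltr0n andbT divr_gt0.
have s2 : s <= 2^-1 by rewrite ge_min lexx orbT.
have tauN (t : R) : tau `|t| = tau t.
  by rewrite /tau; have [t0|t0] := leP 0 t; rewrite ?(ger0_norm t0)// (ltr0_norm t0) mulrN cosN.
have p0 := @pi_gt0 R.
have bnd (t : R) : 0 <= t <= 2^-1 -> 0 <= 2 * pi * t <= pi.
  move=> /andP[t0 t1]; rewrite !mulr_ge0 ?pi_ge0//= mulrC mulrA -[leRHS]mul1r ler_pM2r//.
  by rewrite -ler_pdivlMr// mul1r.
exists (tau s).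
  rewrite tau_ge0/= /tau ltr_pdivrMr// mul1r -ltrBrDl.
  rewrite [ltRHS](_ : _ = cos 0); last by rewrite cos0; ring.
  rewrite ltr_cos ?in_itv/= ?lexx ?pi_ge0 ?bnd ?(ltW s0)//.
  by rewrite !mulr_gt0.
move=> z Dz rz.
have [i si] : exists i, s <= `|coords B z 0 i|.
  apply: contrapT => /forallNP h; have : `|z| <= s * mxsum B.
    by apply: norm_le_coords => // i; rewrite leNgt; apply/negP => /ltW; exact: h.
  apply/negP; rewrite -ltNge; apply: le_lt_trans rz.
  rewrite (@le_trans _ _ (r / (mxsum B + 1) * mxsum B))//.
    by rewrite ler_wpM2r ?mxsum_ge0// ge_min lexx.
  rewrite -mulrA ler_piMr ?(ltW r0)// mulrC ler_pdivrMr// mul1r lerDl//.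
apply: (@le_trans _ _ (tau (coords B z 0 i))).
  rewrite /kern (bigD1 i)//= ler_piMr ?tau_ge0//.
  by apply: prodr_ile1 => j _; rewrite tau_ge0 tau_le1.
have c2 : `|coords B z 0 i| <= 2^-1.
  by have /andP[h1 h2] := Dz i; rewrite ler_norml h1 ltW.
rewrite -tauN /tau ler_pM2r ?invr_gt0// lerD2l.
move: si; rewrite le_eqVlt => /predU1P[<-//|si]; apply/ltW.
rewrite ltr_cos ?in_itv/= ?bnd ?(ltW s0) ?normr_ge0//.
by rewrite ltr_pM2l ?mulr_gt0.
Qed.

(** The powers of the trigonometric polynomial [kern] concentrate at the
    origin of the cell, where it has its only maximum: tested against them, a
    function with zero coefficients sees its value at 0. *)
Lemma orth_eq0 W : orth W -> cont0 W -> W 0 = 0.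
Proof.
move=> oW cW; apply: contrapT => W0.
have [mW [M WM] _] := oW.
pose w := normc (W 0).
have w0 : 0 < w.
  by rewrite lt0r normc_ge0 andbT; apply/negP => /eqP/normc_eq0.
have [mD _] := fdom_cell uB; have [Doo _] := pvol_cell uB.
pose h z := Re ((W 0)^* * W z).
have hM z : `|h z| <= w * M.
  apply: le_trans (ler_Re_normc _) _; rewrite normcM normc_conj.
  by rewrite ler_wpM2l ?normc_ge0.
have M0 : 0 <= w * M by apply: le_trans (hM 0).
have w2 : 0 < w / 2 by rewrite divr_gt0.
have [r r0 Wr] := cW _ w2.
pose a0 := w ^+ 2 / 2; have a00 : 0 < a0 by rewrite divr_gt0 ?exprn_gt0.
have hr z : `|z| <= r -> a0 <= h z.
  move=> /Wr zr; have -> : h z = w ^+ 2 + Re ((W 0)^* * (W z - W 0)).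
    have e : (W 0)^* * W z = (w ^+ 2)%:C + (W 0)^* * (W z - W 0).
      by rewrite mulrBr (mulrC _ (W 0)) mulcJ addrC subrK.
    by rewrite /h e; case: (_ * _).
  have h1 : `|Re ((W 0)^* * (W z - W 0))| <= w * normc (W z - W 0).
    by apply: le_trans (ler_Re_normc _) _; rewrite normcM normc_conj.
  have := le_trans h1 (ler_wpM2l (ltW w0) zr); rewrite ler_norml => /andP[h2 _].
  rewrite /a0; have -> : w ^+ 2 / 2 = w ^+ 2 - w * (w / 2) by field.
  by rewrite lerD2l.
have [q /andP[q0 q1] kq] := kern_away r0.
pose p := (1 + q) / 2.
have qp : q < p by rewrite /p; lra.
have p1 : 0 < 1 - p by rewrite /p; lra.
have [r' r'0 kr'] := kern_cont0 p1.
have kern0 : kern 0 = 1.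
  by rewrite /kern big1// => i _; rewrite -(subrr 0) coordsB subrr mxE /tau mulr0 cos0; field.
have kp z : `|z| <= r' -> p <= kern z.
  move=> /kr'; rewrite (_ : _ - _ = (kern z - kern 0)%:C); last by rewrite rmorphB.
  rewrite normcC kern0 ler_norml => /andP[+ _]; lra.
have [e e0 eD] := pball_sub_cell B.
pose c := Num.min r (Num.min r' e).
have c0 : 0 < c by rewrite !lt_min r0 r'0 e0.
have cE z : `|z| <= c -> [/\ `|z| <= r, `|z| <= r' & D z].
  by rewrite /c !le_min => /and3P[h1 h2 h3]; split => //; exact: eD.
pose vc := fine (pvol (pball c)).
have vcE : pvol (pball c) = ((2 * c) ^+ d * (2 * c) ^+ d)%:E by apply: pvol_pball; exact: ltW.
have vc0 : 0 < vc.
  by rewrite /vc [X in fine X]vcE /= mulr_gt0 ?exprn_gt0 ?mulr_gt0.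
have mc : measurable (pball c : set phase) by apply: measurable_pball; exact: ltW.
have coo : (pvol (pball c) < +oo)%E by rewrite [X in (X < _)%E]vcE ltry.
(* On the ball of radius c the integrand is at least a0 p^N; it is nonnegative
   where |z| <= r, and at least - w M q^N elsewhere. *)
have key N : a0 * vc * p ^+ N <= w * M * vcell * q ^+ N.
  have [mK [MK WK] oK] := orth_kern N oW.
  have iK := cintegrable_cell mK WK.
  have e1 : \int[pvol]_z (\1_D z * h z * kern z ^+ N) = 0.
    have := oK 0; under eq_fun do rewrite chi0 mulr1.
    move=> /(congr1 (fun x => Re ((W 0)^* * x))).
    rewrite mulr0 -cintegralZl//= => <-; congr Rintegral; apply/funext => z.
    by rewrite /h /= !ReImE /=; ring.
  have [ic ec] := cintegral_indic mc coo; have [iD eD'] := cintegral_indic mD Doo.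
  have i2 := cintegrableD (cintegrableZl (a0 * p ^+ N)%:C ic)
    (cintegrableZl (- (w * M * q ^+ N))%:C iD).
  have e2 := cintegralD (cintegrableZl (a0 * p ^+ N)%:C ic)
    (cintegrableZl (- (w * M * q ^+ N))%:C iD).
  rewrite !cintegralZl// ec eD' in e2.
  have : Re ((a0 * p ^+ N)%:C * vc%:C + (- (w * M * q ^+ N))%:C * vcell%:C) <= 0.
    rewrite -e2 -e1 /cintegral /=; apply: le_Rintegral => //.
    - exact: i2.1.
    - have [+ _] := cintegrableZl (W 0)^* iK.
      congr (integrable _ _ _); apply/funext => z; congr EFin.
      by rewrite /h !ReImE /=; ring.
    - move=> z _; rewrite !mul0r !subr0 !indicE.
      have [|zc] := boolP (z \in (pball c : set phase)).
        rewrite inE => /cE[z1 z2 z3]; rewrite mem_set// mulr1n !mulr1 mul1r.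
        apply: (@le_trans _ _ (a0 * p ^+ N)).
          by rewrite gerDl oppr_le0 mulr_ge0 ?exprn_ge0.
        apply: ler_pM; rewrite ?(ltW a00) ?hr ?exprn_ge0 ?(le_trans q0 (ltW qp))//.
        by rewrite lerXn2r ?nnegrE ?kp ?kern_ge0 ?(le_trans q0 (ltW qp)).
      rewrite mulr0n !mulr0 add0r.
      have [|zD] := boolP (z \in D); last by rewrite !mulr0n !mulr0 !mul0r.
      rewrite inE => zD; rewrite !mulr1n mulr1 mul1r.
      have [zr|zr] := leP `|z| r.
        apply: (@le_trans _ _ 0); first by rewrite oppr_le0 mulr_ge0 ?exprn_ge0.
        by rewrite mulr_ge0 ?exprn_ge0 ?kern_ge0 ?(le_trans (ltW a00))// hr.
      rewrite lerNl -mulNr.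
      apply: (@le_trans _ _ (w * M * kern z ^+ N)).
        rewrite ler_wpM2r ?exprn_ge0 ?kern_ge0//.
        by have := hM z; rewrite ler_norml => /andP[+ _]; rewrite lerNl.
      rewrite ler_wpM2l// lerXn2r ?nnegrE ?kern_ge0//; exact: kq.
  rewrite !ReImE /= !mul0r !subr0 -/vc => h1; rewrite -subr_le0.
  by move: h1; congr (_ <= 0); ring.
have pp : 0 < p by exact: le_lt_trans qp.
have x1 : `|q / p| < 1.
  have qp0 : 0 <= q / p by rewrite divr_ge0// ltW.
  by rewrite (ger0_norm qp0) ltr_pdivrMr// mul1r; lra.
have lim : (w * M * vcell * (q / p) ^+ N) @[N --> \oo] --> (0 : R).
  rewrite -(mulr0 (w * M * vcell)); apply: cvgM; first exact: cvg_cst.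
  exact: cvg_expr.
have av : 0 < a0 * vc by rewrite mulr_gt0.
move/cvgrPdist_lt : lim => /(_ _ av)[N _ /(_ N (leqnn N))].
rewrite sub0r normrN => /= /(le_lt_trans (ler_norm _)).
rewrite expr_div_n mulrA ltr_pdivrMr ?exprn_gt0// ltNge => /negP; apply; exact: key.
Qed.

Lemma cell_coefB (P Q : phase -> R[i]) a (x : R[i]) :
  cintegrable pvol (fun z => (\1_D z)%:C * (P z * chi a z)) ->
  cintegrable pvol (fun z => (\1_D z)%:C * (Q z * chi a z)) ->
  cintegral pvol (fun z => (\1_D z)%:C * (P z * chi a z)) = x ->
  cintegral pvol (fun z => (\1_D z)%:C * (Q z * chi a z)) = vcell%:C * x ->
  cintegral pvol (fun z => (\1_D z)%:C * ((P z - (vcell^-1)%:C * Q z) * chi a z)) = 0.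
Proof.
move=> i1 i2 e1 e2.
transitivity (cintegral pvol (fun z => (\1_D z)%:C * (P z * chi a z) -
    (vcell^-1)%:C * ((\1_D z)%:C * (Q z * chi a z)))).
  by congr cintegral; apply/funext => z; ring.
rewrite (cintegralB i1 (cintegrableZl _ i2)) (cintegralZl _ i2) e1 e2 mulrA -rmorphM.
by rewrite [_^-1 * _]mulVf ?gt_eqF ?vcell_gt0// rmorph1 mul1r subrr.
Qed.

(** The periodization of F minus its Fourier series has zero coefficients, hence
    vanishes at 0. *)
Theorem poisson F : cmeasurable F -> amalgam F ->
  (forall a (u : nat -> phase), `|u k| @[k --> \oo] --> (0 : R) ->
    cvgc (fun k => F (u k + lam a)) (F (lam a))) ->
  let G a := cintegral pvol (fun z => F z * chi a z) in isummable G ->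
  isummable (fun a => F (lam a)) /\
  isum (fun a => F (lam a)) = (vcell^-1)%:C * isum G.
Proof.
move=> mF aF cF G sG.
have fD := fdom_cell uB; have [mD _] := fD; have [Doo _] := pvol_cell uB.
have spl : spread (fun a => lam a).
  apply: (@linear_spread R d (d + d) _ (invmx B)) => [a b|a].
    by rewrite intvB ofcoordsB.
  by rewrite -[LHS]/(coords B _) ofcoordsK.
have [C aC] := amalgam_sum spl aF.
pose Phi z := isum (fun a => F (z + lam a)).
have sPhi z : isummable (fun a => F (z + lam a)) /\ normc (Phi z) <= C.
  have [T [sT FT TC]] := aC z.
  have FT' a : normc (F (z + lam a)) <= T a by apply: FT; rewrite subrr normr0.
  by split; [exact: isummable_le sT FT'|exact: TC].
have mFl a : cmeasurable (fun z => F (z + lam a)).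
  by apply: cmeasurable_comp => //; have [] := phase_shift (lam a).
have mPhi : cmeasurable Phi by exact: cmeasurable_isum.
pose S z := isum (fun a => G a * (chi a z)^*).
have sGn : isummable (fun a => (normc (G a))%:C).
  apply/isummableP; move/isummableP: sG; congr (_ < _)%E; apply: eq_esum => a _.
  by rewrite normcC ger0_norm ?normc_ge0.
have Gn z a : normc (G a * (chi a z)^*) <= normc (G a).
  by rewrite normcM normc_conj normc_chi mulr1.
have mS : cmeasurable S.
  apply: cmeasurable_isum => a; apply: cmeasurableM; first exact: cmeasurable_cst.
  apply: cmeasurableJ; exact: cmeasurable_chi.
pose W z := Phi z - (vcell^-1)%:C * S z.
have SM z : normc (S z) <= Re (isum (fun a => (normc (G a))%:C)).
  exact: normc_isum_le.
have v0 := vcell_gt0.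
have PM z : normc (Phi z) <= C by have [] := sPhi z.
have oW : orth W.
  split.
  - by apply: cmeasurableB => //; apply: cmeasurableM => //; exact: cmeasurable_cst.
  - exists (C + vcell^-1 * Re (isum (fun a => (normc (G a))%:C))) => z.
    rewrite /W -normcN opprB addrC; apply: le_trans (ler_normcD _ _) _; rewrite normcN.
    have vi : 0 <= vcell^-1 by rewrite invr_ge0 ltW.
    apply: lerD; first exact: PM.
    by rewrite normcM normcC (ger0_norm vi); apply: ler_wpM2l => //; exact: SM.
  move=> a.
  have e1 : cintegral pvol (fun z => (\1_D z)%:C * (Phi z * chi a z)) = G a.
    have iFc : cintegrable pvol (fun z => F z * chi a z).
      apply: (cintegrableMb (M := 1)); first exact: amalgam_cintegrable.
        exact: cmeasurable_chi.
      by move=> z; rewrite normc_chi.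
    have [_ e] := unfolding fD iFc; rewrite (e : G a = _); congr cintegral; apply/funext => z.
    rewrite -[RHS]/(isum _).
    under [in RHS]eq_fun do rewrite chi_translate chi_lattice mulr1 (mulrC (F _)) mulrA.
    rewrite isumZl; last by have [] := sPhi z.
    by rewrite -/(Phi z) mulrA mulrAC.
  have e2 : cintegral pvol (fun z => (\1_D z)%:C * (S z * chi a z)) = vcell%:C * G a.
    have jS := jsummable_prod (g := fun b z => chi (a - b) z) (M := 1)
      (cintegral_indic mD Doo).1 sG (fun b => @cmeasurable_chi (a - b))
      (fun b z => normc_chi_le1 (a - b) z).
    have [_ _ e] := jsummable_cintegral jS.
    transitivity (cintegral pvol (fun z => isum (fun b => (\1_D z)%:C * G b * chi (a - b) z))).
      congr cintegral; apply/funext => z; rewrite mulrCA mulrC /S.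
      rewrite -isumZl; last exact: isummable_le sGn (Gn z).
      by congr isum; apply/funext => b; rewrite chiB; ring.
    rewrite e.
    have E b : cintegral pvol (fun z => (\1_D z)%:C * G b * chi (a - b) z) =
        G b * (if a == b then vcell%:C else 0).
      rewrite -subr_eq0 -cell_chi -cintegralZl.
        by congr cintegral; apply/funext => z; ring.
      apply: (cintegrable_cell (M := 1)); first exact: cmeasurable_chi.
      by move=> z; rewrite normc_chi.
    under eq_fun do rewrite E.
    have [|_ ->] := @isum_single R index (fun b => G b * (if a == b then vcell%:C else 0)) a.
      by move=> b ba; rewrite eq_sym (negbTE ba) mulr0.
    by rewrite eqxx mulrC.
  have i1 : cintegrable pvol (fun z => (\1_D z)%:C * (Phi z * chi a z)).
    apply: (cintegrable_cell (M := C)); first by apply: cmeasurableM => //; exact: cmeasurable_chi.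
    move=> z; rewrite normcM normc_chi mulr1; exact: PM.
  have i2 : cintegrable pvol (fun z => (\1_D z)%:C * (S z * chi a z)).
    apply: (cintegrable_cell (M := Re (isum (fun a => (normc (G a))%:C)))).
      by apply: cmeasurableM => //; exact: cmeasurable_chi.
    move=> z; rewrite normcM normc_chi mulr1; exact: SM.
  exact: cell_coefB i1 i2 e1 e2.
have cW : cont0 W.
  apply: sequential_cont0 => u u2 u0.
  apply: cvgcB; last first.
    apply: cvgcM; first exact: cvgc_cst.
    apply: (isum_dominated sGn (fun k a => Gn (u k) a)) => a.
    apply: cvgcM; first exact: cvgc_cst.
    apply: cvgcJ; apply: cvgc_cis2pi; apply: cvg_dot; last exact: cvgv_cst.
    rewrite (_ : coords B 0 = 0); last by rewrite -(subrr 0) coordsB subrr.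
    exact: cvgv_coords.
  have [T [sT FT _]] := aC 0.
  apply: (isum_dominated sT) => [k a|a].
    by apply: FT; rewrite subr0.
  by rewrite add0r; exact: cF.
have := orth_eq0 oW cW; rewrite /W /Phi /S => /eqP; rewrite subr_eq0 => /eqP.
under eq_fun do rewrite add0r.
have -> : (fun a => G a * (chi a 0)^*) = G.
  apply/funext => a; rewrite /chi (_ : coords B 0 = 0); last by rewrite -(subrr 0) coordsB subrr.
  by rewrite dot0l cis2pi0 rmorph1 mulr1.
move=> E; split; last exact: E.
by have [+ _] := sPhi 0; under eq_fun do rewrite add0r.
Qed.

End poisson.

(** * The fundamental identity *)

Section identity.
Context {R : realType} {d : nat}.
Local Notation time := 'rV[R]_d.
Local Notation phase := ('rV[R]_d * 'rV[R]_d)%type.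
Local Notation vol := (volume d : {sigma_finite_measure set 'rV[R]_d -> \bar R}).
Local Notation pvol := (@phase_volume R d : {sigma_finite_measure set phase -> \bar R}).
Local Notation index := 'rV[int]_(d + d).
Implicit Types (f g : time -> R[i]).

Lemma stft_seqcont g f (x w : nat -> time) (y v : time) : nice g -> nice f ->
  cvgv x y -> cvgv w v -> cvgc (fun k => stft g f (x k, w k)) (stft g f (y, v)).
Proof.
move=> ng nf xy wv; have [cg [M gM] _] := ng; have [_ _ fi] := nf.
have mg := nice_cmeasurable ng; have mf := nice_cmeasurable nf.
have mh (a b : time) : cmeasurable (fun t => f t * (g (t - a))^* * cis2pi (- dot b t)).
  apply: cmeasurableM; last by apply: cmeasurable_cis2pi; vmeas.
  by apply: cmeasurableM => //; apply: cmeasurableJ; exact: cmeasurable_shift.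
have M0 : 0 <= M by exact: le_trans (normc_ge0 _) (gM 0).
rewrite stftE; under eq_fun do rewrite stftE.
apply: (cdominated_convergence (g := fun t => normc (M%:C * f t))) => //.
- apply: aeW => t; apply: cvgcM.
    apply: cvgcM; first exact: cvgc_cst.
    by apply: cvgcJ; apply: cg; apply: cvgvB => //; exact: cvgv_cst.
  apply: cvgc_cis2pi; apply: cvgN; apply: cvg_dot => //; exact: cvgv_cst.
- exact: cintegrable_normc (cintegrableZl _ fi).
- move=> k t; rewrite !normcM normc_cis2pi mulr1 normc_conj normcC (ger0_norm M0) mulrC.
  by rewrite ler_wpM2r ?normc_ge0.
Qed.

Lemma amalgam_stftM f1 f2 g1 g2 : nice f2 -> nice g2 -> amalgam (stft g1 f1) ->
  amalgam (fun z => stft g1 f1 z * (stft g2 f2 z)^*).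
Proof.
move=> nf2 ng2; have [_ [M gM] _] := ng2.
have [N VN] := stft_le nf2 (nice_cmeasurable ng2) gM.
by apply: amalgam_Mb => z; rewrite normcM normc_conj ler_wpM2l ?normc_ge0.
Qed.

(** All fundamental domains have the same measure, so the one chosen by
    [covolume] may be replaced by the cell. *)
Lemma covolumeE (L : zmodClosed phase) (B : 'M[R]_(d + d)) : B \in unitmx ->
  (forall z, z \in L <-> exists a, z = ofcoords B (intv a)) -> covolume L = vcell B.
Proof.
move=> uB LB.
have fund D : fundamental_domain L D <-> fdom B D.
  split=> -[mD uD]; split=> // z.
    have [w [[Dw /LB[a wa]] uw]] := uD z; exists a.
    have zw : w = z - ofcoords B (intv a) by rewrite -wa subKr.
    split=> [|b Db]; first by rewrite -zw.
    have /uw : D (z - ofcoords B (intv b)) /\ z - (z - ofcoords B (intv b)) \in L.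
      by split=> //; apply/LB; exists b; rewrite subKr.
    rewrite zw => /addrI/oppr_inj/(congr1 (coords B)); rewrite !ofcoordsK//.
    exact: intv_inj.
  have [a [Da ua]] := uD z; exists (z - ofcoords B (intv a)); split.
    by split=> //; apply/LB; exists a; rewrite subKr.
  move=> w [Dw /LB[b wb]].
  have zw : w = z - ofcoords B (intv b) by rewrite -wb subKr.
  by rewrite zw (ua b)// -zw.
have fD := fdom_cell uB; have [Doo _] := pvol_cell uB.
rewrite /covolume; case: xgetP => [D _ /fund fD'|/(_ (cell B))]; last by move/fund.
exact: (fdom_measure uB fD fD' Doo).
Qed.

Lemma isummable_spread (pt : index -> phase) U : spread pt -> amalgam U ->
  isummable (fun a => U (pt a)).
Proof.
move=> sp aU; have [C /(_ 0)[T [sT UT _]]] := amalgam_sum sp aU.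
apply: (isummable_le sT) => a.
by have := UT a 0; rewrite subr0 normr0 add0r; apply; rewrite invr_ge0.
Qed.

(** Poisson summation for F, whose Fourier coefficients are given by [moyal]. *)
Lemma fundamental_identity (L : zmodClosed phase) f1 f2 g1 g2 : lattice L ->
  nice f1 -> nice f2 -> nice g1 -> nice g2 ->
  amalgam (stft g1 f1) -> amalgam (stft g1 g2) ->
  let F := fun l => stft g1 f1 l * (stft g2 f2 l)^* in
  let G := fun l => stft g1 g2 l * (stft f1 f2 l)^* in
  [/\ csummable [set` L] F, csummable (adjoint_lattice L) G &
      csum [set` L] F = ((covolume L)^-1)%:C * csum (adjoint_lattice L) G].
Proof.
move=> lL nf1 nf2 ng1 ng2 aF aG F G.
have [B uB [LB LoB]] := lattice_basis lL.
have mf1 := nice_cmeasurable nf1; have mf2 := nice_cmeasurable nf2.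
have mg1 := nice_cmeasurable ng1; have mg2 := nice_cmeasurable ng2.
have mF : cmeasurable F.
  by apply: cmeasurableM; [|apply: cmeasurableJ]; exact: cmeasurable_stft.
have spd : spread (fun a : index => dual B (intv a)).
  apply: (@linear_spread R d (d + d) _ (symplectic^T *m B^T)) => [a b|a].
    by rewrite intvB dualB.
  exact: dualK.
have FG a : cintegral pvol (fun z => F z * chi B a z) = G (dual B (intv a)).
  rewrite /G -(moyal (dual B (intv a)) nf1 nf2 ng1 ng2); last first.
    by apply: amalgam_cintegrable => //; exact: cmeasurable_stft.
  by congr cintegral; apply/funext => z; rewrite /chi Omega_dual.
have sG : isummable (fun a => G (dual B (intv a))).
  by apply: (isummable_spread spd); exact: amalgam_stftM.
have cF a (u : nat -> phase) : `|u k| @[k --> \oo] --> (0 : R) ->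
    cvgc (fun k => F (u k + ofcoords B (intv a))) (F (ofcoords B (intv a))).
  move=> u0; set p := ofcoords B (intv a).
  have c1 : cvgv (fun k => (u k).1 + p.1) p.1.
    rewrite -[X in cvgv _ X]add0r; apply: cvgvD; last exact: cvgv_cst.
    by apply: cvgv_norm u0 => k; rewrite prod_normE le_max lexx.
  have c2 : cvgv (fun k => (u k).2 + p.2) p.2.
    rewrite -[X in cvgv _ X]add0r; apply: cvgvD; last exact: cvgv_cst.
    by apply: cvgv_norm u0 => k; rewrite prod_normE le_max lexx orbT.
  rewrite /F (surjective_pairing p); apply: cvgcM.
    exact: (stft_seqcont ng1 nf1 c1 c2).
  by apply: cvgcJ; exact: (stft_seqcont ng2 nf2 c1 c2).
have FGE : (fun a => cintegral pvol (fun z => F z * chi B a z)) =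
    fun a => G (dual B (intv a)) by apply/funext.
have [] := poisson uB mF (amalgam_stftM nf2 ng2 aF) cF.
  by rewrite FGE.
rewrite FGE -(covolumeE uB LB) => sF eF.
have bL : set_bij [set: index] [set` L] (fun a => ofcoords B (intv a)).
  split=> [a _|a b _ _ ab|z /= /LB[a ->]]; last by exists a.
    by apply/LB; exists a.
  by apply: (@intv_inj R); apply: (can_inj (ofcoordsK uB)).
have bLo : set_bij [set: index] (adjoint_lattice L) (fun a => dual B (intv a)).
  split=> [a _|a b _ _ ab|z /= /LoB[a ->]]; last by exists a.
    by apply/LoB; exists a.
  by apply: (@intv_inj R); rewrite -(dualK uB (intv a)) ab dualK.
have [cF' ->] := csum_isum (F := F) bL sF.
have [cG' ->] := csum_isum (F := G) bLo sG.
by split => //; exact: eF.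
Qed.

End identity.

Theorem theorem4p5 (R : realType) (d : nat)
    (phi : 'rV[R]_d -> R[i]) (phi_schwartz : schwartz phi)
    (phi_neq0 : exists t, phi t <> 0)
    (L : zmodClosed ('rV[R]_d * 'rV[R]_d)%type) (latticeL : lattice L)
    (f1 f2 g1 g2 : 'rV[R]_d -> R[i])
    (f1_M1 : M1 phi f1) (f2_M1 : M1 phi f2)
    (g1_M1 : M1 phi g1) (g2_M1 : M1 phi g2) :
  let F := fun l => stft g1 f1 l * (stft g2 f2 l)^* in
  let G := fun l => stft g1 g2 l * (stft f1 f2 l)^* in
  [/\ csummable [set` L] F,
      csummable (adjoint_lattice L) G &
      csum [set` L] F = ((covolume L)^-1)%:C * csum (adjoint_lattice L) G].
Proof.
have [gam [ng ag synthM1]] := M1_synth phi_schwartz phi_neq0.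
have [A1 iA1 e1] := synthM1 _ f1_M1; have [A2 iA2 e2] := synthM1 _ f2_M1.
have [B1 iB1 h1] := synthM1 _ g1_M1; have [B2 iB2 h2] := synthM1 _ g2_M1.
have mM1 f : M1 phi f -> cmeasurable f by case=> -[].
have mS A : cintegrable (phase_volume (R:=R)) A -> cmeasurable (synth gam A).
  by move=> iA; apply: nice_cmeasurable; exact: nice_synth.
have e11 : stft g1 f1 = stft (synth gam B1) (synth gam A1).
  by apply: stft_ae_eq; [exact: mM1|exact: mS|exact: mM1|exact: mS|..].
have e22 : stft g2 f2 = stft (synth gam B2) (synth gam A2).
  by apply: stft_ae_eq; [exact: mM1|exact: mS|exact: mM1|exact: mS|..].
have e12 : stft g1 g2 = stft (synth gam B1) (synth gam B2).
  by apply: stft_ae_eq; [exact: mM1|exact: mS|exact: mM1|exact: mS|..].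
have e21 : stft f1 f2 = stft (synth gam A1) (synth gam A2).
  by apply: stft_ae_eq; [exact: mM1|exact: mS|exact: mM1|exact: mS|..].
rewrite e11 e22 e12 e21.
apply: fundamental_identity => //; try exact: nice_synth.
- exact: amalgam_stft_synth2.
- exact: amalgam_stft_synth2.
Qed.
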